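(* Let $\Bbbk$ be an algebraically closed field of characteristic $p>0$ and let $H$ be a non-cosemisimple Hopf algebra of dimension $p^n$ over $\Bbbk$ for some integer $n\ge 1$. If $|G(H)|=p^{n-1}$, then $H$ is pointed.
   Context: For a Hopf algebra $H$, $G(H)$ denotes the group of group-like elements (nonzero $g\in H$ with $\Delta(g)=g\otimes g$). The coradical $H_0$ is the sum of all simple subcoalgebras of $H$. $H$ is cosemisimple if $H=H_0$, and pointed if $H_0=\Bbbk[G(H)]$, the linear span of $G(H)$. *)

(* Defs.v *)
From HB Require Import structures.
From mathcomp Require Import all_boot all_order all_algebra all_field.

Set Implicit Arguments.
Unset Strict Implicit.
Unset Printing Implicit Defensive.

Import GRing.Theory.
Local Open Scope ring_scope.

(* U (x) V is modelled by coordinate matrices with respect to the bases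
   vbasis {:U} and vbasis {:V}; tlift_pure and tlift_uniq below are its
   universal property, so nothing depends on the choice of these bases. *)
Definition tensor (k : fieldType) (U V : vectType k) : vectType k :=
  'M[k]_(\dim {:U}, \dim {:V}).

Definition tpure (k : fieldType) (U V : vectType k) (u : U) (v : V) :
    tensor U V :=
  \matrix_(i, j) (coord (vbasis {:U}) i u * coord (vbasis {:V}) j v).

Notation "u ⊗ v" := (tpure u v) (at level 40, left associativity) : ring_scope.

(* The linear map U (x) V -> W induced by a bilinear map f : U -> V -> W, i.e.
   tlift f t is the Sweedler sum of the f t_(1) t_(2). *)
Definition tlift (k : fieldType) (U V W : vectType k) (f : U -> V -> W)
    (t : tensor U V) : W :=
  \sum_i \sum_j (t : 'M_(_, _)) i j *: f (vbasis {:U})`_i (vbasis {:V})`_j.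

Definition tmap (k : fieldType) (U V U' V' : vectType k)
    (f : U -> U') (g : V -> V') : tensor U V -> tensor U' V' :=
  tlift (fun u v => f u ⊗ g v).

Definition tassoc (k : fieldType) (U V W : vectType k) :
    tensor (tensor U V) W -> tensor U (tensor V W) :=
  tlift (fun (s : tensor U V) w => tlift (fun u v => u ⊗ (v ⊗ w)) s).

Definition tmul (k : fieldType) (A B : falgType k) (s t : tensor A B) :
    tensor A B :=
  tlift (fun a b => tlift (fun c d => (a * c) ⊗ (b * d)) t) s.

Definition tspace (k : fieldType) (U V : vectType k)
    (C : {vspace U}) (D : {vspace V}) : {vspace tensor U V} :=
  <<[seq c ⊗ d | c <- vbasis C, d <- vbasis D]>>%VS.

Definition bilin (k : fieldType) (U V W : vectType k) (f : U -> V -> W) :=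
  (forall v a u u', f (a *: u + u') v = a *: f u v + f u' v) /\
  (forall u a v v', f u (a *: v + v') = a *: f u v + f u v').

Section TensorTheory.

Context (k : fieldType).
Implicit Types U V W : vectType k.

Lemma tpure_bilin U V : bilin (@tpure k U V).
Proof.
split=> [v a u u' | u a v v']; apply/matrixP=> i j;
  rewrite !mxE linearP /=; first by rewrite mulrDl mulrA.
by rewrite mulrDr !mulrA (mulrC _ a).
Qed.

Lemma bilin_suml U V W (f : U -> V -> W) (I : Type) (r : seq I) c u v :
  bilin f -> f (\sum_(i <- r) c i *: u i) v = \sum_(i <- r) c i *: f (u i) v.
Proof.
case=> fl _; have f0: f 0 v = 0.
  by have := fl v (-1) 0 0; rewrite scaler0 addr0 scaleN1r addNr.
by elim: r => [|i r IHr]; rewrite ?big_nil // !big_cons fl IHr.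
Qed.

Lemma bilin_sumr U V W (f : U -> V -> W) (I : Type) (r : seq I) c u v :
  bilin f -> f u (\sum_(i <- r) c i *: v i) = \sum_(i <- r) c i *: f u (v i).
Proof.
case=> fl fr; apply: (@bilin_suml V U W (fun v u => f u v)).
by split.
Qed.

Lemma tlift_is_linear U V W (f : U -> V -> W) : linear (tlift f).
Proof.
move=> a s t; rewrite /tlift scaler_sumr -big_split; apply: eq_bigr => i _ /=.
rewrite scaler_sumr -big_split; apply: eq_bigr => j _ /=.
by rewrite !mxE scalerDl scalerA.
Qed.

Lemma tlift_pure U V W (f : U -> V -> W) u v :
  bilin f -> tlift f (u ⊗ v) = f u v.
Proof.
move=> f_bl; rewrite {2}(coord_vbasis (memvf u)) bilin_suml //.
rewrite /tlift; apply: eq_bigr => i _.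
rewrite {2}(coord_vbasis (memvf v)) bilin_sumr // scaler_sumr.
by apply: eq_bigr => j _; rewrite mxE scalerA.
Qed.

Lemma tlift_uniq U V W (f : U -> V -> W) (g : {linear tensor U V -> W}) :
  (forall u v, g (u ⊗ v) = f u v) -> g =1 tlift f.
Proof.
move=> gE t; rewrite /tlift.
have {1}->: t = \sum_i \sum_j (t : 'M_(_, _)) i j *:
    ((vbasis {:U})`_i ⊗ (vbasis {:V})`_j).
  rewrite {1}[t]matrix_sum_delta; apply: eq_bigr => i _.
  apply: eq_bigr => j _; congr (_ *: _); apply/matrixP => i' j'.
  by rewrite !mxE !coord_free ?(basis_free (vbasisP _)) // -natrM mulnb
    ![_ == i']eq_sym ![_ == j']eq_sym.
rewrite linear_sum; apply: eq_bigr => i _; rewrite linear_sum.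
by apply: eq_bigr => j _; rewrite linearZ gE.
Qed.

Lemma eq_tlift U V W (f g : U -> V -> W) : f =2 g -> tlift f =1 tlift g.
Proof.
by move=> fg t; apply: eq_bigr => i _; apply: eq_bigr => j _; rewrite fg.
Qed.

Lemma tmap_pure U V U' V' (f : {linear U -> U'}) (g : {linear V -> V'}) u v :
  tmap f g (u ⊗ v) = f u ⊗ g v.
Proof.
have [tl tr] := @tpure_bilin U' V'.
by apply: tlift_pure; split=> *; rewrite linearP ?tl ?tr.
Qed.

Lemma tassoc_pure U V W (u : U) (v : V) (w : W) :
  tassoc (u ⊗ v ⊗ w) = u ⊗ (v ⊗ w).
Proof.
have inner (x : W) : bilin (fun (u : U) (v : V) => u ⊗ (v ⊗ x)).
  have [tl tr] := @tpure_bilin U (tensor V W).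
  have [tl' _] := @tpure_bilin V W.
  by split=> * /=; [rewrite tl | rewrite tl' tr].
rewrite /tassoc tlift_pure ?tlift_pure //; split=> [x|s] a.
  by move=> s t; rewrite tlift_is_linear.
have [_ tr] := @tpure_bilin U (tensor V W).
have [_ tr'] := @tpure_bilin V W.
move=> x y; rewrite /tlift scaler_sumr -big_split; apply: eq_bigr => i _ /=.
rewrite scaler_sumr -big_split; apply: eq_bigr => j _ /=.
by rewrite tr' tr scalerDr !scalerA mulrC.
Qed.

Lemma tmul_pure (A B : falgType k) (a c : A) (b d : B) :
  tmul (a ⊗ b) (c ⊗ d) = (a * c) ⊗ (b * d).
Proof.
have [tl tr] := @tpure_bilin A B.
have inner (x : A) (y : B) : bilin (fun c d => (x * c) ⊗ (y * d)).
  by split=> *; rewrite mulrDr -scalerAr ?tl ?tr.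
rewrite /tmul (eq_tlift (g := fun x y => (x * c) ⊗ (y * d))); last first.
  by move=> x y; rewrite tlift_pure.
by rewrite tlift_pure //; split=> *; rewrite mulrDl -scalerAl ?tl ?tr.
Qed.

Lemma mem_tspace U V (C : {vspace U}) (D : {vspace V}) u v :
  u \in C -> v \in D -> u ⊗ v \in tspace C D.
Proof.
move=> uC vD; rewrite (coord_vbasis uC) (bilin_suml _ _ _ _ (@tpure_bilin U V)).
apply: memv_suml => i _; apply: memvZ.
rewrite (coord_vbasis vD) (bilin_sumr _ _ _ _ (@tpure_bilin U V)).
apply: memv_suml => j _; apply/memvZ/memv_span/allpairs_f;
  by rewrite mem_nth // size_tuple.
Qed.

End TensorTheory.

HB.mixin Record Vector_isCoalgebra (k : fieldType) C of Vector k C := {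
  comul : 'Hom(C, tensor C C);
  counit : 'Hom(C, k^o);
  comulA : forall x : C,
    tassoc (tmap comul id (comul x)) = tmap id comul (comul x);
  counitl : forall x : C, tlift (fun a b => counit a *: b) (comul x) = x;
  counitr : forall x : C, tlift (fun a b => counit b *: a) (comul x) = x
}.

#[short(type="coalgType")]
HB.structure Definition Coalgebra (k : fieldType) :=
  { C of Vector k C & Vector_isCoalgebra k C }.

HB.mixin Record Coalgebra_isHopf (k : fieldType) H
    of Falgebra k H & Coalgebra k H := {
  antipode : 'End(H);
  comul1 : comul (1 : H) = 1 ⊗ 1;
  comulM : forall x y : H, comul (x * y) = tmul (comul x) (comul y);
  counit1 : counit (1 : H) = 1;
  counitM : forall x y : H, counit (x * y) = counit x * counit y;
  antipodel : forall x : H,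
    tlift (fun a b => antipode a * b) (comul x) = counit x *: 1;
  antipoder : forall x : H,
    tlift (fun a b => a * antipode b) (comul x) = counit x *: 1
}.

(* Finite-dimensional Hopf algebras over k. *)
#[short(type="hopfType")]
HB.structure Definition Hopf (k : fieldType) :=
  { H of Falgebra k H & Coalgebra k H & Coalgebra_isHopf k H }.

Definition grouplike (k : fieldType) (C : coalgType k) : pred C :=
  fun g => (g != 0) && (comul g == g ⊗ g).

Definition has_card (T : eqType) (P : pred T) (m : nat) : Prop :=
  exists s : seq T, [/\ uniq s, s =i P & size s = m].

Definition in_span (k : fieldType) (V : vectType k) (P : pred V) (x : V) :
    Prop :=
  exists2 s : seq V, all P s & x \in <<s>>%VS.

Definition subcoalgebra (k : fieldType) (C : coalgType k) (D : {vspace C}) :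
    bool :=
  (comul @: D <= tspace D D)%VS.

Definition simple_subcoalgebra (k : fieldType) (C : coalgType k)
    (D : {vspace C}) : Prop :=
  [/\ subcoalgebra D, D != 0%VS
    & forall E : {vspace C},
        subcoalgebra E -> (E <= D)%VS -> E = 0%VS \/ E = D].

(* x lies in the sum of all simple subcoalgebras, i.e. in a finite sum of
   simple subcoalgebras. *)
Definition coradical (k : fieldType) (C : coalgType k) (x : C) : Prop :=
  exists2 s : seq {vspace C},
    (forall D, D \in s -> simple_subcoalgebra D) & x \in (\sum_(D <- s) D)%VS.

Definition cosemisimple (k : fieldType) (C : coalgType k) : Prop :=
  forall x : C, coradical x.

Definition pointed (k : fieldType) (C : coalgType k) : Prop :=
  forall x : C, coradical x <-> in_span (@grouplike k C) x.

(* Main.v *)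
(* Let G = G(H), N the sum of the elements of G, and S the antipode.  The left
   ideal H N has dimension p: H is free over k[G] because G is a p-group and k
   has characteristic p.  Convolution by functionals that are constant on cosets
   gives an algebra BB of operators on H N that is normalized by S^2.
   - For a functional f with coset sums f', the trace of S^2 composed with the
     convolution by f' on H N is the value at N of the right integral
     x |-> Tr (h |-> f(h1) S^2(h2) x).  As H is not cosemisimple, right
     integrals vanish on G, so this trace is 0.
   - By Radford's formula S^4 is, on H N, a product of commuting operators of
     p-power order: translations by a character are unipotent when dim H is a
     power of p.  So the eigenvalues of S^2 on H N are 1 and -1; as its trace is
     0 and dim H N = p, S^2 is unipotent.
   - The trace condition forces every idempotent of BB fixing N to have rank p;
     hence the operators of BB that kill N are nilpotent.
   For a nonzero subcoalgebra D, the space D N is stable under BB, so it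
   contains a nonzero vector killed by all these operators; this yields x in D
   with x N = N.  If D contained no element of G, a product of functionals would
   separate D N from N.  So every simple subcoalgebra is spanned by a grouplike
   element. *)

Require Import Defs.
From HB Require Import structures.
From mathcomp Require Import all_boot all_order all_algebra all_field.
From mathcomp Require Import all_fingroup all_solvable all_character ring.

Set Implicit Arguments.
Unset Strict Implicit.
Unset Printing Implicit Defensive.

Import GRing.Theory.
Local Open Scope ring_scope.

(** * Linear maps and Sweedler sums *)

(** The map h |-> h N identifies H N with the quotient coalgebra H / H k[G]^+, and the functionals
    constant on cosets with the dual algebra of this quotient; BB is its image and is not assumed
    commutative. The aim is that BB is local, with the action on N as residue map. In characteristic
    p the trace of an idempotent is its rank modulo p, so vanishing traces on BB would exclude every
    rank strictly between 0 and p. The obstacle is that the trace vanishes only after composition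
    with S^2. The remedy compares an idempotent E with T = E S^2 E: as S^2 is unipotent and
    normalizes BB, the p-th power of T falls back into BB and differs from E by some Y that kills N.
    If Y is nilpotent, T and E have the same trace, which settles E; if not, a polynomial in Y
    without constant term is a nonzero idempotent that kills N, and subtracting it from E starts a
    descent on the rank. Twice a number below dim H N = p must be 0 because p divides it: a rank,
    and the multiplicity of the eigenvalue -1 of S^2. *)

HB.instance Definition _ (k : fieldType) (U V W : vectType k)
    (f : U -> V -> W) :=
  GRing.isLinear.Build k _ _ _ (tlift f) (tlift_is_linear f).

(** Linearity is a predicate on plain functions, so that the tactic [lin] can establish it for
    arbitrary lambda terms such as nested Sweedler sums. *)
Definition lin (k : fieldType) (U V : vectType k) (f : U -> V) : Prop :=
  forall c x y, f (c *: x + y) = c *: f x + f y.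

Section Lin.
Context (k : fieldType) (U V W X : vectType k).

Lemma lin_add (f : U -> V) x y : lin f -> f (x + y) = f x + f y.
Proof. by move=> fl; rewrite -[x]scale1r fl !scale1r. Qed.

Lemma lin_0 (f : U -> V) : lin f -> f 0 = 0.
Proof. by move=> fl; apply: (addrI (f 0)); rewrite -lin_add // !addr0. Qed.

Lemma lin_scale (f : U -> V) c x : lin f -> f (c *: x) = c *: f x.
Proof. by move=> fl; rewrite -[c *: x]addr0 fl lin_0 // !addr0. Qed.

Lemma lin_sum (f : U -> V) I (r : seq I) P (F : I -> U) :
  lin f -> f (\sum_(i <- r | P i) F i) = \sum_(i <- r | P i) f (F i).
Proof.
by move=> fl; apply: (big_morph f) => [x y|]; rewrite ?lin_add ?lin_0.
Qed.

Lemma lin_id : lin (fun x : U => x). Proof. by []. Qed.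

Lemma lin_comp (g : V -> W) (f : U -> V) :
  lin g -> lin f -> lin (fun x => g (f x)).
Proof. by move=> gl fl c x y; rewrite fl gl. Qed.

Lemma lin_app (L : {linear V -> W}) (f : U -> V) :
  lin f -> lin (fun x => L (f x)).
Proof. by move=> fl c x y; rewrite fl linearP. Qed.

Lemma lin_scaler (c : k) (f : U -> V) : lin f -> lin (fun x => c *: f x).
Proof. by move=> fl a x y; rewrite fl scalerDr !scalerA mulrC. Qed.

Lemma lin_scalel (f : U -> k^o) (v : V) : lin f -> lin (fun x => f x *: v).
Proof. by move=> fl a x y; rewrite fl scalerDl scalerA. Qed.

Lemma lin_addf (f g : U -> V) : lin f -> lin g -> lin (fun x => f x + g x).
Proof. by move=> fl gl a x y; rewrite fl gl scalerDr addrACA. Qed.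

Lemma lin_sumf I (r : seq I) P (F : I -> U -> V) :
  (forall i, lin (F i)) -> lin (fun x => \sum_(i <- r | P i) F i x).
Proof.
move=> Fl a x y; rewrite scaler_sumr -big_split; apply: eq_bigr => i _.
exact: Fl.
Qed.

Lemma lin_hom (f : U -> V) : lin f -> exists L : 'Hom(U, V), L =1 f.
Proof.
move=> fl; pose f' : {linear U -> V} :=
  HB.pack f (GRing.isLinear.Build k U V _ f fl).
by exists (linfun f') => x; rewrite lfunE.
Qed.

End Lin.

Arguments lin_sumf {k U V I r P F}.

Section LinTensor.
Context (k : fieldType) (U V W X : vectType k).

Lemma lin_tlift (F : U -> V -> W) (f : X -> tensor U V) :
  lin f -> lin (fun x => tlift F (f x)).
Proof. by move=> fl c x y; rewrite fl linearP. Qed.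

Lemma lin_tlift_fun (F : U -> V -> W -> X) t :
  (forall a b, lin (F a b)) -> lin (fun x => tlift (fun a b => F a b x) t).
Proof.
move=> Fl; rewrite /tlift.
apply: (lin_sumf (F := fun i x =>
  \sum_j (t : 'M_(_, _)) i j *: F (vbasis {:U})`_i (vbasis {:V})`_j x)) => i.
apply: (lin_sumf (F := fun j x =>
  (t : 'M_(_, _)) i j *: F (vbasis {:U})`_i (vbasis {:V})`_j x)) => j.
exact: lin_scaler.
Qed.

Lemma lin_tpurel (v : V) : lin (fun u : U => u ⊗ v).
Proof. by move=> c x y; have [-> _] := tpure_bilin U V. Qed.

Lemma lin_tpurer (u : U) : lin (fun v : V => u ⊗ v).
Proof. by move=> c x y; have [_ ->] := tpure_bilin U V. Qed.

Lemma lin_linear (f : {linear U -> V}) : lin f.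
Proof. by move=> c x y; rewrite linearP. Qed.

End LinTensor.

Section LinAlg.
Context (k : fieldType) (U : vectType k) (A : falgType k).
Lemma lin_mull (a : A) (f : U -> A) : lin f -> lin (fun x => a * f x).
Proof. by move=> fl c x y; rewrite fl mulrDr scalerAr. Qed.
Lemma lin_mulr (a : A) (f : U -> A) : lin f -> lin (fun x => f x * a).
Proof. by move=> fl c x y; rewrite fl mulrDl scalerAl. Qed.
Lemma lin_kmull (a : k) (f : U -> k^o) : lin f -> lin (fun x => a * f x : k^o).
Proof. by move=> fl c x y; rewrite fl mulrDr /GRing.scale /= mulrCA. Qed.
Lemma lin_kmulr (a : k) (f : U -> k^o) : lin f -> lin (fun x => f x * a : k^o).
Proof. by move=> fl c x y; rewrite fl mulrDl /GRing.scale /= mulrA. Qed.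
End LinAlg.

Arguments lin_tpurel {k U V}.
Arguments lin_tpurer {k U V}.
Arguments lin_comp {k U V W g f}.
Arguments lin_app {k U V W} L {f}.
Arguments lin_tlift {k U V W X F f}.
Arguments lin_tlift_fun {k U V W X F t}.
Arguments lin_addf {k U V f g}.
Arguments lin_scaler {k U V c f}.
Arguments lin_scalel {k U V f v}.
Arguments lin_mull {k U A a f}.
Arguments lin_mulr {k U A a f}.
Arguments lin_kmull {k U a f}.
Arguments lin_kmulr {k U a f}.

Definition sw (k : fieldType) (C : coalgType k) (W : vectType k)
  (F : C -> C -> W) (x : C) : W := tlift F (comul x).

Notation "\sw_ ( a , b <- x ) F" := (sw (fun a b => F) x)
  (at level 41, F at level 41, a, b at level 0, x at level 60,
   format "\sw_ ( a ,  b  <-  x )  F").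

Lemma lin_sw (k : fieldType) (C : coalgType k) (U W : vectType k)
  (F : C -> C -> W) (f : U -> C) : lin f -> lin (fun x => sw F (f x)).
Proof. by move=> fl; apply/lin_tlift/lin_app. Qed.

Lemma lin_sw_fun (k : fieldType) (C : coalgType k) (U W : vectType k)
    (F : C -> C -> U -> W) (x : C) :
  (forall a b, lin (F a b)) -> lin (fun u => \sw_(a, b <- x) F a b u).
Proof. exact: lin_tlift_fun. Qed.

Arguments lin_sw {k C U W F f}.
Arguments lin_sw_fun {k C U W F x}.

Lemma lin_coord (k : fieldType) (V : vectType k) n (X : n.-tuple V) i :
  lin (coord X i : V -> k^o).
Proof. by move=> c x y; rewrite linearP. Qed.

Ltac lin_step :=
  match goal with
  | |- lin (fun x => x) => refine (@lin_id _ _)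
  | |- lin (fun x => @sw _ _ _ (@?F x) ?y) =>
      refine (lin_sw_fun (F := fun a b x => F x a b) _); intros ? ?
  | |- lin (fun x => @sw _ _ _ ?F (@?f x)) => refine (lin_sw (f := f) _)
  | |- lin (fun x => @tlift _ _ _ _ (@?F x) ?y) =>
      refine (lin_tlift_fun (F := fun a b x => F x a b) _); intros ? ?
  | |- lin (fun x => @tlift _ _ _ _ ?F (@?f x)) =>
      refine (lin_tlift (f := f) _)
  | |- lin (fun x => @tpure _ _ _ (@?f x) ?v) =>
      refine (lin_comp (lin_tpurel v) (f := f) _)
  | |- lin (fun x => @tpure _ _ _ ?u (@?f x)) =>
      refine (lin_comp (lin_tpurer u) (f := f) _)
  | |- lin (fun x => @GRing.scale _ _ ?c (@?f x)) =>
      refine (lin_scaler (f := f) _)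
  | |- lin (fun x => @GRing.scale _ _ (@?f x) ?v) =>
      refine (lin_scalel (f := f) _)
  | |- lin (fun x => @GRing.mul _ ?c (@?f x)) =>
      first [refine (lin_mull (f := f) _) | refine (lin_kmull (f := f) _)]
  | |- lin (fun x => @GRing.mul _ (@?f x) ?c) =>
      first [refine (lin_mulr (f := f) _) | refine (lin_kmulr (f := f) _)]
  | |- lin (fun x => @GRing.add _ (@?f x) (@?g x)) =>
      refine (lin_addf (f := f) (g := g) _ _)
  | |- @lin ?K ?U ?V (fun x => bigop.body _ ?r
          (fun i => BigBody i _ ?P (@?G x i))) =>
      refine (@lin_sumf K U V _ _ _ (fun i x => G x i) _); intros ?
  | |- lin (fun x => @fun_of_lfun _ _ _ ?L (@?f x)) =>
      refine (lin_app L (f := f) _)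
  | |- lin (fun x => @coord _ _ _ ?X ?i (@?f x)) =>
      refine (lin_comp (lin_coord X i) (f := f) _)
  | |- lin (@sw _ _ _ ?F) => refine (lin_sw (f := fun x => x) _)
  | |- lin (@coord _ _ _ ?X ?i) => refine (lin_coord X i)
  | h : lin ?f |- lin ?f => exact h
  | h : forall _, lin _ |- lin _ => exact (h _)
  | h : forall _ _, lin _ |- lin _ => exact (h _ _)
  | h : lin ?g |- lin (fun x => ?g (@?f x)) => refine (lin_comp h (f := f) _)
  | h : forall _, lin _ |- lin (fun x => _ (@?f x) _) =>
      refine (lin_comp (h _) (f := f) _)
  | h : forall _, lin _ |- lin (fun x => _ _ (@?f x)) =>
      refine (lin_comp (h _) (f := f) _)
  | |- lin (fun_of_lfun _) => refine (@lin_linear _ _ _ _)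
  end; cbv beta.
Ltac lin := repeat (intros; lin_step).
#[export] Hint Extern 0 (lin _) => solve [lin] : core.
#[export] Hint Extern 0 (forall _, lin _) => solve [lin] : core.

Section Sweedler.
Context (k : fieldType) (C : coalgType k).
Implicit Types (W V : vectType k) (x y : C).

Lemma eq_sw W (F G : C -> C -> W) x : (forall a b, F a b = G a b) ->
  sw F x = sw G x.
Proof. by move=> FG; apply: eq_tlift. Qed.

Lemma sw_eq0 W (F : C -> C -> W) x : (forall a b, F a b = 0) -> sw F x = 0.
Proof.
by move=> F0; apply: big1 => i _; apply: big1 => j _; rewrite F0 scaler0.
Qed.

(* At type [k]: [k^o] is convertible to it, but rewriting does not see this. *)
Lemma eq_swk (F G : C -> C -> k) x : (forall a b, F a b = G a b) ->
  sw (F : C -> C -> k^o) x = sw (G : C -> C -> k^o) x :> k.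
Proof. exact: (@eq_sw k^o). Qed.

Lemma memv_sw W (P : {vspace W}) (F : C -> C -> W) x :
  (forall a b, F a b \in P) -> sw F x \in P.
Proof. by move=> FP; do 2!apply: memv_suml => ? _; apply: memvZ. Qed.

Lemma lin_tliftE (U V' V W : vectType k) (g : V -> W) (F : U -> V' -> V) t :
  lin g ->
  g (tlift F t) = tlift (fun a b => g (F a b)) t.
Proof.
move=> gl; rewrite /tlift lin_sum //; apply: eq_bigr => i _.
by rewrite lin_sum //; apply: eq_bigr => j _; rewrite lin_scale.
Qed.

Lemma lin_swE V W (g : V -> W) (F : C -> C -> V) x : lin g ->
  g (sw F x) = \sw_(a, b <- x) g (F a b).
Proof. exact: lin_tliftE. Qed.

Lemma sw_scale W (c : k) (F : C -> C -> W) x :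
  \sw_(a, b <- x) (c *: F a b) = c *: sw F x.
Proof. by rewrite (lin_swE (g := fun v => c *: v)) //; lin. Qed.

Lemma sw_add W (F G : C -> C -> W) x :
  \sw_(a, b <- x) (F a b + G a b) = sw F x + sw G x.
Proof.
rewrite /sw /tlift -big_split; apply: eq_bigr => i _ /=.
by rewrite -big_split; apply: eq_bigr => j _; rewrite scalerDr.
Qed.

Lemma sw_sub W (F G : C -> C -> W) x :
  \sw_(a, b <- x) (F a b - G a b) = sw F x - sw G x.
Proof.
rewrite -scaleN1r -sw_scale -sw_add; apply: eq_sw => a b.
by rewrite scaleN1r.
Qed.

Lemma sw_sum W I (r : seq I) P (F : I -> C -> C -> W) x :
  \sw_(a, b <- x) (\sum_(i <- r | P i) F i a b)
    = \sum_(i <- r | P i) sw (F i) x.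
Proof.
rewrite /sw /tlift [RHS]exchange_big /=; apply: eq_bigr => i _.
rewrite [RHS]exchange_big /=; apply: eq_bigr => j _.
by rewrite scaler_sumr.
Qed.

Lemma exchange_sw (C' : coalgType k) W (F : C -> C -> C' -> C' -> W) x
    (y : C') :
  \sw_(a, b <- x) \sw_(c, d <- y) F a b c d
    = \sw_(c, d <- y) \sw_(a, b <- x) F a b c d.
Proof.
pose G i j c d := F (vbasis {:C})`_i (vbasis {:C})`_j c d.
transitivity (\sw_(c, d <- y) \sum_i \sum_j
    (comul x : 'M_(_, _)) i j *: G i j c d) => //.
rewrite sw_sum; apply: eq_bigr => i _.
by rewrite sw_sum; apply: eq_bigr => j _; rewrite sw_scale.
Qed.

Lemma swl W (f : C -> W) x : lin f ->
  \sw_(a, b <- x) (counit a *: f b) = f x.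
Proof.
move=> fl; rewrite -{2}[x]counitl lin_tliftE //; apply: eq_tlift => a b.
by rewrite lin_scale.
Qed.

Lemma swr W (f : C -> W) x : lin f ->
  \sw_(a, b <- x) (counit b *: f a) = f x.
Proof.
move=> fl; rewrite -{2}[x]counitr lin_tliftE //; apply: eq_tlift => a b.
by rewrite lin_scale.
Qed.

(** Makes an arbitrary [F] linear without changing its values on basis vectors, the only values that
    a Sweedler sum sees. *)
Definition basis_ext W (F : C -> W) (x : C) : W :=
  \sum_i coord (vbasis {:C}) i x *: F (vbasis {:C})`_i.

Lemma lin_basis_ext W (F : C -> W) : lin (basis_ext F).
Proof.
rewrite /basis_ext; apply: (lin_sumf (F := fun i x =>
  coord (vbasis {:C}) i x *: F (vbasis {:C})`_i)) => i.
by apply: lin_scalel => c x y; rewrite linearP.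
Qed.

Lemma basis_extE W (F : C -> W) (i : 'I_(\dim {:C})) :
  basis_ext F (vbasis {:C})`_i = F (vbasis {:C})`_i.
Proof.
rewrite /basis_ext (bigD1 i) //= big1 ?addr0; last first.
  move=> j ji; rewrite coord_free ?(basis_free (vbasisP _)) //.
  by rewrite eq_sym; move: ji; rewrite eq_sym -val_eqE => /negPf/= ji;
    rewrite [_ == _]ji scale0r.
by rewrite coord_free ?(basis_free (vbasisP _)) // eqxx scale1r.
Qed.

Lemma tlift_basis (U V W : vectType k) (F G : U -> V -> W) t :
  (forall (i : 'I_(\dim {:U})) (j : 'I_(\dim {:V})),
     F (vbasis {:U})`_i (vbasis {:V})`_j =
       G (vbasis {:U})`_i (vbasis {:V})`_j) ->
  tlift F t = tlift G t.
Proof.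
by move=> FG; apply: eq_bigr => i _; apply: eq_bigr => j _; rewrite FG.
Qed.

Lemma swA_lin W (F : C -> C -> C -> W) x :
  (forall b c, lin (fun a => F a b c)) ->
  (forall a c, lin (fun b => F a b c)) ->
  (forall a b, lin (fun c => F a b c)) ->
  \sw_(a, c <- x) \sw_(a', b <- a) F a' b c
    = \sw_(a, b <- x) \sw_(b', c <- b) F a b' c.
Proof.
move=> F1 F2 F3.
pose L (t : tensor C (tensor C C)) := tlift (fun a s => tlift (F a) s) t.
have Ll : lin L by apply: lin_linear.
have Lp a (s : tensor C C) : L (a ⊗ s) = tlift (F a) s.
  by apply: tlift_pure; split=> [? ? ? ?|? ? ? ?];
    rewrite ?linearP // (lin_tlift_fun (F := fun b c a => F a b c)).
have := congr1 L (comulA x); rewrite /tassoc /tmap.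
have -> : L (tlift (fun u v => u ⊗ comul v) (comul x)) =
    \sw_(a, b <- x) \sw_(b', c <- b) F a b' c.
  by rewrite lin_tliftE //; apply: eq_tlift => a b; apply: Lp.
move=> <-; rewrite !lin_tliftE //; last by apply: lin_linear.
pose T (s : tensor C C) (w : C) := tlift (fun u v : C => u ⊗ (v ⊗ w)) s.
apply/esym/(eq_sw (F := fun a c => tlift (fun s w => L (T s w)) (comul a ⊗ c))).
move=> a c; rewrite tlift_pure /T; last first.
  split=> [? ? ? ?|s d u v]; first by rewrite linearP Ll.
  rewrite -Ll; congr (L _).
  by apply: (lin_tlift_fun (F := fun u v c => u ⊗ (v ⊗ c))) => a' b; lin.
rewrite lin_tliftE //; apply: eq_tlift => a' b.
by rewrite Lp tlift_pure //; split=> *; [apply: F2|apply: F3].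
Qed.

(* [tlift] only evaluates its argument on basis vectors, so no linearity of
   [F] is needed. *)
Lemma swA W (F : C -> C -> C -> W) x :
  \sw_(a, c <- x) \sw_(a', b <- a) F a' b c
    = \sw_(a, b <- x) \sw_(b', c <- b) F a b' c.
Proof.
pose G a b c :=
  basis_ext (fun a => basis_ext (fun b => basis_ext (F a b) c) b) a.
have GE (i j l : 'I_(\dim {:C})) :
  G (vbasis {:C})`_i (vbasis {:C})`_j (vbasis {:C})`_l
    = F (vbasis {:C})`_i (vbasis {:C})`_j (vbasis {:C})`_l.
  by rewrite /G !basis_extE.
transitivity (\sw_(a, c <- x) \sw_(a', b <- a) G a' b c).
  by apply: tlift_basis => i l; apply: tlift_basis => a b; rewrite GE.
transitivity (\sw_(a, b <- x) \sw_(b', c <- b) G a b' c); last first.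
  by apply: tlift_basis => i l; apply: tlift_basis => a b; rewrite GE.
apply: swA_lin => [b c|a c|a b]; rewrite /G.
- exact: lin_basis_ext.
- by apply: lin_sumf => i; apply/lin_scaler/lin_basis_ext.
- by apply: lin_sumf => i; apply/lin_scaler/lin_sumf => j;
    apply/lin_scaler/lin_basis_ext.
Qed.

Lemma sw_grouplike W (F : C -> C -> W) g :
  (forall b, lin (fun a => F a b)) -> (forall a, lin (F a)) ->
  grouplike g -> sw F g = F g g.
Proof.
move=> F1 F2 /andP[_ /eqP gg]; by rewrite /sw gg tlift_pure.
Qed.

End Sweedler.

(** * Antipode identities *)

Section HopfBasics.
Context (k : fieldType) (H : hopfType k).
Implicit Types (W : vectType k) (x y : H).
Local Notation S := (antipode : H -> H).
Local Notation eps x := (counit x : k).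

Lemma swM W (F : H -> H -> W) x y :
  (forall b, lin (fun a => F a b)) -> (forall a, lin (F a)) ->
  sw F (x * y) = \sw_(a, b <- x) \sw_(c, d <- y) F (a * c) (b * d).
Proof.
move=> F1 F2; have Fl : lin (tlift F) by apply: lin_linear.
rewrite /sw comulM /tmul lin_tliftE //; apply: eq_tlift => a b.
rewrite lin_tliftE //; apply: eq_tlift => c d.
by rewrite tlift_pure.
Qed.

Lemma sw1 W (F : H -> H -> W) :
  (forall b, lin (fun a => F a b)) -> (forall a, lin (F a)) -> sw F 1 = F 1 1.
Proof. by move=> F1 F2; rewrite /sw comul1 tlift_pure. Qed.

Lemma sw_Sl W (G : H -> W) x : lin G ->
  \sw_(a, b <- x) G (S a * b) = eps x *: G 1.
Proof.
by move=> Gl; rewrite -(lin_swE (g := G)) // -(lin_scale _ _ Gl) -antipodel.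
Qed.

Lemma sw_Sr W (G : H -> W) x : lin G ->
  \sw_(a, b <- x) G (a * S b) = eps x *: G 1.
Proof.
by move=> Gl; rewrite -(lin_swE (g := G)) // -(lin_scale _ _ Gl) -antipoder.
Qed.

Section Cancel.
Context (W : vectType k) (G : H -> H -> W).
Hypothesis Gl : forall b, lin (fun a => G a b).
Hypothesis Gr : forall a, lin (G a).

(** In these four names [r] or [l] tells on which side of the three Sweedler legs the cancelling
    pair stands, and [Sl] or [Sr] which factor of the pair carries the antipode. *)
Lemma sw_rSl x : \sw_(a, b <- x) \sw_(c, d <- b) G a (S c * d) = G x 1.
Proof.
rewrite (eq_sw (G := fun a b => eps b *: G a 1)) => [|a b].
  by rewrite (swr (f := fun a => G a 1)).
by rewrite sw_Sl.
Qed.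

Lemma sw_rSr x : \sw_(a, b <- x) \sw_(c, d <- b) G a (c * S d) = G x 1.
Proof.
rewrite (eq_sw (G := fun a b => eps b *: G a 1)) => [|a b].
  by rewrite (swr (f := fun a => G a 1)).
by rewrite sw_Sr.
Qed.

Lemma sw_lSl x : \sw_(a, b <- x) \sw_(c, d <- b) G (S a * c) d = G 1 x.
Proof.
rewrite -swA (eq_sw (G := fun a b => eps a *: G 1 b)) => [|a b].
  by rewrite (swl (f := fun a => G 1 a)).
by rewrite (sw_Sl (G := fun z => G z b)).
Qed.

Lemma sw_lSr x : \sw_(a, b <- x) \sw_(c, d <- b) G (a * S c) d = G 1 x.
Proof.
rewrite -swA (eq_sw (G := fun a b => eps a *: G 1 b)) => [|a b].
  by rewrite (swl (f := fun a => G 1 a)).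
by rewrite (sw_Sr (G := fun z => G z b)).
Qed.

End Cancel.

Lemma antipode1 : S 1 = 1.
Proof.
have := sw_Sl (G := fun z => z) 1 (@lin_id _ _).
rewrite sw1; [by rewrite mulr1 counit1 scale1r | | ]. - by lin. - by lin.
Qed.

Lemma counit_antipode x : eps (S x) = eps x.
Proof.
have <- : \sw_(a, b <- x) counit (S a * b) = eps x.
  by rewrite (sw_Sl (G := counit)) ?counit1 ?[_ *: _]mulr1 //.
rewrite (eq_sw (G := fun a b => eps b *: counit (S a))) => [|a b].
  by rewrite (swr (f := fun a => counit (S a))) //.
by rewrite counitM mulrC.
Qed.

(** Both sides are convolution inverses of the multiplication. The intermediate sum is the product
    of one inverse, the multiplication and the other inverse; collapsing it from the right gives the
    left-hand side, from the left the right-hand side. *)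
Lemma antipodeM x y : S (x * y) = S y * S x.
Proof.
transitivity (\sw_(a, b <- x) \sw_(a', b' <- y) \sw_(c, d <- b)
    \sw_(c', d' <- b') (S (a * a') * (c * c' * S d' * S d))).
  transitivity (\sw_(a, b <- x) \sw_(a', b' <- y)
      (eps b *: (eps b' *: S (a * a')))).
    under eq_sw => a b do rewrite sw_scale (swr (f := fun a' => S (a * a'))) //.
    by rewrite (swr (f := fun a => S (a * y))) //.
  apply: eq_sw => a b; apply: eq_sw => a' b'.
  under eq_sw => c d.
    under eq_sw => c' d' do rewrite -(mulrA c).
    rewrite (sw_Sr (G := fun z => S (a * a') * (c * z * S d))) //.
    rewrite mulr1; over.
  by rewrite sw_scale (sw_Sr (G := fun z => S (a * a') * z)) ?mulr1 ?scalerA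
    1?mulrC //.
under eq_sw => a b do rewrite exchange_sw.
rewrite -swA.
under eq_sw => a b.
  under eq_sw => c d.
    under eq_sw => a' b' do under eq_sw => c' d' do rewrite !mulrA.
    rewrite -(swA (fun a' c' d' => S (c * a') * d * c' * S d' * S b)).
    over.
  rewrite exchange_sw.
  under eq_sw => a' b'.
    under eq_sw => c d do under eq_sw => c' d' do rewrite -(mulrA _ d).
    rewrite -(swM (F := fun u v => S u * v * S b' * S b)) //.
    rewrite (sw_Sl (G := fun z => z * S b' * S b)) //.
    rewrite mul1r counitM -[_ *: _]scalerA.
    over.
  rewrite sw_scale (swl (f := fun b' => S b' * S b)) //.
  over.
by rewrite (swl (f := fun b => S y * S b)) //.
Qed.

(** The argument of [antipodeM] for the comultiplication: its composite with [S] and the flipped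
    square of [S] after it are both its convolution inverses. *)
Lemma sw_antipode W (F : H -> H -> W) x :
  (forall b, lin (fun a => F a b)) -> (forall a, lin (F a)) ->
  sw F (S x) = \sw_(a, b <- x) F (S b) (S a).
Proof.
move=> F1 F2.
transitivity (\sw_(a, b <- x) \sw_(u, v <- S a) \sw_(c, d <- b)
    \sw_(d1, d2 <- d) \sw_(e, f <- d2) F (u * c * S f) (v * (d1 * S e))).
  transitivity (\sw_(a, b <- x) (eps b *: sw F (S a))).
    by rewrite (swr (f := fun a => sw F (S a))).
  apply: eq_sw => a b; rewrite -sw_scale; apply: eq_sw => u v.
  under eq_sw => c d.
    rewrite (sw_lSr (G := fun y f => F (u * c * S f) (v * y))) // mulr1 -mulrA.
    over.
  by rewrite (sw_Sr (G := fun y => F (u * y) v)) // mulr1.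
under eq_sw => a b.
  under eq_sw => u v.
    rewrite -(swA (fun c d1 d2 => \sw_(e, f <- d2)
      F (u * c * S f) (v * (d1 * S e)))).
    over.
  rewrite exchange_sw; over.
rewrite -swA.
under eq_sw => a b.
  under eq_sw => c d.
    under eq_sw => u v do under eq_sw => c1 c2 do
      under eq_sw => e f do rewrite mulrA.
    rewrite -(swM (F := fun y z => \sw_(e, f <- b) F (y * S f) (z * S e))) //.
    over.
  rewrite (sw_Sl (G := fun t => sw (fun y z =>
    \sw_(e, f <- b) F (y * S f) (z * S e)) t)) // sw1 //.
  under eq_sw => e f do rewrite !mul1r.
  over.
by rewrite (swl (f := fun b => \sw_(e, f <- b) F (S f) (S e))).
Qed.

Lemma sw_antipode2 W (F : H -> H -> W) x :
  (forall b, lin (fun a => F a b)) -> (forall a, lin (F a)) ->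
  sw F (S (S x)) = \sw_(a, b <- x) F (S (S a)) (S (S b)).
Proof. by move=> F1 F2; rewrite !sw_antipode. Qed.

End HopfBasics.

(** * Integrals from traces *)

Section Trace.
Context (k : fieldType) (V : vectType k).

Definition vtr (f : V -> V) : k :=
  \sum_i coord (vbasis {:V}) i (f (vbasis {:V})`_i).

Lemma vbasis_sum (x : V) :
  x = \sum_i coord (vbasis {:V}) i x *: (vbasis {:V})`_i.
Proof. exact: coord_vbasis (memvf x). Qed.

Lemma lin_expand (W : vectType k) (f : V -> W) x : lin f ->
  f x = \sum_i coord (vbasis {:V}) i x *: f (vbasis {:V})`_i.
Proof.
move=> fl; rewrite {1}[x]vbasis_sum lin_sum //.
by apply: eq_bigr => i _; rewrite lin_scale.
Qed.

Lemma eq_vtr (f g : V -> V) : f =1 g -> vtr f = vtr g.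
Proof. by move=> fg; apply: eq_bigr => i _; rewrite fg. Qed.

(** Computes the trace of an operator on the whole space inside a small subspace that contains its
    image; this is how a trace on H becomes a trace on H N. *)
Lemma vtr_family n (phi : 'I_n -> V -> k) (v : 'I_n -> V) :
  (forall j, lin (phi j : V -> k^o)) ->
  vtr (fun x => \sum_j phi j x *: v j) = \sum_j phi j (v j).
Proof.
move=> phil; rewrite /vtr.
under eq_bigr => i _ do rewrite linear_sum.
rewrite exchange_big; apply: eq_bigr => j _ /=.
rewrite [RHS](lin_expand (f := phi j : V -> k^o)) //.
by apply: eq_bigr => i _; rewrite linearZ /= mulrC.
Qed.

Lemma vtrC (f g : V -> V) : lin f -> lin g ->
  vtr (fun x => f (g x)) = vtr (fun x => g (f x)).
Proof.
move=> fl gl; rewrite /vtr.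
transitivity (\sum_(i < \dim {:V}) \sum_(j < \dim {:V})
    coord (vbasis {:V}) j (g (vbasis {:V})`_i) *
    coord (vbasis {:V}) i (f (vbasis {:V})`_j)).
  apply: eq_bigr => i _; rewrite {1}[g _]vbasis_sum lin_sum // linear_sum.
  by apply: eq_bigr => j _; rewrite lin_scale // linearZ.
rewrite exchange_big; apply: eq_bigr => j _.
rewrite {2}[f _]vbasis_sum lin_sum // linear_sum.
by apply: eq_bigr => i _; rewrite lin_scale // linearZ mulrC.
Qed.

End Trace.

Section Integral.
Context (k : fieldType) (H : hopfType k).
Implicit Types (W : vectType k) (x y : H) (f : H -> k).
Local Notation S := (antipode : H -> H).
Local Notation eps x := (counit x : k).
Local Notation e_ i := ((vbasis {:H})`_i).
Local Notation "e^ i" := (coord (vbasis {:H}) i) (at level 9, i at level 1).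

(** In the dual algebra the condition reads l f = f(1) l for every functional f. *)
Definition right_integral (l : H -> k) : Prop :=
  lin (l : H -> k^o) /\ forall x, \sw_(a, b <- x) (l a *: b) = l x *: 1.

Definition trint f x : k :=
  vtr (fun h : H => \sw_(a, b <- h) (f a *: (S (S b) * x))).

Lemma lin_trint f : lin (trint f : H -> k^o).
Proof.
by rewrite /trint /vtr; lin.
Qed.

Lemma trintE f x : trint f x =
  \sum_i \sw_(a, b <- e_ i) (f a * e^ i (S (S b) * x) : k^o).
Proof.
apply: eq_bigr => i _; rewrite (lin_swE (g := e^ i : H -> k^o)) //.
by apply: eq_swk => a b; rewrite linearZ.
Qed.

(** The second leg of S^2(b1) meets [S b2] in S(b3) S^2(b2) = S(S(b2) b3), which cancels. *)
Lemma sw_leg2_cancel (phi : H -> k) b x : lin (phi : H -> k^o) ->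
  \sw_(b1, b2 <- b) \sw_(z1, z2 <- S (S b1) * x) (phi z1 *: (S b2 * z2))
    = \sw_(x1, x2 <- x) (phi (S (S b) * x1) *: x2).
Proof.
move=> phil.
under eq_sw => b1 b2.
  rewrite swM // sw_antipode2 //.
  over.
rewrite swA.
under eq_sw => c r.
  under eq_sw => d b2.
    under eq_sw => x1 x2 do rewrite mulrA -antipodeM.
    over.
  over.
rewrite (sw_rSl (G := fun c y => \sw_(x1, x2 <- x)
  (phi (S (S c) * x1) *: (S y * x2)))) //.
by apply: eq_sw => x1 x2; rewrite antipode1 mul1r.
Qed.

(** By [sw_leg2_cancel], comultiplying [x] inside the trace can be traded for comultiplying the
    basis vector over which the trace runs. After coassociativity the last leg of that vector meets
    [S b2] and cancels, which leaves the unit. *)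
Lemma trint_right f : lin (f : H -> k^o) -> right_integral (trint f).
Proof.
move=> fl; split; first exact: lin_trint.
move=> x; pose P u j v := \sw_(a, b <- u) (f a *: \sw_(b1, b2 <- b)
  (e^ j (S (S b1) * x) *: (S b2 * v))).
have Pl j v : lin (fun u => P u j v) by rewrite /P; lin.
transitivity (\sum_j \sw_(z1, z2 <- e_ j) P z1 j z2).
  transitivity (\sum_i \sw_(a, b <- e_ i) (f a *: \sw_(x1, x2 <- x)
      (e^ i (S (S b) * x1) *: x2))).
    under eq_sw => x1 x2 do rewrite trintE scaler_suml.
    rewrite sw_sum; apply: eq_bigr => i _.
    under [RHS]eq_sw => a b do rewrite -sw_scale.
    rewrite exchange_sw; apply: eq_sw => x1 x2.
    rewrite (lin_swE (g := fun c : k^o => (c : k) *: x2)) //.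
    by apply: eq_sw => a b; rewrite scalerA.
  transitivity (\sum_i \sum_j \sw_(z1, z2 <- e_ j)
      (e^ i z1 *: P (e_ i) j z2)); last first.
    rewrite exchange_big; apply: eq_bigr => j _ /=.
    rewrite -sw_sum; apply: eq_sw => z1 z2.
    by rewrite [RHS](lin_expand (f := fun u => P u j z2)).
  apply: eq_bigr => i _.
  under eq_sw => a b do rewrite -sw_leg2_cancel //.
  under [RHS]eq_bigr => j _.
    under eq_sw => z1 z2.
      rewrite /P -sw_scale.
      under eq_sw => a b.
        rewrite -!sw_scale; under eq_sw => b1 b2.
          rewrite scalerA mulrC -scalerA [e^ i _ *: (e^ j _ *: _)]scalerA.
          rewrite mulrC -scalerA; over.
        over.
      over.
    rewrite exchange_sw; under eq_sw => a b.
      rewrite exchange_sw.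
      under eq_sw => b1 b2 do rewrite !sw_scale.
      rewrite sw_scale; over.
    over.
  rewrite -sw_sum; apply: eq_sw => a b.
  rewrite -scaler_sumr -sw_sum; congr (_ *: _); apply: eq_sw => b1 b2.
  exact: (lin_expand (f := fun z => \sw_(z1, z2 <- z)
    (e^ i z1 *: (S b2 * z2)))).
rewrite trintE scaler_suml; apply: eq_bigr => j _.
rewrite (lin_swE (g := fun c : k^o => (c : k) *: (1 : H))) //.
rewrite /P swA; apply: eq_sw => a r.
rewrite sw_scale -scalerA; congr (_ *: _); rewrite swA.
rewrite (sw_rSl (G := fun b1 y => e^ j (S (S b1) * x) *: y)) //.
Qed.

Lemma sw_coord i j x :
  \sw_(a, b <- x) (e^ i a * e^ j b : k^o) = (comul x : 'M_(_, _)) i j.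
Proof.
have bf := basis_free (vbasisP {:H}).
rewrite /sw /tlift (bigD1 i) //= [X in _ + X]big1 ?addr0; last first.
  move=> i' i'i; apply: big1 => j' _.
  rewrite !coord_free // (negPf i'i).
  by rewrite mul0r scaler0.
rewrite (bigD1 j) //= big1 ?addr0; last first.
  move=> j' j'j; by rewrite !coord_free // (negPf j'j) mulr0 scaler0.
by rewrite !coord_free // !eqxx mulr1 [_ *: _]mulr1.
Qed.

Lemma trint_cyclic f x : lin (f : H -> k^o) ->
  trint f x = vtr (fun h : H => \sw_(a, b <- S (S h) * x) (f a *: b)).
Proof.
move=> fl; rewrite -(vtrC (f := fun y => S (S y) * x)
  (g := fun h => \sw_(a, b <- h) (f a *: b))) //.
apply: eq_vtr => h; rewrite (lin_swE (g := fun y => S (S y) * x)) //.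
by apply: eq_sw => a b; rewrite !linearZ /= scalerAl.
Qed.

(* Every f is a sum of translates of the integrals attached to the products
   of f with the dual basis; this is the case f = counit, evaluated at 1. *)
Lemma sum_trint : \sum_i trint (e^ i) (S (e_ i)) = 1.
Proof.
transitivity (\sum_l e^ l (\sw_(a, b <- e_ l) S (a * S b))); last first.
  transitivity (\sum_l e^ l 1 * eps (e_ l)).
    apply: eq_bigr => l _; rewrite (sw_Sr (G := S)) // antipode1 linearZ.
    by rewrite mulrC.
  by rewrite -(lin_expand (f := counit)) // counit1.
pose d := \dim {:H}; transitivity (\sum_(i < d) \sum_(j < d) \sum_(l < d)
    (comul (e_ l) : 'M_(_, _)) i j * e^ l (S (e_ i * S (e_ j)))).
  apply: eq_bigr => i _; rewrite trint_cyclic //.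
  apply: eq_bigr => j _; rewrite -antipodeM.
  transitivity (\sw_(a, b <- S (e_ i * S (e_ j))) (e^ i a * e^ j b : k^o)).
    rewrite (lin_swE (g := e^ j : H -> k^o)) //.
    by apply: eq_swk => a b; rewrite linearZ.
  rewrite (lin_expand (f := sw (fun a b => e^ i a * e^ j b : k^o))) //.
  by apply: eq_bigr => l _; rewrite sw_coord mulrC.
under eq_bigr => i _ do rewrite exchange_big /=.
rewrite exchange_big; apply: eq_bigr => l _ /=.
rewrite /sw /tlift linear_sum; apply: eq_bigr => i _ /=.
by rewrite linear_sum; apply: eq_bigr => j _; rewrite linearZ.
Qed.

Lemma ex_right_integral :
  exists l : H -> k, right_integral l /\ exists x, l x != 0.
Proof.
have [i nz]: exists i : 'I_(\dim {:H}), trint (e^ i) (S (e_ i)) != 0.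
  apply/existsP/contraT; rewrite negb_exists => /forallP z.
  have := sum_trint; rewrite big1 => [/eqP|i _];
    first by rewrite eq_sym oner_eq0.
  by apply/eqP; have := z i; rewrite negbK.
by exists (trint (e^ i)); split; [apply: trint_right | exists (S (e_ i))].
Qed.

End Integral.

(** * Nondegeneracy of the integral and bijectivity of the antipode *)

Section GroupLike.
Context (k : fieldType) (H : hopfType k).
Local Notation S := (antipode : H -> H).

Lemma sw_tpure (C : coalgType k) (x : C) : \sw_(a, b <- x) (a ⊗ b) = comul x.
Proof.
have /= := tlift_uniq (g := idfun : {linear tensor C C -> tensor C C})
  (f := @tpure k C C).
by move=> /(_ (fun _ _ => erefl)) E; rewrite /sw -E.
Qed.

Lemma grouplike_neq0 (C : coalgType k) (g : C) : grouplike g -> g != 0.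
Proof. by case/andP. Qed.

Lemma counit_grouplike (C : coalgType k) (g : C) : grouplike g -> counit g = 1.
Proof.
move=> gg; have /eqP := swl (f := fun z => z) g (@lin_id _ _).
rewrite sw_grouplike // -[X in _ == X]scale1r -subr_eq0 -scalerBl.
by rewrite scaler_eq0 (negPf (grouplike_neq0 gg)) orbF subr_eq0 => /eqP.
Qed.

Lemma grouplikeVl (g : H) : grouplike g -> S g * g = 1.
Proof.
move=> gg; have := sw_Sl (G := fun z => z) g (@lin_id _ _).
by rewrite sw_grouplike // counit_grouplike // scale1r.
Qed.

Lemma grouplikeVr (g : H) : grouplike g -> g * S g = 1.
Proof.
move=> gg; have := sw_Sr (G := fun z => z) g (@lin_id _ _).
by rewrite sw_grouplike // counit_grouplike // scale1r.
Qed.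

Lemma antipode2_grouplike (g : H) : grouplike g -> S (S g) = g.
Proof.
move=> gg; rewrite -[LHS]mulr1 -(grouplikeVl gg) mulrA -antipodeM.
by rewrite grouplikeVr // antipode1 mul1r.
Qed.

End GroupLike.

Section RightIntegral.
Context (k : fieldType) (H : hopfType k) (l : H -> k).
Hypothesis l_int : right_integral l.
Implicit Types (W : vectType k) (x y z : H).
Local Notation S := (antipode : H -> H).
Local Notation eps x := (counit x : k).
Local Notation e_ i := ((vbasis {:H})`_i).
Local Notation "e^ i" := (coord (vbasis {:H}) i) (at level 9, i at level 1).

Let ll : lin (l : H -> k^o). Proof. by case: l_int. Qed.
Let lr x : \sw_(a, b <- x) (l a *: b) = l x *: 1. Proof. by case: l_int. Qed.

(** Insert y2 S(y3) behind the second leg of [x] and apply the invariance of [l] to the product of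
    [x] and the first part of [y]. *)
Lemma rint_shift x y :
  \sw_(a, b <- x) (l (a * y) *: b) = \sw_(c, d <- y) (l (x * c) *: S d).
Proof.
transitivity (\sw_(c, d <- y) \sw_(a, b <- x) \sw_(c1, c2 <- c)
   (l (a * c1) *: (b * c2 * S d))).
  rewrite exchange_sw; apply: eq_sw => a b; rewrite swA.
  under eq_sw => c1 r do under eq_sw => c2 d do rewrite -mulrA.
  by rewrite (sw_rSr (G := fun c z => l (a * c) *: (b * z))) // mulr1.
apply: eq_sw => c d.
rewrite -(swM (F := fun z1 z2 => l z1 *: (z2 * S d))) //.
transitivity ((\sw_(z1, z2 <- x * c) (l z1 *: z2)) * S d).
  rewrite (lin_swE (g := fun z => z * S d)) //.
  by apply: eq_sw => a b; rewrite scalerAl.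
by rewrite lr -scalerAl mul1r.
Qed.

Hypothesis l_neq0 : exists x, l x != 0.

(** Write l(y) x as the sum of l(x1 S(x2) y) x3 and expand S(x2) y in a basis: what appears are the
    sums of l(x1 e_i) x2, and [rint_shift] turns them into sums of values l(x _) = 0. *)
Lemma rint_nondegl x : (forall y, l (x * y) = 0) -> x = 0.
Proof.
move=> x0; have [y ly] := l_neq0.
suff /eqP : l y *: x = 0 by rewrite scaler_eq0 (negPf ly) => /eqP.
have <- : \sw_(a, b <- x) \sw_(c, d <- b) (l (a * S c * y) *: d) = l y *: x.
  by rewrite (sw_lSr (G := fun u d => l (u * y) *: d)) // mul1r.
transitivity (\sum_i \sw_(c, d <- \sw_(a, b <- x) (l (a * e_ i) *: b))
    (e^ i (S c * y) *: d)); last first.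
  apply: big1 => i _.
  have -> : \sw_(a, b <- x) (l (a * e_ i) *: b) = 0.
    by rewrite rint_shift; apply: sw_eq0 => c d; rewrite x0 scale0r.
  by rewrite (lin_0 (f := sw (fun c d => e^ i (S c * y) *: d))).
under [RHS]eq_bigr => i _ do rewrite (lin_swE
  (g := sw (fun c d => e^ i (S c * y) *: d))) //.
rewrite -sw_sum; apply: eq_sw => a b.
under [RHS]eq_bigr => i _ do
  rewrite (lin_scale (f := sw (fun c d => e^ i (S c * y) *: d))) // -sw_scale.
rewrite -sw_sum; apply: eq_sw => c d.
rewrite -mulrA (lin_expand (f := fun z => l (a * z) *: d)) //.
by apply: eq_bigr => i _; rewrite scalerA mulrC -scalerA.
Qed.

Let M : 'M[k]_(\dim {:H}) := \matrix_(i, j) l (e_ i * e_ j).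

Let ll_mull x : lin (fun y => l (x * y) : k^o). Proof. by lin. Qed.
Let ll_mulr y : lin (fun x => l (x * y) : k^o). Proof. by lin. Qed.

Let l_mulE (v : 'rV_(\dim {:H})) (j : 'I_(\dim {:H})) :
  l ((\sum_i v 0 i *: e_ i) * e_ j) = (v *m M) 0 j.
Proof.
rewrite mulr_suml (lin_sum _ _ _ ll) !mxE; apply: eq_bigr => i _.
by rewrite -scalerAl (lin_scale _ _ ll) !mxE.
Qed.

Lemma rint_mx_unit : M \in unitmx.
Proof.
rewrite -row_free_unit; apply/inj_row_free => v vM0.
have x0 : \sum_i v 0 i *: e_ i = 0.
  apply: rint_nondegl => y; rewrite (lin_expand _ (ll_mull _)) big1 // => j _.
  by rewrite l_mulE vM0 mxE scaler0.
apply/rowP => i; rewrite mxE; have /freeP := basis_free (vbasisP {:H}).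
by apply.
Qed.

Lemma rint_reprl (phi : H -> k) : lin (phi : H -> k^o) ->
  exists y, forall x, phi x = l (y * x).
Proof.
move=> phil; pose v := (\row_j phi (e_ j)) *m invmx M.
exists (\sum_i v 0 i *: e_ i) => x.
rewrite (lin_expand x phil) [RHS](lin_expand x (ll_mull _)).
apply: eq_bigr => j _.
by rewrite l_mulE mulmxKV ?rint_mx_unit // mxE.
Qed.

Lemma rint_reprr (phi : H -> k) : lin (phi : H -> k^o) ->
  exists y, forall x, phi x = l (x * y).
Proof.
move=> phil; pose v := invmx M *m (\col_j phi (e_ j)).
exists (\sum_i v i 0 *: e_ i) => x.
rewrite (lin_expand x phil) [RHS](lin_expand x (ll_mulr _)).
apply: eq_bigr => j _.
have /(congr1 (fun A : 'cV_(_) => A j 0)) : M *m v = \col_j phi (e_ j).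
  by rewrite mulmxA mulmxV ?rint_mx_unit // mul1mx.
rewrite mxE [RHS]mxE => <-; rewrite mulr_sumr (lin_sum _ _ _ ll).
by congr (_ * _); apply: eq_bigr => i _;
  rewrite -scalerAr (lin_scale _ _ ll) !mxE mulrC.
Qed.

Lemma rint_nondegr y : (forall x, l (x * y) = 0) -> y = 0.
Proof.
move=> y0; rewrite [y]vbasis_sum big1 // => i _.
have [x xE] := rint_reprl (lin_coord (vbasis {:H}) i).
by rewrite xE y0 scale0r.
Qed.

Lemma rint_injl x y : (forall z, l (x * z) = l (y * z)) -> x = y.
Proof.
move=> xy; apply/eqP; rewrite -subr_eq0; apply/eqP/rint_nondegl => z.
by rewrite mulrBl -scaleN1r (lin_add _ _ ll)
  (lin_scale _ _ ll) xy scaleN1r subrr.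
Qed.

Lemma rint_injr x y : (forall z, l (z * x) = l (z * y)) -> x = y.
Proof.
move=> xy; apply/eqP; rewrite -subr_eq0; apply/eqP/rint_nondegr => z.
by rewrite mulrBr -scaleN1r (lin_add _ _ ll)
  (lin_scale _ _ ll) xy scaleN1r subrr.
Qed.

(* The left integral of H dual to l. *)
Lemma ex_dual_integral : exists L : H, forall x, l (x * L) = eps x.
Proof.
have [L LE] := rint_reprr (phi := counit) (@lin_linear _ _ _ _).
by exists L => x; rewrite -LE.
Qed.

End RightIntegral.

Section AntipodeInv.
Context (k : fieldType) (H : hopfType k).
Implicit Types (x y z : H).
Local Notation S := (antipode : H -> H).
Local Notation eps x := (counit x : k).

Lemma antipode_surj y : exists x, y = S x.
Proof.
have [l [l_int l_neq0]] := ex_right_integral H.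
have [L LE] := ex_dual_integral l_int l_neq0.
(* By [rint_shift] the antipode maps this to the sum of l(y1 L) y2, and [l (_ * L)] is the
   counit. *)
exists (\sw_(c, d <- L) (l (y * c) *: d)).
rewrite (lin_swE (g := S)) //.
under eq_sw => c d do rewrite linearZ.
rewrite -(rint_shift l_int).
under eq_sw => a b do rewrite LE.
by rewrite (swl (f := fun b => b)).
Qed.

Definition antipodeV : 'End(H) := (antipode^-1)%VF.

Lemma antipodeVK x : S (antipodeV x) = x.
Proof.
have [y ->] := antipode_surj x.
by apply: limg_lfunVK; apply: memv_img; apply: memvf.
Qed.

Lemma antipode_inj : injective S.
Proof.
have k0 : lker (antipode : 'End(H)) == 0%VS.
  rewrite -dimv_eq0; have := limg_ker_dim (antipode : 'End(H)) fullv.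
  have -> : (antipode @: fullv)%VS = fullv :> {vspace H}.
    apply/eqP; rewrite eqEsubv subvf; apply/subvP => y _.
    by have [x ->] := antipode_surj y; apply/memv_img/memvf.
  by rewrite capfv => /eqP; rewrite -[X in _ == X]add0n eqn_add2r.
exact/lker0P.
Qed.

Lemma antipodeK x : antipodeV (S x) = x.
Proof. by apply: antipode_inj; rewrite antipodeVK. Qed.

Lemma antipodeVM x y : antipodeV (x * y) = antipodeV y * antipodeV x.
Proof. by apply: antipode_inj; rewrite antipodeM !antipodeVK. Qed.

Lemma sw_Vl (W : vectType k) (G : H -> W) x : lin G ->
  \sw_(a, b <- x) G (b * antipodeV a) = eps x *: G 1.
Proof.
move=> Gl; rewrite -(lin_swE (g := G)) // -(lin_scale _ _ Gl); congr (G _).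
apply: antipode_inj; rewrite (lin_swE (g := S)) // linearZ /= antipode1.
under eq_sw => a b do rewrite antipodeM antipodeVK.
by rewrite (sw_Sr (G := fun z => z)).
Qed.

Lemma sw_lVl (W : vectType k) (G : H -> H -> W) x :
  (forall b, lin (fun a => G a b)) -> (forall a, lin (G a)) ->
  \sw_(a, b <- x) \sw_(c, d <- b) G (c * antipodeV a) d = G 1 x.
Proof.
move=> Gl Gr; rewrite -swA.
under eq_sw => a b do rewrite (sw_Vl (G := fun z => G z b)) //.
by rewrite (swl (f := fun a => G 1 a)).
Qed.

End AntipodeInv.

(** * Radford's formula for S^4 *)

Section Radford.
Context (k : fieldType) (H : hopfType k) (l : H -> k).
Hypothesis l_int : right_integral l.
Hypothesis l_neq0 : exists x, l x != 0.
Implicit Types (W : vectType k) (x y z : H).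
Local Notation S := (antipode : H -> H).
Local Notation Sv := (@antipodeV k H : H -> H).
Local Notation eps x := (counit x : k).
Local Notation "e^ i" := (coord (vbasis {:H}) i) (at level 9, i at level 1).

Let ll : lin (l : H -> k^o). Proof. by case: l_int. Qed.

Let lZ c x : l (c *: x) = c * l x. Proof. exact: (lin_scale _ _ ll). Qed.

Context (L : H).
Hypothesis lL : forall x, l (x * L) = eps x.

Let mulL x : x * L = eps x *: L.
Proof.
apply: (rint_injr l_int l_neq0) => y.
by rewrite -scalerAr lZ mulrA !lL counitM mulrC.
Qed.

Let lL1 : l L = 1. Proof. by rewrite -[L]mul1r lL counit1. Qed.

(** The modular function: [L * x] is again a left integral, hence a multiple of [L], and this is the
    factor. *)
Definition modular x : k := l (L * x).
Local Notation al := modular.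

Lemma lin_modular : lin (al : H -> k^o). Proof. by rewrite /al; lin. Qed.
Let all := lin_modular.

Let Lmul x : L * x = al x *: L.
Proof.
apply: (rint_injr l_int l_neq0) => y.
by rewrite -scalerAr lZ lL mulrA mulL -scalerAl lZ mulrC.
Qed.

Lemma modular1 : al 1 = 1. Proof. by rewrite /al mulr1. Qed.

Lemma modularM x y : al (x * y) = al x * al y.
Proof. by rewrite {1}/al mulrA Lmul -scalerAl lZ. Qed.

Let SvE x : \sw_(c, d <- L) (l (x * c) *: d) = Sv x.
Proof.
apply: antipode_inj; rewrite antipodeVK (lin_swE (g := S)) //.
under eq_sw => c d do rewrite linearZ.
rewrite -(rint_shift l_int).
under eq_sw => a b do rewrite lL.
by rewrite (swl (f := fun b => b)).
Qed.

(* Every functional is [l (x * _)] for some x. *)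
Let ndeg1 (phi : H -> k) : lin (phi : H -> k^o) ->
  \sw_(c, d <- L) (phi c *: d) = 0 -> forall z, phi z = 0.
Proof.
move=> phil; have [x xE] := rint_reprl l_int l_neq0 phil.
under eq_sw => c d do rewrite xE.
rewrite SvE => Sx0 z.
by rewrite xE -(antipodeVK x) Sx0 linear0 mul0r (lin_0 ll).
Qed.

Let U y := \sw_(a, b <- y) (al a *: b).
Let V y := \sw_(a, b <- y) (al b *: a).

Let ndeg1_eq (phi psi : H -> k) :
  lin (phi : H -> k^o) -> lin (psi : H -> k^o) ->
  \sw_(c, d <- L) (phi c *: d) = \sw_(c, d <- L) (psi c *: d) -> phi =1 psi.
Proof.
move=> phil psil E z; apply/eqP; rewrite -subr_eq0; apply/eqP; move: z.
apply: (@ndeg1 (fun z => phi z - psi z)).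
  by move=> c x y; rewrite phil psil scalerBr opprD addrACA.
under eq_sw => c d do rewrite scalerBl.
by rewrite sw_sub E subrr.
Qed.

(** The Nakayama automorphism of the form l(x y), computed by pairing with the first leg of [L].
    [Lleft] and [Lleft'] serve the same computation with the second leg, where the distinguished
    grouplike element appears. *)
Let nakayama1 y z : l (z * y) = l (S (S (U y)) * z).
Proof.
move: z; apply: ndeg1_eq => //.
rewrite SvE antipodeK (rint_shift l_int).
by rewrite /U (lin_swE (g := S)) //; apply: eq_sw => a b; rewrite linearZ.
Qed.

(** Every right integral m satisfies m(L1) S(L2) = m(L) 1. So the sums m(L1) L2 of any two right
    integrals are proportional, and m is determined by this sum. *)
Lemma rint_uniq (l' : H -> k) :
  right_integral l' -> forall x, l' x = l' L * l x.
Proof.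
move=> l'_int; have l'l : lin (l' : H -> k^o) by case: l'_int.
apply: ndeg1_eq => //.
have E (m : H -> k) : right_integral m -> lin (m : H -> k^o) ->
    \sw_(c, d <- L) (m c *: S d) = m L *: 1.
  move=> m_int ml; have := rint_shift m_int 1 L.
  rewrite sw1 // mul1r => ->; apply: eq_sw => c d; by rewrite mul1r.
apply: antipode_inj; rewrite !(lin_swE (g := S)) //.
under eq_sw => c d do rewrite linearZ.
rewrite E //; transitivity (l' L *: \sw_(c, d <- L) (l c *: S d)).
  by rewrite E // lL1 scale1r.
rewrite -sw_scale; apply: eq_sw => c d.
by rewrite (lin_scale (f := S)) // scalerA.
Qed.

Let coordZ i c x : e^ i (c *: x) = c * e^ i x.
Proof. exact: (lin_scale _ _ (lin_coord (vbasis {:H}) i)). Qed.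

(** The distinguished grouplike element, which measures how far [l] is from being invariant on the
    other side as well. *)
Definition dist_grouplike := \sw_(a, b <- L) (l b *: a).
Local Notation g := dist_grouplike.

(** Each coordinate of the left-hand side is a right integral as a function of [x], so it is a
    multiple of [l] by uniqueness. *)
Lemma rint_left x : \sw_(a, b <- x) (l b *: a) = l x *: g.
Proof.
rewrite [LHS]vbasis_sum [g]vbasis_sum scaler_sumr; apply: eq_bigr => i _.
rewrite scalerA mulrC; congr (_ *: _).
apply: (rint_uniq (l' := fun x => e^ i (\sw_(a, b <- x) (l b *: a)))).
split=> // {}x.
transitivity (\sw_(a, r <- x) (e^ i a *: \sw_(b, c <- r) (l b *: c))).
  under [RHS]eq_sw => a r do rewrite -sw_scale.
  rewrite -swA; apply: eq_sw => a c.
  rewrite (lin_swE (g := fun z => e^ i z *: c)) //; apply: eq_sw => a' b.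
  by rewrite coordZ scalerA mulrC.
have [_ l_inv] := l_int; under eq_sw => a r do rewrite l_inv.
rewrite (lin_swE (g := fun z => e^ i z *: 1)) //; apply: eq_sw => a b.
by rewrite coordZ scalerA mulrC.
Qed.

Lemma grouplike_dist : grouplike g.
Proof.
apply/andP; split.
  apply/eqP => g0; have : counit g = 1.
    rewrite /g (lin_swE (g := counit)) //.
    transitivity (\sw_(a, b <- L) (eps a *: (l b : k^o))).
      by apply: eq_sw => a b; rewrite (lin_scale (f := counit)) //
        [_ *: _]mulrC.
    by rewrite (swl (f := l : H -> k^o)).
  by rewrite g0 linear0 => /eqP; rewrite eq_sym oner_eq0.
apply/eqP; rewrite {1}/g (lin_swE (g := comul)) //.
transitivity (\sw_(a, r <- L) (a ⊗ (l r *: g))).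
  under eq_sw => a b do rewrite linearZ /= -sw_tpure -sw_scale.
  rewrite swA; apply: eq_sw => a r.
  rewrite -rint_left (lin_swE (g := fun z => a ⊗ z)) //.
  by apply: eq_sw => b c; rewrite (lin_scale _ _ (lin_tpurer _)).
transitivity ((\sw_(a, r <- L) (l r *: a)) ⊗ g) => //.
rewrite (lin_swE (g := fun z => z ⊗ g)) //; apply: eq_sw => a b.
by rewrite (lin_scale _ _ (lin_tpurer _)) (lin_scale _ _ (lin_tpurel _)).
Qed.

Let gS : g * S g = 1. Proof. exact: grouplikeVr grouplike_dist. Qed.
Let Sg : S g * g = 1. Proof. exact: grouplikeVl grouplike_dist. Qed.

Let Lleft x : \sw_(c, d <- L) (l (x * d) *: c) = S x * g.
Proof.
transitivity (\sw_(a, b <- x) \sw_(b1, b2 <- b) \sw_(c, d <- L)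
   (l (b2 * d) *: (S a * b1 * c))).
  rewrite (sw_lSl (G := fun u b2 =>
    \sw_(c, d <- L) (l (b2 * d) *: (u * c)))) //.
  by apply: eq_sw => c d; rewrite mul1r.
transitivity (\sw_(a, b <- x) (l (b * L) *: (S a * g))); last first.
  under eq_sw => a b do rewrite lL.
  by rewrite (swr (f := fun a => S a * g)).
apply: eq_sw => a b; rewrite scalerAr -rint_left
  (lin_swE (g := fun z => S a * z)) //.
rewrite swM //; apply: eq_sw => b1 b2; apply: eq_sw => c d.
by rewrite -scalerAr mulrA.
Qed.

Let Lleft' y : \sw_(c, d <- L) (l (d * y) *: c) = g * Sv (V y).
Proof.
transitivity (\sw_(c, d <- y) \sw_(d1, d2 <- d) \sw_(a, b <- L)
   (l (b * d2) *: (a * (d1 * Sv c)))).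
  rewrite (sw_lVl (G := fun u d2 =>
    \sw_(a, b <- L) (l (b * d2) *: (a * u)))) //.
  by apply: eq_sw => c d; rewrite mulr1.
rewrite /V (lin_swE (g := fun z => g * Sv z)) //.
apply: eq_sw => c d; rewrite linearZ /= -scalerAr scalerAl -rint_left.
rewrite (lin_swE (g := fun z => z * Sv c)) // swM // exchange_sw.
apply: eq_sw => b1 b2; apply: eq_sw => d1 d2.
by rewrite -scalerAl mulrA.
Qed.

Let ndeg2_eq (phi psi : H -> k) :
  lin (phi : H -> k^o) -> lin (psi : H -> k^o) ->
  \sw_(c, d <- L) (phi d *: c) = \sw_(c, d <- L) (psi d *: c) -> phi =1 psi.
Proof.
move=> phil psil.
have [x xE] := rint_reprl l_int l_neq0 phil.
have [y yE] := rint_reprl l_int l_neq0 psil.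
under eq_sw => c d do rewrite xE.
under [in RHS]eq_sw => c d do rewrite yE.
rewrite !Lleft => /(congr1 (fun z => z * S g)); rewrite -!mulrA gS !mulr1.
by move=> /antipode_inj xy z; rewrite xE yE xy.
Qed.

(** The two computations of the Nakayama automorphism must agree by nondegeneracy of the form;
    applying S^2 to this equality clears the inverse antipodes. *)
Lemma radford_S4 y :
  S (S (S (S (\sw_(a, b <- y) (al a *: b))))) * g
    = g * \sw_(a, b <- y) (al b *: a).
Proof.
rewrite -/(U y) -/(V y); pose x := Sv (g * Sv (V y) * S g).
have nakayama2 z : l (x * z) = l (z * y).
  move: z; apply: ndeg2_eq => //.
  by rewrite Lleft Lleft' /x antipodeVK -(mulrA _ (S g) g) Sg mulr1.
have -> : S (S (U y)) = x.
  by apply: (rint_injl l_int l_neq0) => z; rewrite -nakayama1 nakayama2.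
rewrite /x antipodeVK !antipodeM antipodeVK -!mulrA.
by rewrite antipode2_grouplike ?grouplike_dist // Sg mulr1.
Qed.

End Radford.

(** * Nilpotent augmentation ideals in matrix algebras *)

Section Spectrum.
Context (k : closedFieldType).

Lemma mx_spectrum n (A : 'M[k]_n) : exists rs : seq k,
  [/\ size rs = n, char_poly A = \prod_(r <- rs) ('X - r%:P),
      \tr A = \sum_(r <- rs) r & {in rs, forall r, eigenvalue A r}].
Proof.
have [rs E] := closed_field_poly_normal (char_poly A).
move: E; rewrite (monicP (char_poly_monic A)) scale1r => E.
have sz : size rs = n.
  by apply/eqP; rewrite -eqSS -(size_char_poly A) E size_prod_XsubC.
exists rs; split=> //; last first.
  by move=> r rin; rewrite eigenvalue_root_char E root_prod_XsubC.
case: n A E sz => [|n] A E sz.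
  by rewrite (size0nil sz) big_nil /mxtrace big_ord0.
apply: oppr_inj; rewrite -char_poly_trace // E -{1}sz.
by rewrite coefPn_prod_XsubC // sz.
Qed.

Lemma eigenvalue_expr n (A : 'M[k]_n) m r : eigenvalue A r ->
  exists2 v : 'rV_n, v != 0 & v *m A ^+ m = r ^+ m *: v.
Proof.
case/eigenvalueP => v vA v0; exists v => //.
elim: m => [|m IH]; first by rewrite expr0 mulmx1 scale1r.
by rewrite exprSr mulmxA IH -scalemxAl vA scalerA exprSr.
Qed.

Lemma mxtrace_nilpotent n (A : 'M[k]_n) m : A ^+ m = 0 -> \tr A = 0.
Proof.
move=> Am; have [rs [_ _ -> eig]] := mx_spectrum A.
rewrite big_seq big1 // => r /eig /(eigenvalue_expr m) [v v0].
rewrite Am mulmx0 => /esym/eqP; rewrite scaler_eq0 (negPf v0) orbF.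
by rewrite expf_eq0 => /andP[_ /eqP].
Qed.

Lemma mxtrace_idempotent n (E : 'M[k]_n) : E *m E = E -> \tr E = (\rank E)%:R.
Proof.
move=> EE; rewrite -{1}(mulmx_base E) mxtrace_mulC.
suff -> : row_base E *m col_base E = 1%:M by rewrite mxtrace1.
apply: (row_full_inj (col_base_full E));
  apply: (row_free_inj (row_base_free E)).
by rewrite mulmx1 mulmx_base mulmxA mulmx_base -mulmxA mulmx_base.
Qed.

End Spectrum.

Lemma exprB_pchar_comm (R : nzRingType) p m (x y : R) : p \in [pchar R] ->
  GRing.comm x y -> (x - y) ^+ (p ^ m) = x ^+ (p ^ m) - y ^+ (p ^ m).
Proof.
move=> pR xy; elim: m => [|m IH]; first by rewrite !expr1.
rewrite expnSr !exprM IH -!(pFrobenius_autE pR) pFrobenius_autB_comm //.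
exact/commrX/commr_sym/commrX/commr_sym.
Qed.

Lemma exprD_pchar_comm (R : nzRingType) p m (x y : R) : p \in [pchar R] ->
  GRing.comm x y -> (x + y) ^+ (p ^ m) = x ^+ (p ^ m) + y ^+ (p ^ m).
Proof.
move=> pR xy; elim: m => [|m IH]; first by rewrite !expr1.
rewrite expnSr !exprM IH -!(pFrobenius_autE pR) pFrobenius_autD_comm //.
exact/commrX/commr_sym/commrX/commr_sym.
Qed.

Lemma expr_pchar_eq1 (R : idomainType) p m (x : R) : p \in [pchar R] ->
  x ^+ (p ^ m) = 1 -> x = 1.
Proof.
move=> pR x1; apply/eqP; rewrite -subr_eq0.
suff : (x - 1) ^+ (p ^ m) == 0 by rewrite expf_eq0 => /andP[].
by rewrite exprB_pchar_comm ?x1 ?expr1n ?subrr //; apply: commr1.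
Qed.

Section NilpotentAugmentation.
Context (k : closedFieldType) (n : nat).
Hypothesis charp : n.+1 \in [pchar k].
Local Notation p := n.+1.
Local Notation Mp := 'M[k]_p.
(** In the application [v0] is the row of N, [BB] the convolution operators on H N, and [sg], [sgV]
    are S^2 and its inverse. The prime is a successor so that the matrices form a nontrivial
    ring. *)
Context (v0 : 'rV[k]_p) (BB : {vspace Mp}) (sg sgV : Mp) (m : nat).
Hypothesis v0_neq0 : v0 != 0.
Hypothesis BB1 : 1 \in BB.
Hypothesis BBM : forall X Y : Mp, X \in BB -> Y \in BB -> X * Y \in BB.
Hypothesis sgK : sg * sgV = 1.
Hypothesis BBJ : forall X, X \in BB -> sg * X * sgV \in BB.
Hypothesis v0sg : v0 *m sg = v0.
Hypothesis sg_order : sg ^+ (2 * p ^ m) = 1.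
Hypothesis BB_tr0 : forall X, X \in BB -> \tr (X * sg) = 0.

Let charM : p \in [pchar Mp].
Proof. by rewrite (pchar_lalg Mp). Qed.

Let prime_p : prime p. Proof. exact: pcharf_prime charp. Qed.

(* The eigenvalues of sg are 1 and -1; as their sum is 0 and there are p of
   them, only 1 occurs. *)
Lemma sg_unipotent : sg ^+ p = 1.
Proof.
have [rs [sz cE trE eig]] := mx_spectrum sg.
have rs2 r : r \in rs -> (r == 1) || (r == -1).
  move=> /eig/(eigenvalue_expr (2 * p ^ m)) [v vn0].
  rewrite sg_order mulmx1 => /esym/eqP.
  rewrite -subr_eq0 -[X in _ - X]scale1r -scalerBl scaler_eq0 (negPf vn0) orbF.
  rewrite subr_eq0 exprM => /eqP /(expr_pchar_eq1 charp) /eqP.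
  by rewrite sqrf_eq1.
have rs1 : 1 \in rs.
  rewrite -root_prod_XsubC -cE -eigenvalue_root_char.
  by apply/eigenvalueP; exists v0; rewrite // scale1r.
have tr0 : (2 * count (predC1 1) rs)%:R = 0 :> k.
  have : \sum_(r <- rs) r = 0 by rewrite -trE -[sg]mul1r BB_tr0.
  rewrite (eq_big_seq (fun r => 1 - (2 * (r != 1))%:R)) => [|r /rs2];
    last first.
    case: eqP => [->|_ /= /eqP->]; rewrite ?subr0 //.
    by rewrite muln1 mulr2n opprD addNKr.
  rewrite sumrB big_const_seq count_predT iter_addr_0 sz (pcharf0 charp) sub0r.
  move/eqP; rewrite oppr_eq0 -natr_sum -big_distrr /= => /eqP <-.
  by rewrite -sum1_count big_mkcond.
have c0 : count (predC1 1) rs = 0%N.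
  move: tr0 => /eqP; rewrite -(dvdn_pcharf charp) Euclid_dvdM //.
  (* If p = 2, the eigenvalue -1 is 1 itself. *)
  case/orP => [p2|].
    apply/eqP; rewrite -leqn0 leqNgt -has_count; apply/hasPn => r /rs2.
    suff -> : -1 = 1 :> k by rewrite orbb /= negbK.
    have := pcharf0 charp; have /eqP-> : p == 2 by rewrite -dvdn_prime2.
    by move/eqP; rewrite mulr2n addr_eq0 => /eqP <-.
  (* The fixed row [v0] makes 1 an eigenvalue, so at most p - 1 eigenvalues differ from it; a
     multiple of p in this range is 0. *)
  have lt : (count (predC1 1%R) rs < p)%N.
    rewrite -sz -(count_predC (pred1 1) rs) -addn1 addnC leq_add2r -has_count.
    by apply/hasP; exists 1 => /=.
  by case: (count _ _) lt => // c lt /(dvdn_leq (ltn0Sn _)); rewrite leqNgt lt.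
have rsE : rs = nseq p 1.
  rewrite -sz; apply/all_pred1P; apply/allP => r rin /=.
  apply: contraT => r1; have : has (predC1 1) rs by apply/hasP; exists r.
  by rewrite has_count c0.
have := Cayley_Hamilton sg; rewrite cE rsE big_nseq.
rewrite iter_mulr_1 rmorphXn /= rmorphB /= horner_mx_X.
rewrite horner_mx_C.
have := exprB_pchar_comm 1 charM (commr1 sg).
rewrite expn1 expr1n => -> /eqP; rewrite subr_eq0 => /eqP //.
Qed.

Lemma horner_mx_BB (Y : Mp) q : Y \in BB -> horner_mx Y q \in BB.
Proof.
move=> YB; elim/poly_ind: q => [|q c IH]; first by rewrite rmorph0 mem0v.
rewrite rmorphD rmorphM /= horner_mx_X horner_mx_C memvD ?BBM //.
by rewrite -[c%:M]/(c%:M : Mp) -scalemx1 memvZ.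
Qed.

(** Fitting decomposition: [F] projects onto the part where [Y] is invertible. Being a multiple of
    [Y], it inherits from [Y] that it kills [v0], and being a polynomial in [Y], it stays in
    [BB]. *)
Lemma fitting_idempotent (Y : Mp) : Y ^+ p != 0 ->
  exists q, let F := Y * horner_mx Y q in F * F = F /\ F != 0.
Proof.
move=> Yp.
have [a [h nh cE]] := multiplicity_XsubC (char_poly Y) 0.
rewrite subr0 in cE.
move: nh; rewrite -size_poly_eq0 size_char_poly /= => nh.
have ap : (a <= p)%N.
  have := size_char_poly Y; rewrite cE size_mulXn; last first.
    by apply: contraNneq nh => ->; rewrite root0.
  have : (0 < size h)%N.
    by rewrite size_poly_gt0; apply: contraNneq nh => ->; rewrite root0.
  by case: (size h) => // s _; rewrite addnS => -[<-]; apply: leq_addr.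
(* One power more than the multiplicity of 0, so that ['X] divides the projecting polynomial even
   when [a] is 0. *)
have /Bezout_eq1_coprimepP[[u v] /= uv] : coprimep ('X^(a.+1)) h.
  by apply: coprimep_expl; rewrite coprimep_sym -['X]subr0 -polyC0
    coprimep_XsubC.
have chY : horner_mx Y (h * 'X^a) = 0 by rewrite -cE Cayley_Hamilton.
exists (u * 'X^a).
have -> : Y * horner_mx Y (u * 'X^a) = horner_mx Y (u * 'X^(a.+1)).
  by rewrite -{1}(horner_mx_X Y) -rmorphM /= mulrCA -exprS.
split.
  rewrite -rmorphM /=; apply/eqP; rewrite -subr_eq0 -rmorphB /=.
  have -> : u * 'X^(a.+1) * (u * 'X^(a.+1)) - u * 'X^(a.+1)
      = - (u * 'X * v) * (h * 'X^a).
    have uv1 : u * 'X^(a.+1) - 1 = - (v * h) by rewrite -uv opprD addNKr.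
    rewrite -[X in _ - X]mulr1 -mulrBr uv1 exprS; ring.
  by rewrite rmorphM /= chY mulr0.
apply: contraNneq Yp => F0.
have : horner_mx Y (v * h) = 1.
  by rewrite -[RHS](rmorph1 (horner_mx Y)) -uv rmorphD /= F0 add0r.
move=> vh; have Ya : Y ^+ a = 0.
  rewrite -[LHS]mul1r -vh -{2}(horner_mx_X Y) -rmorphXn -rmorphM /= -mulrA.
  by rewrite rmorphM /= chY mulr0.
have -> : Y ^+ p = Y ^+ (a + (p - a)) by rewrite subnKC.
by rewrite exprD Ya mul0r.
Qed.

(** With [T] = [E * sg * E], the power T^p is [E + Y] for some [Y] in [BB] that kills [v0]. If [Y]
    is nilpotent, so is [T - E]; then the rank of [E] is tr T = tr (E sg) = 0 modulo p, hence 0,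
    although [E] fixes [v0]. Otherwise the Fitting idempotent of [Y] is subtracted from [E]. *)
Lemma idempotent_descent (E : Mp) : E \in BB -> E * E = E -> v0 *m E = v0 ->
  (\rank E < p)%N ->
  exists E' : Mp, [/\ E' \in BB, E' * E' = E', v0 *m E' = v0
    & (\rank E' < \rank E)%N].
Proof.
move=> EB EE v0E rE.
have v0sgV : v0 *m sgV = v0 by rewrite -{1}v0sg -mulmxA [sg *m _]sgK mulmx1.
have sgVK : sgV * sg = 1 by exact: mulmx1C.
(* All factors [sg] are moved to the right through [BB], which conjugation by [sg] preserves; at
   exponent p they disappear. *)
have powers j : exists W : Mp, [/\ W \in BB, v0 *m W = v0
    & (E * sg) ^+ j = W * sg ^+ j].
  elim: j => [|j [W [WB v0W IH]]].
    by exists 1; split=> //; rewrite ?mulmx1 // !expr0 mulr1.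
  exists (E * (sg * W * sgV)); split; first exact/BBM/BBJ.
    by rewrite !mulmxA v0E v0sg v0W.
  rewrite exprS IH [sg ^+ j.+1]exprS !mulrA; congr (_ * _).
  by rewrite -!mulrA sgVK mulr1.
have [W [WB v0W]] := powers p; rewrite sg_unipotent mulr1 => EsgW.
have EW : E * W = W by rewrite -EsgW exprS !mulrA EE.
pose T := E * sg * E; pose Y := W * E - E.
have Tp j : T ^+ j.+1 = (E * sg) ^+ j.+1 * E.
  elim: j => [|j IH]; first by rewrite !expr1.
  by rewrite exprSr IH /T [in RHS]exprSr !mulrA -[_ * E * E]mulrA EE.
have TpY : T ^+ p = E + Y by rewrite Tp EsgW /Y addrC subrK.
have EY : E * Y = Y by rewrite /Y mulrBr mulrA EW EE.
have YE : Y * E = Y by rewrite /Y mulrBl -mulrA EE.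
have YB : Y \in BB by rewrite /Y memvB ?BBM.
have v0Y : v0 *m Y = 0 by rewrite /Y mulmxBr mulmxA v0W v0E subrr.
have Ej j : E ^+ j.+1 = E by elim: j => // j IH; rewrite exprS IH.
have [Y0|/fitting_idempotent [q /=]] := eqVneq (Y ^+ p) 0.
  (* One p-th power reaches [E + Y]; a second one, Frobenius on commuting terms, removes [Y]. *)
  have TE : T ^+ (p ^ 2) = E.
    rewrite expnS expn1 exprM TpY.
    have := @exprD_pchar_comm _ _ 1 E Y charM; rewrite expn1.
    by move=> -> //; [rewrite Y0 addr0 Ej | rewrite /GRing.comm EY YE].
  have nil : (T - E) ^+ (p ^ 2) = 0.
    rewrite exprB_pchar_comm // ?TE.
      by rewrite -(prednK (expn_gt0 p 2)) Ej subrr.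
    by rewrite /GRing.comm /T -[LHS]mulrA EE !mulrA EE.
  have : \tr T = \tr E.
    by apply/eqP; rewrite -subr_eq0 -raddfB /= (mxtrace_nilpotent nil).
  rewrite /T mxtrace_mulC mulmxA [E *m E]EE BB_tr0 // mxtrace_idempotent //.
  move/esym/eqP; rewrite -(dvdn_pcharf charp) => dvd.
  have : \rank E = 0%N.
    by apply/eqP; move: dvd; apply: contraTT; rewrite -lt0n => r0;
      rewrite gtnNdvd.
  move/eqP; rewrite mxrank_eq0 => /eqP E0.
  by move: v0_neq0; rewrite -v0E E0 mulmx0 eqxx.
set F := Y * _ => -[FF F0].
have FB : F \in BB by rewrite BBM ?horner_mx_BB.
have v0F : v0 *m F = 0 by rewrite mulmxA v0Y mul0mx.
have EF : E * F = F by rewrite /F mulrA EY.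
have FE : F * E = F.
  have cYE : comm_mx E (horner_mx Y q).
    by apply: comm_mx_horner; rewrite /comm_mx -[E *m Y]/(E * Y) EY
      -[Y *m E]/(Y * E) YE.
  by rewrite /F -mulrA -[_ * E]cYE mulrA YE.
exists (E - F); split.
- exact: memvB.
- by rewrite mulrBl !mulrBr EE EF FE FF subrr subr0.
- by rewrite mulmxBr v0E v0F subr0.
apply: rank_ltmx; apply/andP; split.
  apply/submxP; exists (E - F).
  by rewrite mulmxBl [E *m E]EE [F *m E]FE.
apply: contra F0 => /submxP [Z EZ].
by rewrite -EF {1}EZ -mulmxE -mulmxA mulmxBl [E *m F]EF [F *m F]FF subrr mulmx0.
Qed.

Lemma no_small_idempotent (E : Mp) : E \in BB -> E * E = E -> v0 *m E = v0 ->
  \rank E = p.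
Proof.
move=> EB EE v0E; apply/eqP; rewrite eqn_leq rank_leq_row leqNgt /=.
apply/negP => rE; have [r le] := ubnP (\rank E).
elim: r => // r IH in E le EB EE v0E rE *.
have [E' [E'B E'E' v0E' lt]] := idempotent_descent EB EE v0E rE.
by apply: (IH E') => //; [apply: leq_trans lt _ | apply: ltn_trans rE].
Qed.

(** Otherwise [X] has a nonzero Fitting idempotent [F] that kills [v0]; the complementary idempotent
    [1 - F] fixes [v0], so it has full rank, and F (1 - F) = 0 forces [F] to vanish. *)
Lemma augmentation_nil (X : Mp) : X \in BB -> v0 *m X = 0 -> X ^+ p = 0.
Proof.
move=> XB v0X; apply/eqP; apply: contraT => /fitting_idempotent [q /=].
set F := X * _ => -[FF F0].
have FB : F \in BB by rewrite BBM ?horner_mx_BB.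
have v0F : v0 *m F = 0 by rewrite mulmxA v0X mul0mx.
have EE : (1 - F) * (1 - F) = 1 - F.
  by rewrite mulrBl mul1r mulrBr mulr1 FF subrr subr0.
have free1F : row_free (1 - F).
  apply/eqP/no_small_idempotent => //; first exact: memvB.
  by rewrite mulmxBr mulmx1 v0F subr0.
suff F00 : F = 0 by rewrite F00 eqxx in F0.
apply: (row_free_inj free1F); rewrite mul0mx.
by rewrite -[_ *m _]/(F * (1 - F)) mulrBr mulr1 FF subrr.
Qed.

End NilpotentAugmentation.

Section CommonKernel.
Context (k : fieldType) (n : nat) (v0 : 'rV[k]_n) (BB : {vspace 'M[k]_n}).
Hypothesis BB1 : 1%:M \in BB.
Hypothesis BBM : forall X Y, X \in BB -> Y \in BB -> X *m Y \in BB.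
Hypothesis BB_nil : forall X, X \in BB -> v0 *m X = 0 -> exists N, X ^+ N = 0.

(** Descent on the dimension of the orbit w BB. If [Y] kills [v0] but not [w], pass to w Y. Its
    orbit is strictly smaller: otherwise w = w Y Z for some [Z], and Y Z is nilpotent because it
    also kills [v0]. *)
Lemma augmentation_common_kernel (W : {vspace 'rV[k]_n}) : W != 0%VS ->
  (forall w X, w \in W -> X \in BB -> w *m X \in W) ->
  exists w, [/\ w \in W, w != 0
    & forall X, X \in BB -> v0 *m X = 0 -> w *m X = 0].
Proof.
move=> W0 WB; pose orb (w : 'rV[k]_n) := (linfun (mulmx w) @: BB)%VS.
have orbP w X : X \in BB -> w *m X \in orb w.
  by move=> XB; apply/memv_imgP; exists X; rewrite ?lfunE.
pose BBp := (BB :&: lker (linfun (mulmx v0)))%VS.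
have [d le] := ubnP (\dim (orb (vpick W))).
have : vpick W != 0 by rewrite vpick0.
elim: d (vpick W) (memv_pick W) le => // d IH w wW le w0.
have [/subvP sub|/subvPn [Y]] := boolP (BBp <= lker (linfun (mulmx w)))%VS.
  exists w; split=> // X XB v0X.
  have : X \in BBp by rewrite memv_cap XB memv_ker lfunE /= v0X.
  by move/sub; rewrite memv_ker lfunE => /eqP.
rewrite memv_cap !memv_ker !lfunE /= => /andP[YB /eqP v0Y] wY0.
apply: (IH (w *m Y)) => //; first exact: WB.
rewrite ltnS in le; apply: leq_trans le; rewrite ltn_neqAle dimvS ?andbT;
  last first.
  apply/subvP => _ /memv_imgP [Z ZB ->]; rewrite lfunE /= -mulmxA.
  exact/orbP/BBM.
apply: contra w0 => eqd.
have sub : (orb (w *m Y) <= orb w)%VS.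
  apply/subvP => _ /memv_imgP [Z ZB ->]; rewrite lfunE /= -mulmxA.
  exact/orbP/BBM.
have : w \in orb (w *m Y).
  have /eqP-> : orb (w *m Y) == orb w by rewrite eqEdim sub (eqP eqd) /=.
  by rewrite -[X in X \in _]mulmx1; apply: orbP.
case/memv_imgP => Z ZB; rewrite lfunE /= -mulmxA => wE.
have [] := BB_nil (BBM YB ZB); first by rewrite mulmxA v0Y mul0mx.
move=> N YZN; suff wN j : w *m (Y *m Z) ^+ j = w by rewrite -(wN N) YZN mulmx0.
elim: j => [|j IHj]; first by rewrite mulmx1.
by rewrite exprSr mulmxA IHj -wE.
Qed.

End CommonKernel.

(** * Translations by characters are unipotent *)

(** The hypothesis says that the products of two entries form the list s repeated |s| times. Then
    the distinct values form a group and have equal multiplicities, so the order of this group is a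
    power of p, and 1 is the only root of unity of such an order. *)
Lemma convolution_idempotent_trivial (k : fieldType) (p n : nat) (s : seq k) :
  p \in [pchar k] -> size s = (p ^ n)%N -> 0 \notin s ->
  (forall l, (\sum_(b <- s) count_mem (l / b) s = size s * count_mem l s)%N) ->
  {in s, forall x, x = 1}.
Proof.
move=> charp sz s0 conv.
pose f l := count_mem l s; pose S := undup s.
have f_gt0 x : (0 < f x)%N = (x \in s).
  by rewrite /f -has_count has_pred1.
have s_gt0 : (0 < size s)%N
  by rewrite sz expn_gt0 (prime_gt0 (pcharf_prime charp)).
(* At a value of maximal multiplicity the convolution identity is an average of terms bounded by
   that maximum, so all the terms are equal to it. *)
have [l ls lmax] : exists2 l, l \in s & forall x, (f x <= f l)%N.
  have [i _ imax] := arg_maxnP (fun i : 'I_(size s) => f s`_i)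
    (P := predT) (i0 := Ordinal s_gt0) isT.
  exists s`_i; first exact: mem_nth.
  move=> x; have [xs|] := boolP (x \in s); last first.
    by rewrite -f_gt0 lt0n negbK => /eqP->.
  have := imax (Ordinal (_ : index x s < size s)%N) isT.
  by rewrite /= nth_index //; apply; rewrite index_mem.
have fl b : b \in s -> f (l / b) = f l.
  move=> bs; apply/eqP; rewrite eqn_leq lmax /= -subn_eq0.
  have : (\sum_(b <- s) (f l - f (l / b)) == 0)%N.
    rewrite -(eqn_add2r (\sum_(b <- s) f (l / b))) -big_split /= add0n conv.
    rewrite (eq_bigr (fun=> f l)) => [|c _]; last by rewrite subnK.
    by rewrite big_const_seq count_predT iter_addn_0 mulnC.
  by rewrite sum_nat_seq_eq0 => /allP/(_ b bs).
have neq0 x : x \in s -> x != 0 by move=> xs; apply: contraNneq s0 => <-.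
have divS b : b \in s -> l / b \in s by move=> bs; rewrite -f_gt0 fl // f_gt0.
have fM x : x \in s -> f x = f l.
  move=> xs; rewrite -(fl _ (divS x xs)); congr f.
  by rewrite invf_div mulrCA mulfV ?mulr1 // neq0.
have dvdS : (size S %| p ^ n)%N.
  rewrite -sz -(perm_size (perm_count_undup s)) size_flatten /shape -map_comp.
  have /eq_in_map-> : {in S, size \o (fun x => nseq (f x) x) =1 fun=> f l}.
    by move=> x; rewrite mem_undup /= size_nseq => /fM.
  rewrite sumnE big_map big_const_seq count_predT iter_addn_0.
  exact: dvdn_mull.
have mulS x y : x \in s -> y \in s -> x * y \in s.
  move=> xs ys; rewrite -f_gt0 -(ltn_pmul2l s_gt0) muln0 -conv.
  rewrite (big_rem y) //= mulfK ?neq0 // ltn_addr //.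
  by rewrite f_gt0.
have /(dvdn_pfactor _ _ (pcharf_prime charp))[j _ Sj] := dvdS.
move=> x xs.
(* Multiplication by [x] permutes [S]; comparing the products over [S] gives x^|S| = 1. *)
apply: (@expr_pchar_eq1 _ _ j _ charp); rewrite -Sj.
have uS : uniq [seq x * y | y <- S].
  by rewrite map_inj_uniq ?undup_uniq //; apply: mulfI; apply: neq0.
have perm : perm_eq [seq x * y | y <- S] S.
  have sub : {subset [seq x * y | y <- S] <= S}.
    by move=> _ /mapP [y yS ->]; move: yS; rewrite !mem_undup; apply: mulS.
  have [|_ E] := uniq_min_size uS sub; first by rewrite size_map.
  exact: uniq_perm (undup_uniq s) E.
have P0 : \prod_(y <- S) y != 0.
  rewrite prodf_seq_neq0; apply/allP => y; rewrite mem_undup /=; exact: neq0.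
apply: (mulIf P0); rewrite mul1r -[RHS](perm_big _ perm) big_map big_split /=.
by rewrite big_const_seq count_predT iter_mulr_1.
Qed.

Section PowDiagonalizable.
Context (k : closedFieldType) (p : nat).
Hypothesis charp : p \in [pchar k].

(** By Frobenius, the product of A^(p^m) - r^(p^m) over the distinct eigenvalues r is the p^m-th
    power of the product of the A - r. As p^m bounds every multiplicity, Cayley-Hamilton kills it,
    and the r^(p^m) stay distinct. *)
Lemma expr_pchar_diagonalizable n (A : 'M[k]_n) m : (n <= p ^ m)%N ->
  exists2 P : 'M[k]_n, P \in unitmx
    & exists mu : 'rV[k]_n, P *m A ^+ (p ^ m) = diag_mx mu *m P.
Proof.
case: n A => [|n] A nm.
  by exists 1%:M; rewrite ?unitmx1 //; exists 0; apply/matrixP => -[].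
have [rs [sz cE _ _]] := mx_spectrum A.
have charM : p \in [pchar 'M[k]_n.+1] by rewrite (pchar_lalg 'M[k]_n.+1).
suff /diagonalizableP [P Pu /similar_diagPex [mu /(similarP Pu) Pmu]] :
    exists2 rs' : seq k, uniq rs' &
      mxminpoly (A ^+ (p ^ m)) %| \prod_(x <- rs') ('X - x%:P).
  by exists P => //; exists mu.
exists [seq r ^+ (p ^ m) | r <- undup rs].
  rewrite map_inj_uniq ?undup_uniq // => x y /eqP; rewrite -subr_eq0.
  rewrite -(exprB_pchar_comm m charp (mulrC _ _)) expf_eq0 subr_eq0.
  by case/andP => _ /eqP.
apply: mxminpoly_min; rewrite big_map rmorph_prod /=.
transitivity (horner_mx A ((\prod_(r <- undup rs) ('X - r%:P)) ^+ (p ^ m))).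
  rewrite -prodrXl rmorph_prod; apply: eq_bigr => r _ /=.
  rewrite [RHS]rmorphXn !rmorphB /= !horner_mx_X !horner_mx_C.
  rewrite exprB_pchar_comm //; last exact/comm_mx_sym/comm_scalar_mx.
  by rewrite [(r ^+ _)%:M]rmorphXn.
have -> : (\prod_(r <- undup rs) ('X - r%:P)) ^+ (p ^ m) =
    (\prod_(r <- undup rs) ('X - r%:P) ^+ (p ^ m - count_mem r rs)) *
    char_poly A.
  rewrite cE -[in RHS](prodr_undup_exp_count rs predT) -big_split -prodrXl /=.
  apply: eq_bigr => r _; rewrite -exprD subnK //.
  by apply: leq_trans nm; rewrite -sz count_size.
by rewrite rmorphM /= Cayley_Hamilton mulr0.
Qed.

End PowDiagonalizable.

Section TranslationUnipotent.
Context (k : closedFieldType) (p n : nat) (H : hopfType k).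
Hypothesis charp : p \in [pchar k].
Hypothesis dimH : \dim {:H} = (p ^ n)%N.
Local Notation S := (antipode : H -> H).
Local Notation N := (\dim {:H}).

Section Diagonal.
Context (T : H -> H) (X : N.-tuple H) (mu : 'I_N -> k).
Hypothesis T_inj : injective T.
Hypothesis TM : forall x y, T (x * y) = T x * T y.
Hypothesis Tlin : lin T.
Hypothesis T_col : forall (W : vectType k) (F : H -> H -> W) x,
  (forall b, lin (fun a => F a b)) -> (forall a, lin (F a)) ->
  sw F (T x) = \sw_(a, b <- x) F (T a) b.
Hypothesis X_basis : basis_of {:H} X.
Hypothesis TX : forall a : 'I_N, T X`_a = mu a *: X`_a.

Let X_free : free X. Proof. exact: basis_free X_basis. Qed.

Let XE x : x = \sum_(a < N) coord X a x *: X`_a.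
Proof. exact: (coord_basis X_basis (memvf x)). Qed.

Let K (u w : H) : 'M[k]_N := \matrix_(c, d) (coord X c u * coord X d w).

Let Kl w : lin (fun u => K u w).
Proof.
by move=> c u u'; apply/matrixP => i j; rewrite !mxE linearP mulrDl mulrA.
Qed.

Let Kr u : lin (K u).
Proof.
by move=> c w w'; apply/matrixP => i j; rewrite !mxE linearP mulrDr mulrCA.
Qed.

Let Kdelta (a b : 'I_N) : K X`_a X`_b = delta_mx a b.
Proof.
apply/matrixP => i j; rewrite !mxE !coord_free // -natrM mulnb.
by rewrite ![_ == i]eq_sym ![_ == j]eq_sym.
Qed.

Let ext (G : H -> H -> 'M[k]_N) (M : 'M[k]_N) : 'M[k]_N :=
  \sum_a \sum_b M a b *: G X`_a X`_b.

Let ext_linear G : linear (ext G).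
Proof.
move=> c M M'; rewrite /ext scaler_sumr -big_split; apply: eq_bigr => a _ /=.
rewrite scaler_sumr -big_split; apply: eq_bigr => b _ /=.
by rewrite !mxE scalerDl scalerA.
Qed.

HB.instance Definition _ G := GRing.isLinear.Build k _ _ _ (ext G)
  (ext_linear G).

Let extK G u w : (forall b, lin (fun a => G a b)) -> (forall a, lin (G a)) ->
  ext G (K u w) = G u w.
Proof.
move=> Gl Gr; rewrite {2}[u]XE (lin_sum _ _ _ (Gl w)); apply: eq_bigr => a _.
rewrite (lin_scale _ _ (Gl w)) {2}[w]XE (lin_sum _ _ _ (Gr _)) scaler_sumr.
by apply: eq_bigr => b _; rewrite (lin_scale _ _ (Gr _)) mxE scalerA.
Qed.

(** The Galois map u ⊗ w |-> u w1 ⊗ w2, with tensors written as matrices in the basis [X]; [G']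
    gives its inverse. *)
Let G u w := \sw_(a, b <- w) K (u * a) b.
Let G' u w := \sw_(a, b <- w) K (u * S a) b.

Let G_l w : lin (fun u => G u w). Proof. by rewrite /G; lin. Qed.
Let G_r u : lin (G u). Proof. by rewrite /G; lin. Qed.
Let G'_l w : lin (fun u => G' u w). Proof. by rewrite /G'; lin. Qed.
Let G'_r u : lin (G' u). Proof. by rewrite /G'; lin. Qed.

Let extGK M : ext G (ext G' M) = M.
Proof.
rewrite [in RHS](matrix_sum_delta M) {2}/ext linear_sum; apply: eq_bigr => a _.
rewrite linear_sum; apply: eq_bigr => b _; rewrite linearZ -Kdelta /=.
congr (_ *: _); rewrite /G' (lin_swE (g := ext G)) //; last exact: ext_linear.
under eq_sw => y1 y2 do rewrite extK //.
rewrite /G.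
under eq_sw => y1 y2 do under eq_sw => z1 z2 do rewrite -mulrA.
by rewrite (sw_lSl (G := fun y z => K (X`_a * y) z)) // mulr1.
Qed.

Let Z := lin_mx (ext G).

Let Z_unit : Z \in unitmx.
Proof.
suff : lin_mx (ext G') *m Z = 1%:M by case/mulmx1_unit.
apply/row_matrixP => i; rewrite !rowE mulmx1 mulmxA -(vec_mxK (delta_mx 0 i)).
by rewrite !mul_vec_lin /= extGK.
Qed.

Let mu1 : 'rV[k]_(N * N) := mxvec (\matrix_(a, b) (mu a * mu b)).
Let mu2 : 'rV[k]_(N * N) := mxvec (\matrix_(c, d) mu c).

Let coordT c x : coord X c (T x) = mu c * coord X c x.
Proof.
rewrite {1}[x]XE (lin_sum _ _ _ Tlin) linear_sum (bigD1 c) //= big1 => [|a ac].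
  by rewrite addr0 (lin_scale _ _ Tlin) TX !linearZ /= coord_free //
    eqxx mulr1 mulrC.
rewrite (lin_scale _ _ Tlin) TX !linearZ /= coord_free //.
by rewrite (negPf ac) !mulr0.
Qed.

Let ZE a b c d : Z (mxvec_index a b) (mxvec_index c d) = G X`_a X`_b c d.
Proof.
have := congr1 (fun v : 'rV_(N * N) => v 0 (mxvec_index c d))
  (mul_vec_lin (ext G) (delta_mx a b)).
by rewrite mxvec_delta -rowE mxE mxvecE -Kdelta /= extK.
Qed.

Let entry_lin (c d : 'I_N) : lin (fun M : 'M[k]_N => M c d : k^o).
Proof. by move=> x M M'; rewrite !mxE. Qed.

(** The Galois map intertwines T ⊗ T with T ⊗ id, because [T] is multiplicative and acts on the
    first leg of the comultiplication. *)
Let Z_eigen i j : mu1 0 i * Z i j = mu2 0 j * Z i j.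
Proof.
case/mxvec_indexP: i => a b; case/mxvec_indexP: j => c d.
rewrite ZE !mxvecE !mxE.
transitivity ((\sw_(y1, y2 <- X`_b) K (T (X`_a * y1)) y2) c d).
  under eq_sw => y1 y2 do rewrite TM.
  rewrite -(T_col (F := fun y1 y2 => K (T X`_a * y1) y2)) // !TX.
  rewrite (lin_scale _ _ (_ : lin (fun x => sw _ x))); last by lin.
  under eq_sw => y1 y2 do rewrite -scalerAl (lin_scale _ _ (Kl _)).
  by rewrite sw_scale !mxE mulrA (mulrC (mu b)).
rewrite /G (lin_swE (g := fun M : 'M[k]_N => M c d : k^o)) //.
rewrite (lin_swE (g := fun M : 'M[k]_N => M c d : k^o)) //.
rewrite -[_ * _]/(_ *: (_ : k^o)) -sw_scale; apply: eq_swk => y1 y2.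
by rewrite !mxE coordT -mulrA.
Qed.

(** The determinant of [Z] is nonzero, so some term of its expansion is; [Z_eigen] equates the two
    eigenvalues at each entry of that term. *)
Let mu_perm : exists s : {perm 'I_(N * N)}, forall i, mu1 0 i = mu2 0 (s i).
Proof.
move: Z_unit; rewrite unitmxE unitfE => detZ.
have [s /prodf_neq0 Zs] : exists s : {perm 'I_(N * N)}, \prod_i Z i (s i) != 0.
  apply/existsP; apply: contraNT detZ; rewrite negb_exists => /forallP z.
  rewrite /determinant big1 // => s _; have := z s; rewrite negbK => /eqP->.
  by rewrite mulr0.
by exists s => i; apply: (mulIf (Zs i isT)); apply: Z_eigen.
Qed.

Let sum_mxvec (F : 'I_(N * N) -> nat) :
  (\sum_i F i = \sum_a \sum_b F (mxvec_index a b))%N.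
Proof.
rewrite (reindex _ (curry_mxvec_bij _ _)) /= pair_bigA /=.
by apply: eq_bigr => -[].
Qed.

(** By the matching [mu_perm], the products [mu a * mu b] are the eigenvalues [mu c], each repeated
    [N] times. This is the hypothesis of [convolution_idempotent_trivial]. *)
Lemma translation_diagonal_trivial x : T x = x.
Proof.
pose s := [seq mu a | a <- enum 'I_N].
have szs : size s = N by rewrite size_map size_enum_ord.
have count_s l : count_mem l s = (\sum_(a < N) (mu a == l))%N.
  rewrite -sum1_count big_map big_mkcond big_enum.
  by apply: eq_bigr => a _ /=; case: (mu a == l).
have Xn0 (a : 'I_N) : X`_a != 0.
  by apply: (free_not0 X_free); rewrite mem_nth ?size_tuple.
have s0 : 0 \notin s.
  apply/mapP => -[a _ mua]; have /T_inj/eqP : T X`_a = T 0.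
    by rewrite TX -mua scale0r (lin_0 Tlin).
  by rewrite (negPf (Xn0 a)).
have mu_neq0 a : mu a != 0.
  by apply: contraNneq s0 => <-; apply: map_f; rewrite mem_enum.
have conv l : (\sum_(b <- s) count_mem (l / b) s = size s * count_mem l s)%N.
  have [sg sgE] := mu_perm.
  have E : (\sum_i (mu1 0%R i == l) = \sum_i (mu2 0%R i == l))%N.
    rewrite [RHS](reindex_inj (@perm_inj _ sg)) /=.
    by apply: eq_bigr => i _; rewrite sgE.
  rewrite big_map big_enum count_s szs; move: E; rewrite !sum_mxvec.
  under eq_bigr => a _ do under eq_bigr => b _ do rewrite mxvecE mxE.
  under [in RHS]eq_bigr => a _ do under eq_bigr => b _ do rewrite mxvecE mxE.
  under [in RHS]eq_bigr => a _ do rewrite sum_nat_const card_ord.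
  rewrite -big_distrr exchange_big /= => <-; apply: eq_bigr => b _.
  rewrite count_s; apply: eq_bigr => a _.
  by rewrite -(inj_eq (mulIf (mu_neq0 b))) divfK.
have mu_1 a : mu a = 1.
  apply: (convolution_idempotent_trivial charp (n := n) (s := s)) => //.
    by rewrite szs dimH.
  by apply: map_f; rewrite mem_enum.
rewrite [x]XE (lin_sum _ _ _ Tlin); apply: eq_bigr => a _.
by rewrite (lin_scale _ _ Tlin) TX mu_1 scale1r.
Qed.

End Diagonal.

Lemma translation_unipotent (T : H -> H) : injective T -> lin T ->
  (forall x y, T (x * y) = T x * T y) ->
  (forall (W : vectType k) (F : H -> H -> W) x,
    (forall b, lin (fun a => F a b)) -> (forall a, lin (F a)) ->
    sw F (T x) = \sw_(a, b <- x) F (T a) b) ->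
  forall x, iter (p ^ n) T x = x.
Proof.
move=> T_inj Tlin TM T_col.
pose vec (v : 'rV[k]_N) : H := \sum_i v 0 i *: (vbasis {:H})`_i.
have vec_lin : lin vec.
  by move=> c v w; rewrite /vec scaler_sumr -big_split; apply: eq_bigr => i _;
     rewrite !mxE scalerDl scalerA.
pose A : 'M[k]_N := \matrix_(i, j) coord (vbasis {:H}) j (T (vbasis {:H})`_i).
have vecA v : T (vec v) = vec (v *m A).
  rewrite [LHS]vbasis_sum; apply: eq_bigr => j _; congr (_ *: _).
  rewrite /vec (lin_sum _ _ _ Tlin) linear_sum mxE; apply: eq_bigr => i _.
  by rewrite (lin_scale _ _ Tlin) linearZ mxE.
have vecAj j v : iter j T (vec v) = vec (v *m A ^+ j).
  elim: j => [|j IH]; first by rewrite mulmx1.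
  by rewrite iterS IH vecA exprSr mulmxA.
have [|P Pu [mu Pmu]] := @expr_pchar_diagonalizable _ _ charp _ A n.
  by rewrite dimH.
pose X := [tuple vec (row a P) | a < N].
have XE (a : 'I_N) : X`_a = vec (row a P) by rewrite -tnth_nth tnth_mktuple.
have X_free : free X.
  have /freeP fr := basis_free (vbasisP {:H}).
  apply/freeP => c; under eq_bigr => a _ do rewrite XE -(lin_scale _ _ vec_lin).
  rewrite -(lin_sum _ _ _ vec_lin) => /fr c0; pose cv := \row_a c a.
  have : cv *m P = 0.
    apply/rowP => i; rewrite [RHS]mxE -[RHS](c0 i) !mxE summxE.
    by apply: eq_bigr => a _; rewrite !mxE.
  move/(congr1 (mulmx^~ (invmx P))); rewrite mulmxK // mul0mx => /rowP cv0 i.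
  by have := cv0 i; rewrite !mxE.
have X_basis : basis_of {:H} X.
  by rewrite basisEfree X_free subvf size_tuple leqnn.
(* The diagonal case is applied to the p^n-th iterate of [T], which is diagonalizable and still a
   translation. *)
apply: (@translation_diagonal_trivial _ X (mu 0)) => //.
- by elim: (p ^ n)%N => // j IH x y /T_inj /IH.
- by elim: (p ^ n)%N => // j IH x y; rewrite !iterS IH TM.
- by elim: (p ^ n)%N => // j IH c x y; rewrite !iterS IH Tlin.
- move=> W F; elim: (p ^ n)%N F => // j IH F x F1 F2.
  by rewrite iterS T_col // (IH (fun a b => F (T a) b)) // => b;
    apply: (lin_comp (F1 b)).
move=> a; rewrite XE vecAj -(lin_scale _ _ vec_lin); congr vec.
by rewrite -row_mul Pmu; apply/rowP => j; rewrite mul_diag_mx !mxE.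
Qed.

End TranslationUnipotent.

(** * Freeness over the grouplike elements *)

Lemma sum_option (V : nmodType) (I : finType) (F : option I -> V) :
  \sum_o F o = F None + \sum_i F (Some i).
Proof.
rewrite (bigD1 None) //=; congr (_ + _).
rewrite (reindex_omap Some id) => [|[]] //=.
by apply: eq_bigl => i; rewrite eqxx.
Qed.

Section IndependentFamily.
Context (k : fieldType) (V : vectType k) (I : finType) (f : I -> V).

Definition indep : Prop :=
  forall c : I -> k, \sum_i c i *: f i = 0 -> forall i, c i = 0.

Let X := [tuple f (enum_val i) | i < #|I|].

Let XE (i : 'I_#|I|) : X`_i = f (enum_val i).
Proof. by rewrite -tnth_nth tnth_mktuple. Qed.

Lemma indep_free : indep -> free X.
Proof.
move=> fi; apply/freeP => c; under eq_bigr => i _ do rewrite XE.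
move=> c0 i; have := fi (c \o enum_rank) _ (enum_val i); rewrite /= enum_valK.
apply; rewrite (reindex _ (onW_bij _ (@enum_val_bij I))) -[RHS]c0 /=.
by apply: eq_bigr => j _; rewrite enum_valK.
Qed.

Lemma indep_dual : indep -> exists phi : I -> V -> k,
  (forall i, lin (phi i : V -> k^o)) /\ forall i j, phi i (f j) = (i == j)%:R.
Proof.
move=> /indep_free X_free; exists (fun i => coord X (enum_rank i)).
split=> [i|i j]; first exact: lin_coord.
rewrite -(enum_rankK j) -XE coord_free // enum_rankK eq_sym.
by rewrite (inj_eq enum_rank_inj).
Qed.

Lemma indep_card (P : {vspace V}) : indep -> (forall i, f i \in P) ->
  (#|I| <= \dim P)%N.
Proof.
move=> /indep_free X_free fP; rewrite -[#|I|](size_tuple X) -(eqP X_free).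
by apply/dimvS/span_subvP => _ /mapP [i _ ->].
Qed.

Lemma indep_span : indep -> #|I| = \dim {:V} ->
  forall x, exists c : I -> k, x = \sum_i c i *: f i.
Proof.
move=> /indep_free X_free card x.
have X_basis : basis_of {:V} X
  by rewrite basisEfree X_free subvf size_tuple card leqnn.
exists (fun i => coord X (enum_rank i) x).
rewrite {1}(coord_basis X_basis (memvf x)).
rewrite [RHS](reindex _ (onW_bij _ (@enum_val_bij I))) /=.
by apply: eq_bigr => i _; rewrite XE enum_valK.
Qed.

End IndependentFamily.

Section PGroupFix.
Context (k : fieldType) (p : nat) (gT : finGroupType) (V : vectType k).
Hypothesis charp : p \in [pchar k].
Hypothesis pG : (p.-group [set: gT])%g.
Context (act : gT -> V -> V) (M : {vspace V}).
Hypothesis act_lin : forall x, lin (act x).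
Hypothesis act1 : forall v, act 1%g v = v.
Hypothesis actM : forall x y v, act (x * y)%g v = act y (act x v).
Hypothesis actS : forall x v, v \in M -> act x v \in M.
Local Notation b := (vbasis M).

Let A x : 'M[k]_(\dim M) := \matrix_(i, j) coord b j (act x b`_i).

Let vec (v : 'rV[k]_(\dim M)) := \sum_i v 0 i *: b`_i.

Let vecM v : vec v \in M.
Proof.
by apply: memv_suml => i _; rewrite memvZ // vbasis_mem // mem_nth ?size_tuple.
Qed.

Let vec_inj : injective vec.
Proof.
move=> v w vw; apply/rowP => i; have := congr1 (coord b i) vw.
by rewrite !coord_sum_free ?(basis_free (vbasisP M)).
Qed.

Let vecA x v : vec (v *m A x) = act x (vec v).
Proof.
rewrite [RHS](coord_vbasis (actS x (vecM v))); apply: eq_bigr => j _.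
congr (_ *: _); rewrite (lin_sum _ _ _ (act_lin x)) linear_sum mxE.
by apply: eq_bigr => i _; rewrite (lin_scale _ _ (act_lin x)) linearZ mxE.
Qed.

Let A_repr : mx_repr [set: gT] A.
Proof.
split=> [|x y _ _]; apply/row_matrixP => i; rewrite !rowE; apply: vec_inj.
  by rewrite vecA act1 mulmx1.
by rewrite mulmxA !vecA actM.
Qed.

Lemma pgroup_fixed_vector : M != 0%VS ->
  exists v, [/\ v \in M, v != 0 & forall x, act x v = v].
Proof.
rewrite -dimv_eq0 -lt0n => M0.
have := rfix_pgroup_pchar charp (MxRepresentation A_repr) M0 pG (subxx _).
set R := rfix_mx _ _ => R0; exists (vec (nz_row R)).
have fixR x : act x (vec (nz_row R)) = vec (nz_row R).
  rewrite -vecA; congr vec.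
  by have /rfix_mxP -> := nz_row_sub R; rewrite ?inE.
split=> //; apply: contraNneq R0 => v0.
by rewrite -nz_row_eq0; apply/eqP/vec_inj; rewrite v0 /vec big1 // => i _;
  rewrite mxE scale0r.
Qed.

End PGroupFix.

Section GrouplikeFreeness.
Context (k : fieldType) (p : nat) (H : hopfType k) (gT : finGroupType).
Hypothesis charp : p \in [pchar k].
Hypothesis pG : (p.-group [set: gT])%g.
Context (io : gT -> H).
Hypothesis io_inj : injective io.
Hypothesis ioM : forall x y, io (x * y)%g = io x * io y.
Hypothesis io1 : io 1%g = 1.
Hypothesis io_gl : forall x, grouplike (io x).
Local Notation S := (antipode : H -> H).
Local Notation e_ i := ((vbasis {:H})`_i).
Local Notation D := (\dim {:H}).

(** Comultiplying a relation that expresses [g] through the s_i with coefficients c_i, and comparing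
    first legs, gives c_i g = c_i s_i. *)
Lemma indep_grouplike (s : seq H) : uniq s -> all (@grouplike k H) s -> free s.
Proof.
elim: s => [|g s IH] /=; first by rewrite nil_free.
case/andP => gs us /andP[gg sg]; rewrite free_cons IH // andbT.
apply/negP => gin; have sfree := IH us sg.
pose X := in_tuple s; have Xfree : free X := sfree.
have gE : g = \sum_(i < size s) coord X i g *: s`_i.
  exact: (coord_span (X := X)).
have c0 i : coord X i g = 0.
  have : \sw_(a, b <- g) (coord X i a *: b) = coord X i g *: s`_i.
    rewrite {1}gE (lin_sum (f := sw (fun a b => coord X i a *: b))) //.
    rewrite (bigD1 i) //= big1 ?addr0 => [|j ji].
      rewrite (lin_scale (f := sw _)) // sw_grouplike //.
        by rewrite coord_free // eqxx scale1r.
      by apply: (allP sg); rewrite mem_nth.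
    rewrite (lin_scale (f := sw _)) // sw_grouplike //.
      by rewrite coord_free // (negPf ji) scale0r scaler0.
    by apply: (allP sg); rewrite mem_nth.
  rewrite sw_grouplike // => /eqP; rewrite -subr_eq0 -scalerBr scaler_eq0.
  case/orP => [/eqP //|]; rewrite subr_eq0 => /eqP gsi.
  by rewrite gsi mem_nth in gs.
have := grouplike_neq0 gg; rewrite gE big1 ?eqxx // => i _.
by rewrite c0 scale0r.
Qed.

Lemma indep_io : indep io.
Proof.
move=> c c0; pose X := [tuple io (enum_val i) | i < #|gT|].
have XE (i : 'I_#|gT|) : X`_i = io (enum_val i).
  by rewrite -tnth_nth tnth_mktuple.
have /freeP Xfree : free X.
  apply: indep_grouplike.
    by rewrite map_inj_uniq ?enum_uniq // => i j /io_inj /enum_val_inj.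
  by apply/allP => _ /mapP [i _ ->]; apply: io_gl.
move=> x; rewrite -(enum_rankK x).
apply: (Xfree (c \o enum_val) _ (enum_rank x)).
rewrite -[RHS]c0 [RHS](reindex _ (onW_bij _ (@enum_val_bij gT))).
by apply: eq_bigr => i _; rewrite XE.
Qed.

Definition group_norm : H := \sum_x io x.

Lemma group_norm_neq0 : group_norm != 0.
Proof.
apply/eqP => N0; have /(_ 1%g)/eqP : forall x : gT, (1 : k) = 0.
  apply: (indep_io (c := fun=> 1)); rewrite -[RHS]N0.
  by apply: eq_bigr => x _; rewrite scale1r.
by rewrite oner_eq0.
Qed.

Lemma io_group_norm x : io x * group_norm = group_norm.
Proof.
rewrite /group_norm mulr_sumr [RHS](reindex_inj (mulgI x)) /=.
by apply: eq_bigr => y _; rewrite ioM.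
Qed.

Lemma group_norm_io x : group_norm * io x = group_norm.
Proof.
rewrite /group_norm mulr_suml [RHS](reindex_inj (mulIg x)) /=.
by apply: eq_bigr => y _; rewrite ioM.
Qed.

Section Lifts.
Context (r : nat) (u : 'I_r -> H).
Hypothesis uN_indep : indep (fun i => u i * group_norm).

(** The linear relations form a space stable under translation by the group. If it is nonzero, the
    p-group has a nonzero fixed vector in it, that is, a relation with coefficients constant along
    the group, and this is a relation among the [u i * group_norm]. *)
Lemma indep_lifts : indep (fun ix : 'I_r * gT => u ix.1 * io ix.2).
Proof.
pose V : vectType k := {ffun 'I_r * gT -> k^o}.
pose Lf (C : V) : H := \sum_ix (C ix : k) *: (u ix.1 * io ix.2).
have Lf_lin : lin Lf.
  move=> c C C'; rewrite /Lf scaler_sumr -big_split; apply: eq_bigr => ix _ /=.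
  by rewrite !ffunE scalerDl scalerA.
have [L LE] := lin_hom Lf_lin.
pose act (y : gT) (C : V) : V := [ffun ix => C (ix.1, ix.2 * y^-1)%g].
have actL y C : L (act y C) = L C * io y.
  rewrite !LE /Lf mulr_suml (reindex (fun ix : 'I_r * gT =>
    (ix.1, (ix.2 * y)%g))) /=.
    by apply: eq_bigr => -[i x] _; rewrite ffunE /= mulgK ioM -scalerAl mulrA.
  exists (fun ix => (ix.1, ix.2 * y^-1)%g) => -[i x] _ /=;
    by rewrite ?mulgK ?mulgKV.
have L_inj : lker L == 0%VS.
  apply: contraT => /(pgroup_fixed_vector charp pG (act := act)) [].
  - by move=> y c C C'; apply/ffunP => ix; rewrite !ffunE.
  - by move=> C; apply/ffunP => -[i x]; rewrite ffunE /= invg1 mulg1.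
  - by move=> x y C; apply/ffunP => -[i z]; rewrite !ffunE /= invMg mulgA.
  - by move=> x C; rewrite !memv_ker actL => /eqP->; rewrite mul0r.
  move=> C []; rewrite memv_ker LE => /eqP C0 Cn0 Cfix.
  have CE i x : C (i, x) = C (i, 1%g).
    by have /ffunP/(_ (i, x)) := Cfix x; rewrite ffunE /= mulgV => <-.
  have := uN_indep (c := fun i => C (i, 1%g)).
  have -> : \sum_i (C (i, 1%g) : k) *: (u i * group_norm) = Lf C.
    transitivity (\sum_i \sum_x (C (i, x) : k) *: (u i * io x)); last first.
      by rewrite pair_bigA; apply: eq_bigr => -[].
    apply: eq_bigr => i _; rewrite mulr_sumr scaler_sumr.
    by apply: eq_bigr => x _; rewrite CE.
  move=> /(_ C0) C1; case/eqP: Cn0; apply/ffunP => -[i x].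
  by rewrite CE C1 ffunE.
move=> c c0 ix; have : L [ffun ix => c ix] = L 0.
  by rewrite linear0 LE -[RHS]c0; apply: eq_bigr => jx _; rewrite ffunE.
by have /lker0P inj := L_inj; move/inj/ffunP/(_ ix); rewrite !ffunE.
Qed.

Let T2 := tensor H H.
Let nn (a b : H) : T2 := \sum_x (a * io x) ⊗ (b * io x).
Let th (y z : H) : T2 := \sw_(a, b <- z) ((y * a) ⊗ b).

Let nnE a b : nn a b = \sw_(b1, b2 <- b) th (a * S b1) (b2 * group_norm).
Proof.
have thl y : lin (th y) by rewrite /th; lin.
under eq_sw => b1 b2 do rewrite mulr_sumr (lin_sum _ _ _ (thl _)).
rewrite sw_sum; apply: eq_bigr => x _; rewrite /th.
under eq_sw => b1 b2.
  rewrite swM //.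
  under eq_sw => z1 z2 do rewrite sw_grouplike // !mulrA -(mulrA a).
  over.
by rewrite (sw_lSl (G := fun y z => (a * y * io x) ⊗ (z * io x))) // mulr1.
Qed.

Hypothesis rE : forall x : H, exists c : 'I_r -> k,
  x * group_norm = \sum_i c i *: (u i * group_norm).
Hypothesis r_gt0 : (0 < r)%N.

(** A dimension count in H ⊗ H. By [nnE] all [nn a b] lie in the image of H ⊗ H N under the Galois
    map, of dimension at most r D. If some [w] were outside the span of the [u i * io x], then the r
    D elements [nn (e_ j) (u i)] together with one [nn (u i0) w] would be independent. *)
Lemma lifts_card : (r * #|gT|)%N = D.
Proof.
have := indep_card indep_lifts (fun ix => memvf _).
rewrite card_prod card_ord leq_eqVlt => /orP [/eqP //|lt].
pose us := [seq u ix.1 * io ix.2 | ix : 'I_r * gT].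
have [w wF] : exists w, w \notin <<us>>%VS.
  have : ~~ ({:H} <= <<us>>)%VS.
    apply: contraL lt => /dimvS le; rewrite -leqNgt (leq_trans le) //.
    by rewrite (leq_trans (dim_span _)) // size_map -cardE card_prod card_ord.
  by case/subvPn => w _ wF; exists w.
pose f (o : option ('I_r * gT)) : H :=
  if o is Some ix then u ix.1 * io ix.2 else w.
have f_indep : indep f.
  move=> c; rewrite sum_option /= => c0.
  have cN : c None = 0.
    apply: contraNeq wF => cN; rewrite -[w](scalerK cN) memvZ //.
    rewrite -[_ *: w](addrK (\sum_ix c (Some ix) *: (u ix.1 * io ix.2))) c0.
    rewrite sub0r memvN; apply: memv_suml => ix _; apply/memvZ/memv_span.
    by apply/mapP; exists ix; rewrite ?mem_enum.
  rewrite cN scale0r add0r in c0.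
  by case=> // ix; apply: (indep_lifts (c := c \o Some)).
have [phi [phil phiE]] := indep_dual f_indep.
pose ap (o : option ('I_r * gT)) (t : T2) : H :=
  tlift (fun a b => phi o b *: a) t.
have ap_lin o : lin (ap o) by rewrite /ap; lin.
have ap_pure o a b : ap o (a ⊗ b) = phi o b *: a.
  apply: tlift_pure; split=> [? ? ? ?|? c ? ?].
    by rewrite scalerDr !scalerA mulrC.
  by rewrite phil scalerDl scalerA.
have ap_nn o a b : ap o (nn a b) = \sum_x phi o (b * io x) *: (a * io x).
  by rewrite /nn (lin_sum _ _ _ (ap_lin o)); apply: eq_bigr => x _.
pose i0 := Ordinal r_gt0.
pose Ps := [seq th (e_ ji.1) (u ji.2 * group_norm) | ji : 'I_D * 'I_r].
pose P := <<Ps>>%VS.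
have thP y z : th y (z * group_norm) \in P.
  have thl y' : lin (th y') by rewrite /th; lin.
  have thl' z' : lin (fun y' => th y' z') by rewrite /th; lin.
  have [c ->] := rE z; rewrite (lin_sum _ _ _ (thl _)); apply: memv_suml => i _.
  rewrite (lin_scale _ _ (thl _)) memvZ //
    [y]vbasis_sum (lin_sum _ _ _ (thl' _)).
  apply: memv_suml => j _; rewrite (lin_scale _ _ (thl' _)) memvZ //
    memv_span //.
  by apply/mapP; exists (j, i); rewrite // mem_enum.
have nnP a b : nn a b \in P by rewrite nnE; apply: memv_sw.
pose g (o : option ('I_r * 'I_D)) : T2 :=
  if o is Some ij then nn (e_ ij.2) (u ij.1) else nn (u i0) w.
have g_indep : indep g.
  move=> c; rewrite sum_option /= => c0.
  have ap0 o : c None *: ap o (nn (u i0) w) +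
      \sum_ij c (Some ij) *: ap o (nn (e_ ij.2) (u ij.1)) = 0.
    have := congr1 (ap o) c0; rewrite (lin_add _ _ (ap_lin o)).
    rewrite (lin_scale _ _ (ap_lin o)) (lin_0 (ap_lin o)) => E; rewrite -[RHS]E.
    congr (_ + _); rewrite [RHS](lin_sum _ _ _ (ap_lin o)).
    by apply: eq_bigr => ij _; rewrite (lin_scale _ _ (ap_lin o)).
  have ap_nn_u o j i : ap o (nn (e_ j) (u i)) =
      if o is Some (i', x) then (if i' == i then e_ j * io x else 0) else 0.
    rewrite ap_nn; case: o => [[i' x]|].
      rewrite (bigD1 x) //= big1 ?addr0 => [|y yx].
        rewrite (phiE _ (Some (i, x))) (inj_eq Some_inj) xpair_eqE eqxx andbT.
        by case: eqP; rewrite ?scale1r ?scale0r.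
      rewrite (phiE _ (Some (i, y))) (inj_eq Some_inj) xpair_eqE (eq_sym x).
      by rewrite (negPf yx) andbF scale0r.
    by apply: big1 => x _; rewrite (phiE _ (Some (i, x))) scale0r.
  have cN : c None = 0.
    have := ap0 None; rewrite [X in _ + X]big1 => [|ij _]; last first.
      by rewrite ap_nn_u scaler0.
    rewrite addr0 ap_nn scaler_sumr => E.
    pose c' (ix : 'I_r * gT) :=
      if ix.1 == i0 then c None * phi None (w * io ix.2) else 0.
    have := indep_lifts (c := c') _ (i0, 1%g); rewrite /c' /= ?eqxx io1 mulr1.
    rewrite (phiE None None) mulr1; apply; rewrite -[RHS]E.
    rewrite -(pair_bigA _ (fun i x =>
      (if i == i0 then c None * phi None (w * io x) else 0) *:
      (u i * io x))).
    rewrite /= (bigD1 i0) //= [X in _ + X]big1 ?addr0 => [|i ii0].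
      by apply: eq_bigr => x _; rewrite ?eqxx scalerA.
    by rewrite big1 // => x _; rewrite (negPf ii0) scale0r.
  case=> // -[i j]; have := ap0 (Some (i, 1%g)).
  rewrite cN scale0r add0r; under eq_bigr => ij _ do rewrite ap_nn_u.
  move=> E; have : \sum_i' \sum_j' c (Some (i', j')) *:
      (if i == i' then e_ j' * io 1%g else 0) = 0.
    by rewrite pair_bigA -[RHS]E; apply: eq_bigr => -[].
  rewrite (bigD1 i) //= [X in _ + X]big1 ?addr0 => [|i' i'i]; last first.
    by rewrite big1 // => j' _; rewrite eq_sym (negPf i'i) scaler0.
  have /freeP fr := basis_free (vbasisP {:H}).
  move=> {}E; apply: (fr (fun j => c (Some (i, j)))); rewrite -[RHS]E.
  by apply: eq_bigr => j' _; rewrite eqxx io1 mulr1.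
have : (#|{: option ('I_r * 'I_D)}| <= \dim P)%N.
  by apply: (indep_card g_indep) => -[ij|]; apply: nnP.
move/leq_trans/(_ (dim_span _)); rewrite size_map -cardE.
by rewrite card_option !card_prod !card_ord mulnC ltnn.
Qed.

End Lifts.
Lemma grouplike_freeness : exists r (u : 'I_r -> H),
  [/\ (r * #|gT|)%N = D,
      indep (fun ix : 'I_r * gT => u ix.1 * io ix.2),
      indep (fun i => u i * group_norm)
    & forall x, exists c : 'I_r -> k,
        x * group_norm = \sum_i c i *: (u i * group_norm)].
Proof.
have Nl : lin (fun x : H => x * group_norm) by lin.
have [L LE] := lin_hom Nl.
pose W := limg L; pose u (i : 'I_(\dim W)) := (L^-1)%VF (vbasis W)`_i.
have uE i : u i * group_norm = (vbasis W)`_i.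
  by rewrite -LE limg_lfunVK // vbasis_mem // mem_nth ?size_tuple.
have uN : indep (fun i => u i * group_norm).
  move=> c; under eq_bigr => i _ do rewrite uE.
  by have /freeP := basis_free (vbasisP W); apply.
have uS x : exists c : 'I_(\dim W) -> k,
    x * group_norm = \sum_i c i *: (u i * group_norm).
  exists (fun i => coord (vbasis W) i (x * group_norm)).
  under eq_bigr => i _ do rewrite uE.
  by rewrite -coord_vbasis // -LE memv_img ?memvf.
have W_gt0 : (0 < \dim W)%N.
  rewrite lt0n dimv_eq0; apply: contraNneq group_norm_neq0 => W0.
  by rewrite -memv0 -W0 -[group_norm]mul1r -LE memv_img ?memvf.
exists (\dim W), u; split=> //; first exact: lifts_card uN uS W_gt0.
exact: indep_lifts uN.
Qed.

End GrouplikeFreeness.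

(** * The group of grouplike elements *)

Section GrouplikeGroup.
Context (k : fieldType) (H : hopfType k).
Local Notation S := (antipode : H -> H).

Lemma grouplike1 : grouplike (1 : H).
Proof. by rewrite /grouplike /= oner_eq0 comul1 eqxx. Qed.

Lemma grouplikeM (g h : H) : grouplike g -> grouplike h -> grouplike (g * h).
Proof.
move=> gg gh; apply/andP; split; last first.
  by case/andP: gg => _ /eqP gE; case/andP: gh => _ /eqP hE;
     rewrite comulM gE hE tmul_pure.
apply: contraTN (oner_neq0 k) => gh0; rewrite negbK.
have := counitM g h; rewrite (counit_grouplike gg) (counit_grouplike gh) mulr1.
by rewrite (eqP gh0) linear0 => <-.
Qed.

Lemma grouplikeV (g : H) : grouplike g -> grouplike (S g).
Proof.
move=> gg; apply/andP; split.
  apply: contraTneq (oner_neq0 k) => g0; rewrite negbK.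
  by rewrite -(counit_grouplike gg) -counit_antipode g0 linear0.
by rewrite -sw_tpure sw_antipode // sw_grouplike.
Qed.

Context (s : seq H) (sP : s =i @grouplike k H).

(** The proof indexes the type, so that the group laws, which are built from it, can be declared as
    instances on the type. *)
Definition gl_type (_ : s =i @grouplike k H) : Type := seq_sub s.

HB.instance Definition _ := Finite.copy (gl_type sP) (seq_sub s).

Definition gl_val (x : gl_type sP) : H := ssval x.

Lemma gl_val_inj : injective gl_val. Proof. exact: val_inj. Qed.

Lemma gl_valP x : grouplike (gl_val x).
Proof. by have := ssvalP x; rewrite sP. Qed.

Fact gl_mem (g : H) : grouplike g -> g \in s.
Proof. by rewrite sP. Qed.

Definition gl_sub (g : H) (gg : grouplike g) : gl_type sP := SeqSub (gl_mem gg).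

Definition gl_mul x y := gl_sub (grouplikeM (gl_valP x) (gl_valP y)).
Definition gl_one := gl_sub grouplike1.
Definition gl_inv x := gl_sub (grouplikeV (gl_valP x)).

Fact gl_mulA : associative gl_mul.
Proof. by move=> x y z; apply: gl_val_inj; rewrite /gl_val /= mulrA. Qed.
Fact gl_mul1 : left_id gl_one gl_mul.
Proof. by move=> x; apply: gl_val_inj; rewrite /gl_val /= mul1r. Qed.
Fact gl_mulV : left_inverse gl_one gl_inv gl_mul.
Proof.
by move=> x; apply: gl_val_inj; rewrite [LHS]grouplikeVl //; apply: gl_valP.
Qed.

HB.instance Definition _ :=
  Finite_isGroup.Build (gl_type sP) gl_mulA gl_mul1 gl_mulV.

Lemma gl_valM (x y : gl_type sP) : gl_val (x * y)%g = gl_val x * gl_val y.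
Proof. by []. Qed.

Lemma gl_val1 : gl_val 1%g = 1. Proof. by []. Qed.

Lemma card_gl_type : uniq s -> #|{: gl_type sP}| = size s.
Proof. by move=> us; rewrite card_seq_sub. Qed.

End GrouplikeGroup.

(** * Subcoalgebras and cosemisimplicity *)

Section Subcoalgebra.
Context (k : fieldType) (C : coalgType k).
Implicit Types (D E : {vspace C}).

Lemma subcoalgebraP D :
  reflect (forall x, x \in D -> comul x \in tspace D D) (subcoalgebra D).
Proof.
apply: (iffP subvP) => sub => [x xD|_ /memv_imgP [x xD ->]]; last exact: sub.
by apply/sub/memv_img.
Qed.

Lemma tspaceS D E : (D <= E)%VS -> (tspace D D <= tspace E E)%VS.
Proof.
move=> /subvP sub; apply/span_subvP => _ /allpairsP [[c d] /= [cD dD ->]].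
by apply: mem_tspace; apply/sub/vbasis_mem.
Qed.

Lemma sw_subcoalgebra (W : vectType k) (P : {vspace W}) D (F : C -> C -> W) x :
  (forall b, lin (fun a => F a b)) -> (forall a, lin (F a)) ->
  subcoalgebra D -> x \in D ->
  (forall a b, a \in D -> b \in D -> F a b \in P) -> sw F x \in P.
Proof.
move=> F1 F2 /subcoalgebraP sub /sub; rewrite /sw => xD FP.
have Fl : lin (tlift F) by apply: lin_linear.
pose X := in_tuple [seq c ⊗ d | c <- vbasis D, d <- vbasis D].
have {}xD : comul x \in <<X>>%VS := xD.
rewrite (coord_span xD) (lin_sum _ _ _ Fl); apply: memv_suml => i _.
rewrite (lin_scale _ _ Fl) memvZ //.
have /allpairsP [[c d] /= [cD dD ->]] : X`_i \in tval X.
  by rewrite mem_nth // ltn_ord.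
by rewrite tlift_pure // FP // vbasis_mem.
Qed.

Lemma eq_sw_subcoalgebra (W : vectType k) D (F G : C -> C -> W) x :
  (forall b, lin (fun a => F a b)) -> (forall a, lin (F a)) ->
  (forall b, lin (fun a => G a b)) -> (forall a, lin (G a)) ->
  subcoalgebra D -> x \in D ->
  (forall a b, a \in D -> b \in D -> F a b = G a b) -> sw F x = sw G x.
Proof.
move=> F1 F2 G1 G2 sub xD FG; apply/eqP; rewrite -subr_eq0 -sw_sub -memv0.
apply: (sw_subcoalgebra _ _ sub xD) => [b|a|a b aD bD].
- by move=> c u v; rewrite F1 G1 scalerBr opprD addrACA.
- by move=> c u v; rewrite F2 G2 scalerBr opprD addrACA.
by rewrite FG // subrr mem0v.
Qed.

Lemma subcoalgebra_add D E : subcoalgebra D -> subcoalgebra E ->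
  subcoalgebra (D + E)%VS.
Proof.
move=> /subcoalgebraP sD /subcoalgebraP sE; apply/subcoalgebraP => x.
case/memv_addP => [d dD [e eE ->]]; rewrite linearD memvD //.
  exact: (subvP (tspaceS (addvSl D E))) (sD _ dD).
exact: (subvP (tspaceS (addvSr D E))) (sE _ eE).
Qed.

Lemma subcoalgebra0 : subcoalgebra (0%VS : {vspace C}).
Proof.
by apply/subcoalgebraP => x; rewrite memv0 => /eqP->; rewrite linear0 mem0v.
Qed.

Lemma subcoalgebra_sum (s : seq {vspace C}) :
  (forall D, D \in s -> subcoalgebra D) -> subcoalgebra (\sum_(D <- s) D)%VS.
Proof.
elim: s => [|D s IH] sub; first by rewrite big_nil subcoalgebra0.
rewrite big_cons subcoalgebra_add ?IH ?sub ?mem_head // => E Es.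
by rewrite sub // inE Es orbT.
Qed.

(** Descent on the dimension. Whether a proper nonzero subcoalgebra exists is not decided over a
    general field, hence [classically]. *)
Lemma ex_simple_subcoalgebra D : subcoalgebra D -> D != 0%VS ->
  classically (exists2 E, simple_subcoalgebra E & (E <= D)%VS).
Proof.
have [m] := ubnP (\dim D); elim: m D => // m IH D le sD D0.
pose P := exists E, [/\ subcoalgebra E, (E <= D)%VS, E != 0%VS & E != D].
apply: (classic_bind _ (@classic_EM P)) => -[[E [sE ED E0 EnD]]|nP].
  have lt : (\dim E < m)%N.
    rewrite ltnS in le; apply: leq_trans le.
    by rewrite ltn_neqAle dimvS // andbT; apply: contra EnD => e;
      rewrite eqEdim ED (eqP e) /=.
  apply: (classic_bind _ (IH E lt sE E0)) => -[F sF FE].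
  by apply/classicP => nE; apply: nE; exists F => //; apply: subv_trans ED.
apply/classicP => nE; apply: nE; exists D => //; split=> // E sE ED.
have [->|E0] := eqVneq E 0%VS; first by left.
have [->|EnD] := eqVneq E D; first by right.
by case: nP; exists E.
Qed.

End Subcoalgebra.

(** * Complements of subcoalgebras from a normalized integral (dual Maschke theorem) *)

Section Averaging.
Context (k : fieldType) (H : hopfType k) (l : H -> k).
Hypothesis l_int : right_integral l.
Hypothesis l1 : l 1 = 1.
Local Notation S := (antipode : H -> H).
Local Notation eps x := (counit x : k).

Let ll : lin (l : H -> k^o). Proof. by case: l_int. Qed.
Let l_right x : \sw_(a, b <- x) (l a *: b) = l x *: 1.
Proof. by case: l_int. Qed.

(** Evaluating [rint_left] at 1, where [l] is 1, shows that the distinguished grouplike element is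
    1. *)
Let l_left x : \sw_(a, b <- x) (l b *: a) = l x *: 1.
Proof.
have l_neq0 : exists x, l x != 0 by exists 1; rewrite l1 oner_neq0.
have [L LE] := ex_dual_integral l_int l_neq0.
rewrite (rint_left l_int l_neq0 LE).
have := rint_left l_int l_neq0 LE 1; rewrite sw1 // l1 !scale1r => <- //.
Qed.

Let shift_left y b : \sw_(c, d <- y) (l (d * S b) *: c)
  = \sw_(b1, b2 <- b) (l (y * S b1) *: b2).
Proof.
transitivity (\sw_(u, r <- b) \sw_(v, b2 <- r) \sw_(y1, y2 <- y)
  (l (y2 * S u) *: (y1 * (S v * b2)))).
  rewrite (sw_rSl (G := fun u z =>
    \sw_(y1, y2 <- y) (l (y2 * S u) *: (y1 * z)))) //.
  by apply: eq_sw => y1 y2; rewrite mulr1.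
rewrite -swA; apply: eq_sw => b1 b2.
rewrite -[X in l _ *: X]mul1r scalerAl -l_left
  (lin_swE (g := fun z => z * b2)) //.
rewrite swM // [RHS]exchange_sw sw_antipode //.
by apply: eq_sw => u v; apply: eq_sw => y1 y2; rewrite -scalerAl !mulrA.
Qed.

Let shift_right a y : \sw_(c, d <- y) (l (S a * c) *: d)
  = \sw_(a1, a2 <- a) (l (S a2 * y) *: a1).
Proof.
transitivity (\sw_(a1, r <- a) \sw_(u, v <- r) \sw_(y1, y2 <- y)
  (l (S v * y1) *: (a1 * S u * y2))).
  rewrite (sw_lSr (G := fun z v =>
    \sw_(y1, y2 <- y) (l (S v * y1) *: (z * y2)))) //.
  by apply: eq_sw => y1 y2; rewrite mul1r.
apply: eq_sw => a1 a2.
rewrite -[X in l _ *: X]mulr1 scalerAr -l_right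
  (lin_swE (g := fun z => a1 * z)) //.
rewrite swM // sw_antipode //; apply: eq_sw => u v; apply: eq_sw => y1 y2.
by rewrite -scalerAr !mulrA.
Qed.

Context (D : {vspace H}).
Hypothesis sub : subcoalgebra D.

(** Averaging a linear projection onto [D] with the integral makes it colinear on the right;
    averaging [pr1] on the other side gives [pr2], a projection that is colinear on both sides. *)
Let pr1 (h : H) : H :=
  \sw_(a, b <- h) \sw_(c, d <- projv D a) (l (d * S b) *: c).
Let pr2 (h : H) : H :=
  \sw_(a, b <- h) \sw_(c, d <- pr1 b) (l (S a * c) *: d).

Let pr1_lin : lin pr1. Proof. by rewrite /pr1; lin. Qed.
Let pr2_lin : lin pr2. Proof. by rewrite /pr2; lin. Qed.

Let pr1_mem h : pr1 h \in D.
Proof.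
apply: memv_sw => a b; apply: (sw_subcoalgebra _ _ sub) => //.
  exact: memv_proj.
by move=> c d cD dD; apply: memvZ.
Qed.

Let pr2_mem h : pr2 h \in D.
Proof.
apply: memv_sw => a b; apply: (sw_subcoalgebra _ _ sub) => //.
by move=> c d cD dD; apply: memvZ.
Qed.

Let pr1_id h : h \in D -> pr1 h = h.
Proof.
move=> hD; rewrite /pr1.
rewrite (eq_sw_subcoalgebra (G := fun a b => \sw_(c, d <- a) (l (d * S b) *: c))
  _ _ _ _ sub hD) // => [|a b aD bD]; last by rewrite projv_id.
rewrite swA -[RHS](swr (f := fun c => c)) //; apply: eq_sw => c r.
rewrite -(lin_swE (g := fun t : k^o => (t : k) *: c)
  (fun d b => l (d * S b) : k^o)) //.
by rewrite (sw_Sr (G := l : H -> k^o)) // l1 [X in X *: c]mulr1.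
Qed.

Let pr2_id h : h \in D -> pr2 h = h.
Proof.
move=> hD; rewrite /pr2.
rewrite (eq_sw_subcoalgebra (G := fun a b => \sw_(c, d <- b) (l (S a * c) *: d))
  _ _ _ _ sub hD) // => [|a b aD bD]; last by rewrite pr1_id.
rewrite -swA -[RHS](swl (f := fun c => c)) //; apply: eq_sw => r d.
rewrite -(lin_swE (g := fun t : k^o => (t : k) *: d)
  (fun a c => l (S a * c) : k^o)) //.
by rewrite (sw_Sl (G := l : H -> k^o)) // l1 [X in X *: d]mulr1.
Qed.

Let pr1_colinear (W : vectType k) (F : H -> H -> W) h :
  (forall b, lin (fun a => F a b)) -> (forall a, lin (F a)) ->
  sw F (pr1 h) = \sw_(a, b <- h) F (pr1 a) b.
Proof.
move=> F1 F2; transitivity (\sw_(a, b <- h) \sw_(c, r <- projv D a)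
    \sw_(b1, b2 <- b) (l (r * S b1) *: F c b2)).
  rewrite /pr1 (lin_swE (g := sw F)) //; apply: eq_sw => a b.
  rewrite (lin_swE (g := sw F)) //.
  under eq_sw => c d do rewrite (lin_scale (f := sw F)) // -sw_scale.
  rewrite swA; apply: eq_sw => c r.
  transitivity (F c (\sw_(b1, b2 <- b) (l (r * S b1) *: b2))).
    rewrite -shift_left (lin_swE (g := F c)) //; apply: eq_sw => u v.
    by rewrite (lin_scale (f := F c)).
  by rewrite (lin_swE (g := F c)) //; apply: eq_sw => u v;
    rewrite (lin_scale (f := F c)).
under eq_sw => a b do rewrite exchange_sw.
rewrite -swA; apply: eq_sw => a b.
rewrite /pr1 (lin_swE (g := fun z => F z b)) //; apply: eq_sw => a1 a2.
rewrite (lin_swE (g := fun z => F z b)) //; apply: eq_sw => c d.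
by rewrite (lin_scale (f := fun z => F z b)).
Qed.

Let pr2_colinearr (W : vectType k) (F : H -> H -> W) h :
  (forall b, lin (fun a => F a b)) -> (forall a, lin (F a)) ->
  sw F (pr2 h) = \sw_(a, b <- h) F (pr2 a) b.
Proof.
move=> F1 F2.
transitivity (\sw_(a, b <- h) \sw_(b1, b2 <- b) \sw_(c, d <- pr1 b1)
   (l (S a * c) *: F d b2)).
  rewrite /pr2 (lin_swE (g := sw F)) //; apply: eq_sw => a b.
  rewrite (lin_swE (g := sw F)) //.
  under eq_sw => c d do rewrite (lin_scale (f := sw F)) // -sw_scale.
  by rewrite -swA (pr1_colinear (F := fun c' d2 => \sw_(c, d1 <- c')
     (l (S a * c) *: F d1 d2))).
rewrite -swA; apply: eq_sw => p q.
rewrite /pr2 (lin_swE (g := fun z => F z q)) //; apply: eq_sw => a b.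
rewrite (lin_swE (g := fun z => F z q)) //; apply: eq_sw => c d.
by rewrite (lin_scale (f := fun z => F z q)).
Qed.

Let pr2_colinearl (W : vectType k) (F : H -> H -> W) h :
  (forall b, lin (fun a => F a b)) -> (forall a, lin (F a)) ->
  sw F (pr2 h) = \sw_(a, b <- h) F a (pr2 b).
Proof.
move=> F1 F2; transitivity (\sw_(a, b <- h) \sw_(r, d2 <- pr1 b)
    \sw_(a1, a2 <- a) (l (S a2 * r) *: F a1 d2)).
  rewrite /pr2 (lin_swE (g := sw F)) //; apply: eq_sw => a b.
  rewrite (lin_swE (g := sw F)) //.
  under eq_sw => c d do rewrite (lin_scale (f := sw F)) // -sw_scale.
  rewrite -swA; apply: eq_sw => r d2.
  transitivity (F (\sw_(a1, a2 <- a) (l (S a2 * r) *: a1)) d2).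
    rewrite -shift_right (lin_swE (g := fun z => F z d2)) //;
      apply: eq_sw => u v.
    by rewrite (lin_scale (f := fun z => F z d2)).
  rewrite (lin_swE (g := fun z => F z d2)) //; apply: eq_sw => u v.
  by rewrite (lin_scale (f := fun z => F z d2)).
under eq_sw => a b do rewrite exchange_sw.
rewrite swA; apply: eq_sw => a b.
rewrite /pr2 (lin_swE (g := F a)) //; apply: eq_sw => a1 a2.
rewrite (lin_swE (g := F a)) //; apply: eq_sw => c d.
by rewrite (lin_scale (f := F a)).
Qed.

Lemma subcoalgebra_complement : exists K : {vspace H},
  [/\ subcoalgebra K, (D + K)%VS = {:H}%VS & (D :&: K)%VS = 0%VS].
Proof.
have [P PE] := lin_hom pr2_lin.
have PK x : P (x - P x) = 0.
  by rewrite linearB /= !PE (pr2_id (pr2_mem x)) subrr.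
exists (lker P); split; first last.
- apply/eqP; rewrite -subv0; apply/subvP => x; rewrite memv_cap memv_ker.
  by case/andP => xD; rewrite PE pr2_id // memv0.
- apply/eqP; rewrite eqEsubv subvf; apply/subvP => x _.
  rewrite -[x](subrK (P x)) addrC memv_add //; first by rewrite PE.
  by rewrite memv_ker PK.
apply/subcoalgebraP => x; rewrite memv_ker PE => /eqP x0.
have xE : comul x = \sw_(a, b <- x) ((a - pr2 a) ⊗ b).
  have tl (a a' b : H) : (a - a') ⊗ b = a ⊗ b - a' ⊗ b.
    by rewrite -scaleN1r addrC (lin_tpurel b) scaleN1r addrC.
  under eq_sw => a b do rewrite tl.
  rewrite sw_sub sw_tpure -(pr2_colinearr (F := fun a b => a ⊗ b)) // x0.
  by rewrite sw_tpure linear0 subr0.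
(* For [x] in the kernel, colinearity on either side allows the complementary projection to be
   inserted in each leg. *)
have -> : comul x = \sw_(a, b <- x) ((a - pr2 a) ⊗ (b - pr2 b)).
  have tr (a b b' : H) : a ⊗ (b - b') = a ⊗ b - a ⊗ b'.
    by rewrite -scaleN1r addrC (lin_tpurer a) scaleN1r addrC.
  under eq_sw => a b do rewrite tr.
  have Fl : lin (fun a => a - pr2 a).
    by move=> c u v; rewrite pr2_lin scalerBr opprD addrACA.
  rewrite sw_sub -xE -(pr2_colinearl (F := fun a b => (a - pr2 a) ⊗ b)).
  - by rewrite x0 /sw linear0 /tlift big1 ?subr0 // => i _;
      rewrite big1 // => j _; rewrite mxE scale0r.
  - by move=> b; apply: (lin_comp (lin_tpurel b)).
  by lin.
by apply: memv_sw => a b; apply: mem_tspace; rewrite memv_ker -PE PK.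
Qed.

End Averaging.

(** If [l 1] is nonzero, rescaling [l] gives a normalized integral. As long as a sum of simple
    subcoalgebras is not all of H, it then has a nonzero complement, which contains a further simple
    subcoalgebra. *)
Lemma rint1_eq0 (k : fieldType) (H : hopfType k) (l : H -> k) :
  right_integral l -> ~ cosemisimple H -> l 1 = 0.
Proof.
case=> ll l_inv ncss; apply/eqP; apply: contraT => l1.
pose l' x := (l 1)^-1 * l x.
have l'_int : right_integral l'.
  split; first by rewrite /l'; lin.
  move=> x; rewrite /l' -scalerA -l_inv -sw_scale.
  by apply: eq_sw => a b; rewrite scalerA.
have l'1 : l' 1 = 1 by rewrite /l' mulVf.
suff css : classically (exists2 s : seq {vspace H},
    forall D, D \in s -> simple_subcoalgebra D &
      (\sum_(D <- s) D)%VS = {:H}%VS).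
  apply: css => -[s ss sE]; case: ncss => x; exists s => //.
  by rewrite sE memvf.
have [m] := ubnP (\dim {:H} - \dim (\sum_(D <- ([::] : seq {vspace H})) D))%N.
have: forall D : {vspace H}, D \in [::] -> simple_subcoalgebra D by [].
elim: m [::] => // m IH s ss le.
have sub : subcoalgebra (\sum_(D <- s) D)%VS.
  by apply: subcoalgebra_sum => D /ss [].
have [K [sK KE K0]] := subcoalgebra_complement l'_int l'1 sub.
have [Kz|Kn0] := eqVneq K 0%VS.
  by apply/classicP => nE; apply: nE; exists s; rewrite // -KE Kz addv0.
apply: (classic_bind _ (ex_simple_subcoalgebra sK Kn0)) => -[E sE EK].
apply: (IH (E :: s)); first by move=> D; rewrite inE => /predU1P [-> //|/ss].
rewrite ltnS in le; apply: leq_trans le.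
have lt : (\dim (\sum_(D <- s) D) < \dim (\sum_(D <- E :: s) D))%N.
  rewrite big_cons addvC dimv_disjoint_sum.
    by case: sE => _ E0 _; rewrite -[X in (X < _)%N]addn0 ltn_add2l lt0n
      dimv_eq0.
  by apply/eqP; rewrite -subv0 -[X in (_ <= X)%VS]K0; apply: capvS.
rewrite ltn_sub2l //; apply: leq_trans lt _.
exact/dimvS/subvf.
Qed.

(** * Translation operators *)

Section Translations.
Context (k : fieldType) (H : hopfType k).
Local Notation S := (antipode : H -> H).
Local Notation eps x := (counit x : k).

Definition ltrans (b : H -> k) (h : H) : H := \sw_(a, c <- h) (b a *: c).
Definition rtrans (b : H -> k) (h : H) : H := \sw_(a, c <- h) (b c *: a).

Lemma lin_ltrans b : lin (ltrans b). Proof. by rewrite /ltrans; lin. Qed.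
Lemma lin_rtrans b : lin (rtrans b). Proof. by rewrite /rtrans; lin. Qed.

Lemma eq_ltrans b c : b =1 c -> ltrans b =1 ltrans c.
Proof. by move=> bc h; apply: eq_sw => x y; rewrite bc. Qed.

Section Functional.
Context (b : H -> k).
Hypothesis b_lin : lin (b : H -> k^o).

Lemma ltrans_colinear (W : vectType k) (F : H -> H -> W) x :
  (forall b, lin (fun a => F a b)) -> (forall a, lin (F a)) ->
  sw F (ltrans b x) = \sw_(a, c <- x) F (ltrans b a) c.
Proof.
move=> F1 F2; rewrite /ltrans (lin_swE (g := sw F)) //.
under eq_sw => a c do rewrite (lin_scale (f := sw F)) // -sw_scale.
rewrite -swA; apply: eq_sw => a c.
rewrite (lin_swE (g := fun z => F z c)) //; apply: eq_sw => u v.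
by rewrite (lin_scale (f := fun z => F z c)).
Qed.

Lemma rtrans_colinear (W : vectType k) (F : H -> H -> W) x :
  (forall b, lin (fun a => F a b)) -> (forall a, lin (F a)) ->
  sw F (rtrans b x) = \sw_(a, c <- x) F a (rtrans b c).
Proof.
move=> F1 F2; rewrite /rtrans (lin_swE (g := sw F)) //.
under eq_sw => a c do rewrite (lin_scale (f := sw F)) // -sw_scale.
rewrite swA; apply: eq_sw => a c.
rewrite (lin_swE (g := F a)) //; apply: eq_sw => u v.
by rewrite (lin_scale (f := F a)).
Qed.

Lemma counit_ltrans x : eps (ltrans b x) = b x.
Proof.
rewrite /ltrans (lin_swE (g := counit)) // -[RHS](swr (f := b : H -> k^o)) //.
by apply: eq_swk => a c; rewrite (lin_scale (f := counit)) // [LHS]mulrC.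
Qed.

Lemma counit_rtrans x : eps (rtrans b x) = b x.
Proof.
rewrite /rtrans (lin_swE (g := counit)) // -[RHS](swl (f := b : H -> k^o)) //.
by apply: eq_swk => a c; rewrite (lin_scale (f := counit)) // [LHS]mulrC.
Qed.

Lemma ltrans_rtrans (c : H -> k) x : lin (c : H -> k^o) ->
  ltrans c (rtrans b x) = rtrans b (ltrans c x).
Proof.
move=> c_lin.
rewrite {1}/ltrans rtrans_colinear //.
have bl := lin_rtrans b.
rewrite /ltrans (lin_swE (g := rtrans b)) //; apply: eq_sw => u v.
by rewrite (lin_scale (f := rtrans b)).
Qed.

End Functional.

Section Character.
Context (al : H -> k).
Hypothesis al_lin : lin (al : H -> k^o).
Hypothesis al1 : al 1 = 1.
Hypothesis alM : forall x y, al (x * y) = al x * al y.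

Lemma ltransM x y : ltrans al (x * y) = ltrans al x * ltrans al y.
Proof.
rewrite /ltrans swM // (lin_swE (g := fun z => z * _)) //; apply: eq_sw => a b.
rewrite (lin_swE (g := fun z => _ * z)) //; apply: eq_sw => c d.
by rewrite alM -scalerAl -scalerAr scalerA.
Qed.

Lemma ltrans_inj : injective (ltrans al).
Proof.
have K : cancel (ltrans al) (ltrans (fun x => al (S x))).
  move=> x; rewrite {1}/ltrans ltrans_colinear //.
  rewrite -[RHS](swl (f := fun z => z)) //; apply: eq_sw => a b; congr (_ *: _).
  rewrite /ltrans (lin_swE (g := fun z => al (S z) : k^o)) //.
  transitivity (\sw_(u, v <- a) (al (u * S v) : k^o)).
    by apply: eq_swk => u v; rewrite alM linearZ /= (lin_scale _ _ al_lin).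
  by rewrite (sw_Sr (G := al : H -> k^o)) // al1 [LHS]mulr1.
exact: can_inj K.
Qed.

(** Both are convolution inverses of the character composed with [S]; that values commute in the
    field makes this composite multiplicative in the order needed. *)
Lemma character_antipode2 x : al (S (S x)) = al x.
Proof.
transitivity
  (\sw_(a, b <- x) \sw_(c, d <- b) (al (S (S a)) * al (S c * d) : k^o)).
  rewrite (sw_rSl (G := fun a z => al (S (S a)) * al z : k^o)) //.
  by rewrite al1 mulr1.
transitivity (\sw_(a, b <- x) \sw_(c, d <- b) (al (S (S a * c)) * al d : k^o)).
  apply: eq_swk => a b; apply: eq_swk => c d.
  by rewrite antipodeM !alM mulrA [al (S (S a)) * _]mulrC.
rewrite (sw_lSl (G := fun z d => al (S z) * al d : k^o)) //.
by rewrite antipode1 al1 mul1r.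
Qed.

(** Left and right translations have the same counits, also after iteration, and an operator
    colinear in the second leg is recovered from its counit. *)
Lemma iter_rtrans_id m : (forall x, iter m (ltrans al) x = x) ->
  forall x, iter m (rtrans al) x = x.
Proof.
move=> Lid; have comm j x : rtrans al (iter j (ltrans al) x) =
    iter j (ltrans al) (rtrans al x).
  by elim: j => // j IH; rewrite !iterS -IH ltrans_rtrans.
have epsE j x : eps (iter j (rtrans al) x) = eps (iter j (ltrans al) x).
  elim: j x => // j IH x.
  by rewrite iterSr IH -comm iterS counit_rtrans // counit_ltrans.
have col j (W : vectType k) (F : H -> H -> W) x :
    (forall b, lin (fun a => F a b)) -> (forall a, lin (F a)) ->
    sw F (iter j (rtrans al) x) = \sw_(a, c <- x) F a (iter j (rtrans al) c).
  have rl := lin_rtrans al.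
  elim: j F => // j IH F F1 F2; rewrite iterS rtrans_colinear //.
  by rewrite (IH (fun a c => F a (rtrans al c))) // => a;
    apply: (lin_comp (F2 a)).
move=> x; rewrite -[LHS](swr (f := fun z => z)) // col //.
by under eq_sw => a c do rewrite epsE Lid; rewrite (swr (f := fun z => z)).
Qed.

End Character.
End Translations.

(** * The left ideal generated by the norm *)

Lemma ex_functional (k : fieldType) (V : vectType k) (D : {vspace V}) v :
  v \notin D -> exists f : V -> k,
    [/\ lin (f : V -> k^o), f v = 1 & forall d, d \in D -> f d = 0].
Proof.
move=> vD; pose w := v - projv D v.
have w0 : w != 0.
  apply: contraNneq vD => /eqP; rewrite subr_eq0 => /eqP ->.
  exact: memv_proj.
have [i ci] : exists i, coord (vbasis {:V}) i w != 0.
  apply/existsP/contraT; rewrite negb_exists => /forallP c0.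
  by case/negP: w0; rewrite [w]vbasis_sum big1 // => i _;
     have := c0 i; rewrite negbK => /eqP->; rewrite scale0r.
pose c := coord (vbasis {:V}) i.
exists (fun x => (c w)^-1 * c (x - projv D x)); split.
- have dl : lin (fun x => x - projv D x).
    by move=> a x y; rewrite linearP opprD addrACA -scalerBr.
  apply: (lin_kmull (f := fun x => c (x - projv D x) : k^o)).
  exact: (lin_comp (lin_coord (vbasis {:V}) i) dl).
- by rewrite mulVf.
by move=> d dD; rewrite projv_id // subrr /c linear0 mulr0.
Qed.

Section NormIdeal.
Context (k : closedFieldType) (H : hopfType k) (gT : finGroupType) (r n : nat).
Context (io : gT -> H) (u : 'I_r.+1 -> H).
Local Notation p := r.+1.
Local Notation S := (antipode : H -> H).
Local Notation eps x := (counit x : k).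
Hypothesis charp : p \in [pchar k].
Hypothesis dimH : \dim {:H} = (p ^ n)%N.
Hypothesis cardG : (p * #|gT|)%N = \dim {:H}.
Hypothesis ncss : ~ cosemisimple H.
Hypothesis io_inj : injective io.
Hypothesis ioM : forall x y, io (x * y)%g = io x * io y.
Hypothesis io1 : io 1%g = 1.
Hypothesis io_gl : forall x, grouplike (io x).
Hypothesis io_surj : forall g, grouplike g -> exists x, io x = g.
Local Notation N := (group_norm io).
Hypothesis uio_indep : indep (fun ix : 'I_p * gT => u ix.1 * io ix.2).
Hypothesis uN_indep : indep (fun i => u i * N).
Hypothesis uN_span : forall x, exists c : 'I_p -> k,
  x * N = \sum_i c i *: (u i * N).

Let S2 x := S (S x).
Let Sv2 x := antipodeV H (antipodeV H x).

Let S2M x y : S2 (x * y) = S2 x * S2 y. Proof. by rewrite /S2 !antipodeM. Qed.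
Let S2io x : S2 (io x) = io x. Proof. exact: antipode2_grouplike. Qed.
Let S2N : S2 N = N.
Proof.
by rewrite /S2 /group_norm !linear_sum; apply: eq_bigr => x _; apply: S2io.
Qed.
Let S2K x : Sv2 (S2 x) = x. Proof. by rewrite /Sv2 /S2 !antipodeK. Qed.
Let Sv2N : Sv2 N = N. Proof. by rewrite -{1}S2N S2K. Qed.
Let S2_lin : lin S2. Proof. by rewrite /S2; lin. Qed.
Let Sv2_lin : lin Sv2. Proof. by rewrite /Sv2; lin. Qed.
Let ioN x : io x * N = N. Proof. exact: io_group_norm. Qed.
Let Nio x : N * io x = N. Proof. exact: group_norm_io. Qed.

Lemma ex_coordinates : exists phi : 'I_p -> H -> k,
  (forall i, lin (phi i : H -> k^o)) /\
  forall i j, phi i (u j * N) = (i == j)%:R.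
Proof. exact: indep_dual uN_indep. Qed.

Context (phi : 'I_p -> H -> k).
Hypothesis phi_lin : forall i, lin (phi i : H -> k^o).
Hypothesis phiE : forall i j, phi i (u j * N) = (i == j)%:R.

(* The coordinates on the left ideal H N, and the matrix of an operator that
   preserves it; row vectors, so composition is reversed. *)
Definition rowof (y : H) : 'rV[k]_p := \row_j phi j y.
Definition mxof_op (O : H -> H) : 'M[k]_p := \matrix_(i, j) phi j (O (u i * N)).

Lemma lin_rowof : lin rowof.
Proof. by move=> c x y; apply/rowP => j; rewrite !mxE phi_lin. Qed.

Lemma rowofK x : x * N = \sum_i rowof (x * N) 0 i *: (u i * N).
Proof.
have [c E] := uN_span x; rewrite {1}E; apply: eq_bigr => i _; congr (_ *: _).
rewrite mxE E (lin_sum _ _ _ (phi_lin i)) (bigD1 i) //= big1 => [|j ji].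
  by rewrite (lin_scale _ _ (phi_lin i)) phiE eqxx addr0 [RHS]mulr1.
by rewrite (lin_scale _ _ (phi_lin i)) phiE eq_sym (negPf ji) scaler0.
Qed.

Lemma rowof_inj x y : rowof (x * N) = rowof (y * N) -> x * N = y * N.
Proof. by move=> E; rewrite rowofK E -rowofK. Qed.

Definition preserves (O : H -> H) : Prop :=
  lin O /\ forall x, exists y, O (x * N) = y * N.

Lemma rowof_op O x : lin O -> rowof (O (x * N)) = rowof (x * N) *m mxof_op O.
Proof.
move=> Ol; rewrite [in LHS]rowofK (lin_sum _ _ _ Ol) (lin_sum _ _ _ lin_rowof).
apply/rowP => j; rewrite summxE !mxE; apply: eq_bigr => i _.
by rewrite (lin_scale _ _ Ol) (lin_scale _ _ lin_rowof) !mxE.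
Qed.

Lemma rowof_u i : rowof (u i * N) = delta_mx 0 i.
Proof. by apply/rowP => j; rewrite !mxE phiE eqxx. Qed.

Lemma mxof_opP O (A : 'M[k]_p) : lin O ->
  (forall x, rowof (O (x * N)) = rowof (x * N) *m A) -> mxof_op O = A.
Proof.
move=> Ol OA; apply/row_matrixP => i; rewrite !rowE -rowof_u.
by rewrite -rowof_op // OA.
Qed.

Lemma eq_mxof_op O O' : (forall x, O (x * N) = O' (x * N)) ->
  mxof_op O = mxof_op O'.
Proof. by move=> OO'; apply/matrixP => i j; rewrite !mxE OO'. Qed.

Lemma mxof_op_comp O O' : lin O -> preserves O' ->
  mxof_op (fun x => O (O' x)) = mxof_op O' *m mxof_op O.
Proof.
move=> Ol [O'l O'N]; apply: mxof_opP => [|x]; first exact: lin_comp.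
by have [y E] := O'N x; rewrite mulmxA -rowof_op // E rowof_op.
Qed.

Lemma mxof_op_id : mxof_op id = 1%:M.
Proof. by apply: mxof_opP => // x; rewrite mulmx1. Qed.

Lemma preserves_comp O O' : preserves O -> preserves O' ->
  preserves (fun x => O (O' x)).
Proof.
move=> [Ol ON] [O'l O'N]; split=> [|x]; first exact: lin_comp.
by have [y ->] := O'N x; apply: ON.
Qed.

Lemma preserves_iter O j : preserves O -> preserves (iter j O).
Proof.
move=> OP; elim: j => [|j IH]; last exact: preserves_comp.
by split=> // x; exists x.
Qed.

Lemma mxof_op_iter O j : preserves O -> mxof_op (iter j O) = mxof_op O ^+ j.
Proof.
move=> OP; elim: j => [|j IH]; first exact: mxof_op_id.
rewrite exprSr -IH -mulmxE -mxof_op_comp //; first by case: OP.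
exact: preserves_iter.
Qed.

Lemma group_norm_fix_right x y : x * N * io y = x * N.
Proof. by rewrite -mulrA Nio. Qed.

(** These are the functionals that factor through H / H k[G]^+; their translations commute with
    right multiplication by G and so act on H N. *)
Definition ginv (b : H -> k) : Prop :=
  lin (b : H -> k^o) /\ forall h x, b (h * io x) = b h.

Lemma ltrans_N b x : ginv b -> ltrans b (x * N) = ltrans b x * N.
Proof.
case=> bl bG; rewrite mulr_sumr mulr_sumr.
rewrite (lin_sum _ _ _ (lin_ltrans b)); apply: eq_bigr => g _.
rewrite /ltrans swM // (lin_swE (g := fun z => z * io g)) //.
by apply: eq_sw => a c; rewrite sw_grouplike // bG scalerAl.
Qed.

Lemma rtrans_N b x : ginv b -> rtrans b (x * N) = rtrans b x * N.
Proof.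
case=> bl bG; rewrite mulr_sumr mulr_sumr.
rewrite (lin_sum _ _ _ (lin_rtrans b)); apply: eq_bigr => g _.
rewrite /rtrans swM // (lin_swE (g := fun z => z * io g)) //.
by apply: eq_sw => a c; rewrite sw_grouplike // bG scalerAl.
Qed.

Lemma ltrans_preserves b : ginv b -> preserves (ltrans b).
Proof.
move=> bG; split=> [|x]; first exact: lin_ltrans.
by exists (ltrans b x); apply: ltrans_N.
Qed.

Lemma rtrans_preserves b : ginv b -> preserves (rtrans b).
Proof.
move=> bG; split=> [|x]; first exact: lin_rtrans.
by exists (rtrans b x); apply: rtrans_N.
Qed.

Lemma S2_preserves : preserves S2.
Proof. by split=> // x; exists (S2 x); rewrite S2M S2N. Qed.

Lemma Sv2_preserves : preserves Sv2.
Proof.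
by split=> // x; exists (Sv2 x); rewrite /Sv2 !antipodeVM -/(Sv2 N) Sv2N.
Qed.

Lemma mulN_preserves g : preserves (fun x => g * x).
Proof. by split=> [|x]; [lin | exists (g * x); rewrite mulrA]. Qed.

(* Uses Radford's formula: on H N the operator S^4 is a product of operators of
   p-power order. *)
Lemma S2_order : mxof_op S2 ^+ (2 * p ^ n) = 1.
Proof.
have [l [l_int l_neq0]] := ex_right_integral H.
have [L LE] := ex_dual_integral l_int l_neq0.
pose al := modular l L; pose g := dist_grouplike l L.
have al_lin : lin (al : H -> k^o) := lin_modular l_int L.
have al1 : al 1 = 1 := modular1 LE.
have alM : forall x y, al (x * y) = al x * al y := modularM l_int l_neq0 LE.
have gg : grouplike g := grouplike_dist l_int l_neq0 LE.
have gp x : io x ^+ (p ^ n) = 1.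
  have dv : (#|[set: gT]| %| p ^ n)%N by rewrite cardsT -dimH -cardG dvdn_mull.
  have /eqP := order_dvdG (in_setT x) => _.
  have xe : (x ^+ (p ^ n) = 1)%g.
    by apply/eqP; rewrite -order_dvdn (dvdn_trans _ dv) ?order_dvdG ?inE.
  suff ioX j : io (x ^+ j)%g = io x ^+ j by rewrite -ioX xe io1.
  by elim: j => [|j IH]; rewrite ?io1 // expgS exprS ioM IH.
(* Characters take G to roots of unity of p-power order in k, so only to 1; this makes [al] constant
   on cosets. *)
have al_g h : grouplike h -> al h = 1.
  move=> /io_surj [x <-]; apply: (expr_pchar_eq1 charp (m := n)).
  have alX j : al (io x ^+ j) = al (io x) ^+ j.
    by elim: j => [|j IH]; rewrite ?al1 // !exprS alM IH.
  by rewrite -alX gp al1.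
have alG : ginv al by split=> // h x; rewrite alM (al_g _ (io_gl x)) mulr1.
pose U := ltrans al; pose V := rtrans al.
have U_id x : iter (p ^ n) U x = x.
  apply: (translation_unipotent charp dimH) => //.
  - exact: ltrans_inj.
  - exact: lin_ltrans.
  - exact: ltransM.
  by move=> W F y F1 F2; apply: ltrans_colinear.
have V_id x : iter (p ^ n) V x = x by apply: iter_rtrans_id.
have g_id x : iter (p ^ n) (fun z => g * z) x = x.
  have [y gy] := io_surj gg.
  suff E j : iter j (fun z => g * z) x = g ^+ j * x by rewrite E -gy gp mul1r.
  by elim: j => [|j IH]; rewrite ?mul1r // iterS IH exprS mulrA.
have Upres := ltrans_preserves alG; have Vpres := rtrans_preserves alG.
have gpres := mulN_preserves g.
have S4pres := preserves_comp S2_preserves S2_preserves.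
(* In Radford's formula the right factor g is absorbed by N. *)
have S4 x : S2 (S2 (U (x * N))) = g * V (x * N).
  have [y gy] := io_surj gg.
  have := radford_S4 l_int l_neq0 LE (x * N); rewrite -/al -/g => <-.
  rewrite -/(ltrans al (x * N)) -/(S2 _) -/(S2 (ltrans _ _)) -/U.
  by rewrite [U _]ltrans_N // !S2M !S2N -gy group_norm_fix_right.
pose A1 := mxof_op S2; pose A2 := mxof_op U.
pose A3 := mxof_op (fun x => g * x); pose A4 := mxof_op V.
have idE O : (forall x, iter (p ^ n) O x = x) -> preserves O ->
    mxof_op O ^+ (p ^ n) = 1.
  move=> Oid OP; rewrite -mxof_op_iter // (eq_mxof_op (O' := id)) //.
  exact: mxof_op_id.
have comp O O' : preserves O -> preserves O' ->
    mxof_op (fun x => O (O' x)) = mxof_op O' * mxof_op O.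
  by case=> Ol _ O'P; apply: mxof_op_comp.
have A_S4 : A2 * A1 ^+ 2 = A4 * A3.
  rewrite expr2 -!comp //; try exact: S2_preserves.
  exact: eq_mxof_op.
have comm12 : GRing.comm A2 (A1 ^+ 2).
  apply: commrX; rewrite /GRing.comm -!comp //; try exact: S2_preserves.
  apply: eq_mxof_op => x; rewrite /U /ltrans (lin_swE (g := S2)) //.
  rewrite sw_antipode2 //; apply: eq_sw => a b.
  by rewrite (lin_scale _ _ S2_lin) character_antipode2.
have comm34 : GRing.comm A4 A3.
  rewrite /GRing.comm -!comp //; apply: eq_mxof_op => x.
  rewrite /V /rtrans (lin_swE (g := fun z => g * z)) //.
  rewrite (swM g) // (sw_grouplike _ _ gg) //; apply: eq_sw => a b.
  by rewrite alM (al_g g gg) mul1r scalerAr.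
have := congr1 (fun X => X ^+ (p ^ n)) A_S4.
rewrite !exprMn_comm // [A2 ^+ _]idE // [A4 ^+ _]idE // [A3 ^+ _]idE //.
by rewrite !mul1r -expr2 -exprM mulnC.
Qed.

Definition trf (f : H -> k) (h : H) : k := \sum_x f (h * io x).

Lemma lin_trf f : lin (f : H -> k^o) -> lin (trf f : H -> k^o).
Proof.
move=> fl; apply: (lin_sumf (F := fun x h => f (h * io x) : k^o)) => x.
exact: (lin_comp (g := f : H -> k^o)).
Qed.

Lemma ginv_trf f : lin (f : H -> k^o) -> ginv (trf f).
Proof.
move=> fl; split=> [|h y]; first exact: lin_trf.
rewrite /trf [RHS](reindex_inj (mulgI y)) /=; apply: eq_bigr => x _.
by rewrite ioM mulrA.
Qed.

(** Expanding x N over the group puts a factor from G in both legs. In the second leg S^2 fixes it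
    and N absorbs it, so the sum falls on [f] alone. *)
Lemma ltrans_trf_N f x : lin (f : H -> k^o) ->
  (\sw_(a, b <- x * N) (f a *: S2 b)) * N = S2 (ltrans (trf f) (x * N)).
Proof.
move=> fl; rewrite ltrans_N ?S2M ?S2N; last exact: ginv_trf.
have Fl : lin (sw (fun a b => f a *: S2 b)) by lin.
rewrite [x * N]mulr_sumr (lin_sum _ _ _ Fl).
rewrite /ltrans (lin_swE (g := S2)) // (lin_swE (g := fun z => z * N)) //.
under [RHS]eq_sw => a b do
  rewrite /trf (lin_scale _ _ S2_lin) scaler_suml mulr_suml.
rewrite sw_sum mulr_suml; apply: eq_bigr => g _.
rewrite (swM x) // (lin_swE (g := fun z => z * N)) //; apply: eq_sw => a b.
rewrite (sw_grouplike _ _ (io_gl g)) // S2M S2io.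
by rewrite -!scalerAl -mulrA ioN.
Qed.

(** Both are the trace of h |-> f(h1) S^2(h2) N, whose image lies in H N. *)
Lemma trace_trf f : lin (f : H -> k^o) ->
  \tr (mxof_op (ltrans (trf f)) *m mxof_op S2) = trint f N.
Proof.
move=> fl; have Fl : lin (sw (fun a b => f a *: S2 b)) by lin.
rewrite -mxof_op_comp //; last exact/ltrans_preserves/ginv_trf.
pose psi i h := phi i ((\sw_(a, b <- h) (f a *: S2 b)) * N).
have psil i : lin (psi i : H -> k^o).
  by apply: (lin_comp (g := phi i : H -> k^o)) => //; lin.
transitivity (\sum_i psi i (u i * N)).
  by apply: eq_bigr => i _; rewrite mxE /psi ltrans_trf_N.
rewrite -(vtr_family (fun i => u i * N) psil); apply: eq_vtr => h.
transitivity ((\sw_(a, b <- h) (f a *: S2 b)) * N).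
  by rewrite [RHS]rowofK; apply: eq_bigr => i _; rewrite mxE.
by rewrite (lin_swE (g := fun z => z * N)) //; apply: eq_sw => a b;
  rewrite scalerAl.
Qed.

(** For a right integral t and g in G, t(g) g = t(g) 1. So t(g) = 0 unless g = 1, and t(1) = 0 since
    H is not cosemisimple. *)
Lemma trint_N f : lin (f : H -> k^o) -> trint f N = 0.
Proof.
move=> fl; have ti := trint_right fl.
have t1 := rint1_eq0 ti ncss; case: ti => tl ti.
rewrite (lin_sum _ _ _ tl) big1 // => g _.
have := ti (io g); rewrite sw_grouplike // => E.
case: (eqVneq (trint f (io g)) 0) => // tg; move/(scalerI tg): E => E.
by rewrite E t1 eqxx in tg.
Qed.

Lemma ltrans_comp (b c : H -> k) x : lin (b : H -> k^o) -> lin (c : H -> k^o) ->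
  ltrans c (ltrans b x) = ltrans (fun y => \sw_(a, d <- y) (b a * c d : k^o)) x.
Proof.
move=> bl cl; rewrite {1}/ltrans ltrans_colinear // /ltrans.
transitivity (\sw_(a, d <- x) \sw_(a', e <- d) ((b a * c a') *: e)).
  rewrite -swA; apply: eq_sw => a d.
  rewrite (lin_swE (g := fun z => c z *: d)) //.
  by apply: eq_sw => a' e; rewrite (lin_scale _ _ cl).
rewrite -swA; apply: eq_sw => a d; rewrite -[RHS]/((_ : k^o) *: _).
by rewrite (lin_swE (g := fun z : k^o => (z : k) *: d)).
Qed.

Lemma trf_conv (b f : H -> k) : ginv b -> lin (f : H -> k^o) ->
  trf (fun y => \sw_(a, d <- y) (b a * f d : k^o))
    =1 fun y => \sw_(a, d <- y) (b a * trf f d : k^o).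
Proof.
move=> [bl bG] fl h; rewrite /trf.
transitivity (\sw_(a, d <- h) (\sum_x b a * f (d * io x) : k^o)); last first.
  by apply: eq_swk => a d; rewrite mulr_sumr.
rewrite sw_sum; apply: eq_bigr => g _; rewrite swM //.
  by apply: eq_swk => a d; rewrite (sw_grouplike _ _ (io_gl g)) // bG.
Qed.

Lemma lin_conv (b f : H -> k) : lin (b : H -> k^o) -> lin (f : H -> k^o) ->
  lin (fun y => \sw_(a, d <- y) (b a * f d : k^o) : k^o).
Proof. by move=> bl fl; lin. Qed.

(** Here freeness enters: [f] is the counit on the representatives [u i] and 0 on the other basis
    elements [u i * io x]. This puts the identity into the operator algebra. *)
Lemma ex_trf_counit : exists2 f : H -> k, lin (f : H -> k^o) &
  trf f =1 fun h => eps h.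
Proof.
have [psi [psil psiE]] := indep_dual uio_indep.
pose f h : k := \sum_i eps (u i) * psi (i, 1%g) h.
have fl : lin (f : H -> k^o).
  by apply: (lin_sumf (F := fun i h => eps (u i) * psi (i, 1%g) h : k^o)).
exists f => // h; have cE : #|{: 'I_p * gT}| = \dim {:H}.
  by rewrite card_prod card_ord.
have [c ->] := indep_span uio_indep cE h.
have tl := lin_trf fl.
rewrite (lin_sum _ _ _ tl) linear_sum /=; apply: eq_bigr => -[i x] _ /=.
rewrite (lin_scale _ _ tl) linearZ /=
  counitM (counit_grouplike (io_gl x)) mulr1.
rewrite -[LHS]/(c (i, x) * _) -[RHS]/(c (i, x) * _); congr (_ * _);
  rewrite /trf (bigD1 x^-1%g) //= big1 ?addr0 => [|y yx].
  rewrite -mulrA -ioM mulgV; rewrite /f (bigD1 i) //= big1 ?addr0 => [|j ji].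
    by rewrite (psiE (i, 1%g) (i, 1%g)) eqxx mulr1.
  by rewrite (psiE (j, 1%g) (i, 1%g)) xpair_eqE (negPf ji) mulr0.
rewrite -mulrA -ioM /f big1 // => j _.
rewrite (psiE (j, 1%g) (i, x * y)%g) xpair_eqE.
rewrite [1%g == _]eq_sym -eq_invg_mul (eq_sym _ y) (negPf yx) andbF.
exact: mulr0.
Qed.

Lemma ex_trf_space : exists BB : {vspace 'M[k]_p},
  (forall f, lin (f : H -> k^o) -> mxof_op (ltrans (trf f)) \in BB) /\
  forall X, X \in BB ->
    exists2 f, lin (f : H -> k^o) & X = mxof_op (ltrans (trf f)).
Proof.
pose F (L : 'Hom(H, k^o)) := mxof_op (ltrans (trf L)).
have Fl : lin F.
  move=> c L L'; apply/matrixP => i j; rewrite !mxE.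
  rewrite -[RHS]/(c *: (_ : k^o) + (_ : k^o)) -(phi_lin j); congr (phi j _).
  have tE h : trf (c *: L + L')%R h = c * trf L h + trf L' h.
    rewrite /trf mulr_sumr -big_split; apply: eq_bigr => x _.
    by rewrite add_lfunE scale_lfunE.
  rewrite /ltrans -sw_scale -sw_add; apply: eq_sw => a b.
  by rewrite tE scalerDl scalerA.
have [G GE] := lin_hom Fl.
have FE (L : 'Hom(H, k^o)) (f : H -> k) :
  L =1 f -> F L = mxof_op (ltrans (trf f)).
  move=> Lf; apply: eq_mxof_op => x; apply: eq_ltrans => h.
  by apply: eq_bigr => y _; rewrite Lf.
exists (limg G); split=> [f fl|X /memv_imgP [L _ ->]].
  by have [L LE] := lin_hom fl; rewrite -(FE L) // -GE memv_img ?memvf.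
by exists (L : H -> k); rewrite ?GE //; apply: lin_linear.
Qed.

Lemma trf_id : exists2 f : H -> k, lin (f : H -> k^o) &
  mxof_op (ltrans (trf f)) = 1%:M.
Proof.
have [f fl fE] := ex_trf_counit; exists f => //.
rewrite -mxof_op_id; apply: eq_mxof_op => x; rewrite (eq_ltrans fE).
by rewrite /ltrans (swl (f := fun z => z)).
Qed.

Lemma trf_mul (b c : H -> k) : lin (b : H -> k^o) -> lin (c : H -> k^o) ->
  exists2 f : H -> k, lin (f : H -> k^o) & mxof_op (ltrans (trf f)) =
    mxof_op (ltrans (trf b)) *m mxof_op (ltrans (trf c)).
Proof.
move=> bl cl; exists (fun y => \sw_(a, d <- y) (trf b a * c d : k^o)).
  by apply: lin_conv => //; apply: lin_trf.
rewrite -mxof_op_comp; [|exact: lin_ltrans|exact/ltrans_preserves/ginv_trf].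
apply: eq_mxof_op => x; rewrite ltrans_comp; try exact: lin_trf.
by apply/eq_ltrans/trf_conv => //; apply: ginv_trf.
Qed.

Lemma ltrans_group_norm b : ginv b -> ltrans b N = b 1 *: N.
Proof.
move=> bG; rewrite -[N]mul1r ltrans_N // /ltrans sw_grouplike ?grouplike1 //.
by rewrite -scalerAl.
by case: bG => bl _; lin.
Qed.

Lemma group_norm_trf f : lin (f : H -> k^o) ->
  rowof N *m mxof_op (ltrans (trf f)) = trf f 1 *: rowof N.
Proof.
move=> fl; have tG := ginv_trf fl.
rewrite -{1}[N]mul1r -rowof_op ?mul1r; last exact: lin_ltrans.
by rewrite ltrans_group_norm // (lin_scale _ _ lin_rowof).
Qed.

Lemma rowof_eq0 x : rowof (x * N) = 0 -> x * N = 0.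
Proof.
move=> E; rewrite -[RHS](mul0r N); apply: rowof_inj.
by rewrite E mul0r (lin_0 lin_rowof).
Qed.

Lemma rowof_group_norm : rowof N != 0.
Proof.
apply: contraNneq (group_norm_neq0 io_inj io_gl) => N0.
by rewrite -[N]mul1r rowof_eq0 ?mul1r.
Qed.

Lemma trf_nilpotent f : lin (f : H -> k^o) -> trf f 1 = 0 ->
  mxof_op (ltrans (trf f)) ^+ p = 0.
Proof.
have [BB [BBf fBB]] := ex_trf_space.
have comp O O' : preserves O -> preserves O' ->
    mxof_op (fun x => O (O' x)) = mxof_op O' * mxof_op O.
  by case=> Ol _ O'P; apply: mxof_op_comp.
have tpres f' : lin (f' : H -> k^o) -> preserves (ltrans (trf f')).
  by move=> f'l; apply/ltrans_preserves/ginv_trf.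
move=> fl f1; apply: (augmentation_nil charp (v0 := rowof N) (BB := BB)
  (sg := mxof_op S2) (sgV := mxof_op Sv2) (m := n)); last 2 first.
- exact: BBf.
- by rewrite group_norm_trf // f1 scale0r.
- exact: rowof_group_norm.
- by rewrite -[1]/(1%:M); have [f0 f0l <-] := trf_id; apply: BBf.
- move=> _ _ /fBB [b bl ->] /fBB [c cl ->].
  by have [f' f'l E] := trf_mul bl cl; rewrite -[_ * _]/(_ *m _) -E; apply: BBf.
- rewrite -(comp _ _ Sv2_preserves S2_preserves).
  rewrite -[RHS]/(1%:M) -mxof_op_id; apply: eq_mxof_op => x; exact: S2K.
- move=> _ /fBB [b bl ->].
  have SBp := preserves_comp (tpres b bl) S2_preserves.
  have tl := lin_trf bl.
  rewrite -!comp //; try exact: Sv2_preserves; try exact: S2_preserves;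
    try exact: tpres.
  (* Conjugation by S^2 replaces the functional by its composite with S^2, and coset sums are
     respected because S^2 fixes G. *)
  rewrite (eq_mxof_op (O' := ltrans (trf (fun y => b (S2 y))))).
    by apply: BBf; apply: (lin_comp (g := b : H -> k^o)).
  move=> x; rewrite {1}/ltrans sw_antipode2 //.
  rewrite (lin_swE (g := Sv2)) // /ltrans; apply: eq_sw => a d.
  rewrite (lin_scale _ _ Sv2_lin) S2K; congr (_ *: _).
  by apply: eq_bigr => y _; rewrite S2M S2io.
- by rewrite -{1}[N]mul1r -rowof_op // mul1r S2N.
- exact: S2_order.
move=> _ /fBB [b bl ->]; rewrite -[_ * _]/(_ *m _) trace_trf //.
exact: trint_N.
Qed.

Lemma mulr_rowof_lin : lin (fun x => rowof (x * N)).
Proof. by apply: (lin_comp lin_rowof); lin. Qed.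

Lemma subcoalgebra_common_vector (D : {vspace H}) :
  subcoalgebra D -> D != 0%VS ->
  exists x, [/\ x \in D, x * N != 0 & forall f, lin (f : H -> k^o) ->
    ltrans (trf f) (x * N) = trf f 1 *: (x * N)].
Proof.
move=> sD D0; have [BB [BBf fBB]] := ex_trf_space.
have [R RE] := lin_hom mulr_rowof_lin.
have W0 : (R @: D)%VS != 0%VS.
  apply: contraNneq D0 => W0; rewrite -subv0; apply/subvP => d dD.
  (* The image of [D] is nonzero: if D N = 0, then eps(x) N = S(x1) x2 N = 0 on [D], so the counit
     vanishes on [D], and then [D] is 0. *)
  have DN x : x \in D -> x * N = 0.
    move=> xD; apply: rowof_eq0; rewrite -RE; apply/eqP.
    by rewrite -memv0 -W0 memv_img.
  have epsD x : x \in D -> eps x = 0.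
    move=> xD; apply/eqP; have : eps x *: N == 0.
      rewrite -[N]mul1r -(sw_Sl (G := fun z => z * N)) //.
      rewrite -memv0; apply: (sw_subcoalgebra _ _ sD xD) => // a b _ bD.
      by rewrite -mulrA DN // mulr0 mem0v.
    by rewrite scaler_eq0 (negPf (group_norm_neq0 io_inj io_gl)) orbF.
  rewrite -[d](swl (f := fun z => z)) //.
  by apply: (sw_subcoalgebra _ _ sD dD) => // a b aD _;
    rewrite epsD // scale0r mem0v.
have [] := augmentation_common_kernel (v0 := rowof N) (BB := BB) _ _ _ W0.
- by have [f0 f0l <-] := trf_id; apply: BBf.
- move=> _ _ /fBB [b bl ->] /fBB [c cl ->].
  by have [f fl <-] := trf_mul bl cl; apply: BBf.
- move=> _ /fBB [f fl ->]; rewrite group_norm_trf // => /eqP.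
  rewrite scaler_eq0 (negPf rowof_group_norm) orbF => /eqP f1.
  by exists p; apply: trf_nilpotent.
- move=> _ _ /memv_imgP [d dD ->] /fBB [f fl ->].
  rewrite RE -rowof_op; last exact: lin_ltrans.
  rewrite ltrans_N -?RE; last exact: ginv_trf.
  apply: memv_img; have tl := lin_trf fl;
    apply: (sw_subcoalgebra _ _ sD dD) => //.
  by move=> a b _ bD; apply: memvZ.
move=> _ [/memv_imgP [x xD ->]]; rewrite RE => wn0 wX; exists x; split=> //.
  by apply: contraNneq wn0 => ->; rewrite (lin_0 lin_rowof).
move=> f fl; have [f0 f0l f0E] := trf_id.
(* The operator minus its eigenvalue at N kills N, hence also x N. *)
have := wX (mxof_op (ltrans (trf f)) - trf f 1 *: 1%:M).
rewrite -{1}f0E memvB ?memvZ ?BBf // => /(_ isT).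
rewrite mulmxBr group_norm_trf // -scalemxAr mulmx1 subrr => /(_ erefl) /eqP.
rewrite mulmxBr -scalemxAr mulmx1 subr_eq0 => /eqP.
rewrite -rowof_op; last exact: lin_ltrans.
rewrite -(lin_scale _ _ lin_rowof) ltrans_N ?scalerAl; last exact: ginv_trf.
exact: rowof_inj.
Qed.

Lemma subcoalgebra_lift_norm (D : {vspace H}) : subcoalgebra D -> D != 0%VS ->
  exists2 x, x \in D & x * N = N.
Proof.
move=> sD /(subcoalgebra_common_vector sD) [x [xD xN0 xNE]].
have [ph [phl ph1 _]] : exists f : H -> k, [/\ lin (f : H -> k^o), f (x * N) = 1
    & forall d, d \in 0%VS -> f d = 0].
  by apply: ex_functional; rewrite memv0.
(* Applying any functional [f] to this element times N gives the sum of f(x1 N) ph(x2 N). This is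
   [ph] of the translate of x N by [trf f], that is, [trf f 1] = f(N). *)
exists (\sw_(a, b <- x) (ph (b * N) *: a)).
  have pl : lin (fun b => ph (b * N) : k^o).
    by apply: (lin_comp (g := ph : H -> k^o)) => //; lin.
  by apply: (sw_subcoalgebra _ _ sD xD) => // a b aD _; apply: memvZ.
apply/eqP; rewrite -subr_eq0 -memv0; apply: contraT.
case/ex_functional => f [fl f1 _]; case/eqP: (oner_neq0 k).
rewrite -f1 (lin_add _ _ fl) -scaleN1r (lin_scale _ _ fl) scaleN1r.
apply/eqP; rewrite subr_eq0; apply/eqP.
have := congr1 ph (xNE f fl); rewrite (lin_scale _ _ phl) ph1.
rewrite -[_ *: 1]/(_ * 1) mulr1.
have -> : trf f 1 = f N.
  by rewrite (lin_sum _ _ _ fl); apply: eq_bigr => g _; rewrite mul1r.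
move=> <-; rewrite ltrans_N; last exact: ginv_trf.
have tl := lin_trf fl.
rewrite /ltrans !(lin_swE (g := fun z => z * N)) //.
rewrite (lin_swE (g := f : H -> k^o)) // (lin_swE (g := ph : H -> k^o)) //.
apply: eq_swk => a b; rewrite -!scalerAl (lin_scale _ _ fl) (lin_scale _ _ phl).
rewrite -[LHS]/(_ * _) -[RHS]/(_ * _) mulrC; congr (_ * _).
by rewrite mulr_sumr (lin_sum _ _ _ fl).
Qed.

(** If no element of G were in [D], there would be a functional [Ph] that is 1 on N but vanishes on
    each D g, hence on D N; but N = x N with x in [D]. *)
Lemma subcoalgebra_grouplike (D : {vspace H}) : subcoalgebra D -> D != 0%VS ->
  exists x, io x \in D.
Proof.
move=> sD D0; apply/existsP/contraT; rewrite negb_exists => /forallP nD.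
have [x xD xN] := subcoalgebra_lift_norm sD D0.
suff [Ph [Phl Ph1 Phio PhD]] : exists f : H -> k,
    [/\ lin (f : H -> k^o), f 1 = 1,
    forall g : gT, g != 1%g -> f (io g) = 0 &
    forall y g, y \in D -> g \in enum gT -> f (y * io g) = 0].
  case/eqP: (oner_neq0 k); rewrite -Ph1.
  have <- : Ph N = Ph 1.
    rewrite (lin_sum _ _ _ Phl) (bigD1 1%g) //= big1 ?addr0 ?io1 //.
  rewrite -xN mulr_sumr (lin_sum _ _ _ Phl) big1 // => g _.
  by rewrite PhD ?mem_enum.
(* [Ph] is a convolution product with one factor for each g, vanishing on D g and equal to 1 at 1.
   Convolution is pointwise on G, so the starting functional keeps all values on G other than that
   at 1 equal to 0. *)
elim: (enum gT) => [|g t [Ph [Phl Ph1 Phio PhD]]].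
  have [f [fl fE]] := indep_dual (indep_io io_inj io_gl).
  exists (f 1%g); split=> //; first by rewrite -io1 fE eqxx.
  by move=> g g1; rewrite fE eq_sym (negPf g1).
have [psi [psil psi1 psiD]] := ex_functional (nD g^-1%g).
pose f h : k := psi (h * io g^-1%g).
have fl : lin (f : H -> k^o).
  by apply: (lin_comp (g := psi : H -> k^o)) => //; lin.
have cio c : sw (fun a b => f a * Ph b : k^o) (io c) = f (io c) * Ph (io c).
  by rewrite sw_grouplike.
exists (fun h => \sw_(a, b <- h) (f a * Ph b : k^o)); split.
- exact: lin_conv.
- by rewrite -io1 cio io1 Ph1 /f mul1r psi1 mulr1.
- by move=> c c1; rewrite cio Phio // mulr0.
move=> y c yD ct.
transitivity (\sw_(a, b <- y) (f (a * io c) * Ph (b * io c) : k^o)).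
  by rewrite swM //; apply: eq_swk => a b; rewrite sw_grouplike.
have Z : lin (fun _ : H => 0 : k^o) by move=> *; rewrite scaler0 addr0.
apply: (etrans (eq_sw_subcoalgebra (G := fun _ _ => 0 : k^o) _ _ _ _ sD yD _));
  rewrite ?sw_eq0 //.
move=> a b aD bD; move: ct; rewrite inE => /orP [/eqP ->|ct].
  by rewrite /f -mulrA -ioM mulgV io1 mulr1 psiD //; apply: mul0r.
by rewrite (PhD b) //; apply: mulr0.
Qed.

End NormIdeal.

(** * Pointedness *)

Section Pointed.
Context (k : fieldType) (H : hopfType k).

Lemma subcoalgebra_line (g : H) : grouplike g -> subcoalgebra <[g]>%VS.
Proof.
case/andP => _ /eqP gE; apply/subcoalgebraP => _ /vlineP [c ->].
by rewrite linearZ memvZ //= gE mem_tspace ?memv_line.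
Qed.

Lemma simple_line (g : H) : grouplike g -> simple_subcoalgebra <[g]>%VS.
Proof.
move=> gg; have g0 := grouplike_neq0 gg; split.
- exact: subcoalgebra_line.
- by rewrite -dimv_eq0 dim_vline g0.
move=> E _ Eg; case: (eqVneq E 0%VS) => [|E0]; [by left | right].
by apply/eqP; rewrite eqEdim Eg dim_vline g0 lt0n dimv_eq0.
Qed.

Lemma pointed_of_grouplike :
  (forall D : {vspace H}, subcoalgebra D -> D != 0%VS ->
    exists2 g, grouplike g & g \in D) -> pointed H.
Proof.
move=> Dg x; split=> [[s sP xs]|[t /allP tg xt]]; last first.
  exists [seq <[g]>%VS | g <- t]; last by rewrite big_map -span_def.
  by move=> _ /mapP [g gt ->]; apply/simple_line/tg.
suff [t tg st] : exists2 t, all (@grouplike k H) t &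
  (\sum_(D <- s) D <= <<t>>)%VS.
  by exists t => //; apply: (subvP st).
elim: s sP {xs} => [|D s IH] sP; first by exists [::]; rewrite // big_nil sub0v.
have [t tg st] : exists2 t, all (@grouplike k H) t &
  (\sum_(D <- s) D <= <<t>>)%VS.
  by apply: IH => E Es; apply: sP; rewrite inE Es orbT.
have [sD D0 Dmin] := sP D (mem_head _ _).
have [g gg gD] := Dg D sD D0.
exists (g :: t); rewrite /= ?gg // big_cons span_cons addvS //.
have [||g0|->//] := Dmin <[g]>%VS; first exact: subcoalgebra_line.
  by rewrite -memvE.
by have := grouplike_neq0 gg; rewrite -memv0 -g0 memv_line.
Qed.

End Pointed.

Theorem theorem3p5 (k : closedFieldType) (p n : nat) (H : hopfType k)
    (charp : p \in [pchar k]) (n_ge1 : (1 <= n)%N)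
    (dimH : \dim {:H} = (p ^ n)%N)
    (ncss : ~ cosemisimple H)
    (cardG : has_card (@grouplike k H) (p ^ (n - 1))%N) :
  pointed H.
Proof.
have p_pr := pcharf_prime charp; have p_gt0 := prime_gt0 p_pr.
have [s [us sP ss]] := cardG.
have cG : #|{: gl_type sP}| = (p ^ (n - 1))%N by rewrite card_gl_type.
have pG : (p.-group [set: gl_type sP])%g
  by rewrite /pgroup cardsT cG pnatX pnat_id.
have [r [u [cD uio_indep uN_indep uN_span]]] := grouplike_freeness charp pG
  (@gl_val_inj _ _ _ sP) (@gl_valM _ _ _ sP) (gl_val1 sP) (@gl_valP _ _ _ sP).
(* The dimension [r] of H N is the index p^n / p^(n-1). *)
have rp : r = p.
  apply/eqP; move/eqP: cD; rewrite dimH cG -{2}(subnK n_ge1) addn1 expnS.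
  by rewrite eqn_pmul2r // expn_gt0 p_gt0.
case: r rp => [p0|r rp] in u cD uio_indep uN_indep uN_span *.
  by rewrite -p0 in p_gt0.
rewrite -rp in charp dimH; have [phi [phil phiE]] := ex_coordinates uN_indep.
apply: pointed_of_grouplike => D sD D0.
have surj g : grouplike g -> exists x : gl_type sP, gl_val x = g.
  by move=> gg; exists (gl_sub sP gg).
have [x xD] := subcoalgebra_grouplike charp dimH cD ncss (@gl_val_inj _ _ _ sP)
  (@gl_valM _ _ _ sP) (gl_val1 sP) (@gl_valP _ _ _ sP) surj uio_indep uN_span
  phil phiE sD D0.
by exists (gl_val x) => //; apply: gl_valP.
Qed.
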